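(* Let $q$ be a prime power, $r\ge2$ an integer, and $e$ a positive integer dividing $(q^r-1)/(q-1)$ but not equal to it. Let $H_{\mathcal{N},e}(X,Y)=X^{q^{r-1}}+\cdots+X^q+X-Y^e\in\mathbb{F}_{q^r}[X,Y]$, and let $\mathcal{P}_{\mathcal{N},e}=\{(\alpha,\beta)\in\mathbb{F}_{q^r}^2\mid H_{\mathcal{N},e}(\alpha,\beta)=0,\ \beta\ne0\}$. Let $\mathcal{C}_{H_{\mathcal{N},e}}(\mathcal{P}_{\mathcal{N},e},m)$ be the corresponding $C_{ab}$ code for some $m<n=|\mathcal{P}_{\mathcal{N},e}|=e(q^r-q^{r-1})$. Then there are algorithms, uniform in $q,r,e,m$, such that encoding (computing $\operatorname{ev}_{\mathcal{P}_{\mathcal{N},e}}(f)$ for a given message polynomial $f\in\mathcal{L}(mP_\infty)$ in standard form) uses $$O\big(\mathsf{M}(m+n)\log(m+n)\big)\subset\tilde{O}(n)$$ operations in $\mathbb{F}_{q^r}$, and unencoding (recovering $f$ from the codeword $\operatorname{ev}_{\mathcal{P}_{\mathcal{N},e}}(f)$) uses $$O\big(e\,\mathsf{M}(q^r)\log(q^r)\big)\subset\tilde{O}(n)$$ operations in $\mathbb{F}_{q^r}$.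
   Context: $\mathbb{F}_{q^r}$ is the field with $q^r$ elements. $H_{\mathcal{N},e}$ is a $C_{ab}$ polynomial with $a=\deg_Y H_{\mathcal{N},e}=e$ and $b=\deg_X H_{\mathcal{N},e}=q^{r-1}$: that is, $a,b$ are coprime, $X^b$ and $Y^a$ occur in it, every monomial $X^iY^j$ occurring in it satisfies $ai+bj\le ab$, and the ideal generated by it and its two partial derivatives is the unit ideal. Its function field $\mathbb{F}_{q^r}(x,y)$, $H_{\mathcal{N},e}(x,y)=0$, has a unique place $P_\infty$ at infinity, where $x^iy^j$ has pole order $ai+bj$. For an integer $m\ge0$, the Riemann–Roch space $\mathcal{L}(mP_\infty)$ is the span of $B=\{x^iy^j\mid ai+bj\le m,\ 0\le j\le a-1\}$; an element is in standard form when written on this basis. The code is $\mathcal{C}_{H_{\mathcal{N},e}}(\mathcal{P}_{\mathcal{N},e},m)=\{\operatorname{ev}_{\mathcal{P}_{\mathcal{N},e}}(f)\mid f\in\mathcal{L}(mP_\infty)\}$, where $\operatorname{ev}_{\mathcal{P}_{\mathcal{N},e}}(f)=(f(P))_{P\in\mathcal{P}_{\mathcal{N},e}}$; for $m<n$ the evaluation map is injective, and messages are the coefficient vectors on $B$. Complexity is the number of arithmetic operations in the field in an algebraic RAM model (table lookup and insertion cost $O(1)$); implied constants are absolute. $\mathsf{M}(n)$ is the cost of multiplying two univariate polynomials over the field of degree at most $n$, taken in $O(n\log n\log\log n)\subset\tilde{O}(n)$, with $\mathsf{M}(n)/n$ nondecreasing and $\mathsf{M}(cn)\in O(\mathsf{M}(n))$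 for each constant $c$. $\tilde{O}(h)=\bigcup_{c\ge0}O(h\log^c h)$, and $\log t$ is read as $\max(1,\log t)$. *)

(* Defs.v *)
From HB Require Import structures.
From mathcomp Require Import all_boot all_order all_algebra.
From mathcomp Require Import reals exp.

Set Implicit Arguments.
Unset Strict Implicit.
Unset Printing Implicit Defensive.

Import Order.TTheory GRing.Theory Num.Theory.
Local Open Scope ring_scope.

(* Programs do not mention a field: one program runs over every finite field.
   There is an index memory holding natural numbers and a data memory holding
   field elements, both addressed indirectly by natural numbers.  Index
   arithmetic has no multiplication, so that large integers cannot be used to
   pack field computations into few index operations. *)
Inductive iexp : Type :=
| ILit of nat
| ILd of iexp
| IAdd of iexp & iexp
| ISub of iexp & iexp          (* truncated; also serves as comparison *)
| IHalf of iexp.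

Inductive fexp : Type :=
| FZero
| FOne
| FLd of iexp
| FAdd of fexp & fexp
| FSub of fexp & fexp
| FMul of fexp & fexp
| FInv of fexp.

(* [IKey a x] writes at index address [a] the rank of the field element [x] in
   the enumeration of the field: this is what makes table lookup and insertion
   keyed by field elements, and equality tests, available.
   [PMul d n a b] calls the multiplication procedure on the polynomials with
   [n + 1] coefficients stored from [a] and from [b]; the [2n + 1] coefficients
   of the result are stored from [d]. *)
Inductive cmd : Type :=
| Skip
| ISet of iexp & iexp
| IKey of iexp & fexp
| FSet of iexp & fexp
| Seq of cmd & cmd
| If of iexp & cmd & cmd
| While of iexp & cmd
| PMul of iexp & iexp & iexp & iexp.

Record state (F : Type) : Type :=
  State { imem : nat -> nat; fmem : nat -> F }.

Fixpoint ieval (im : nat -> nat) (x : iexp) : nat :=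
  match x with
  | ILit k => k
  | ILd y => im (ieval im y)
  | IAdd y z => (ieval im y + ieval im z)%N
  | ISub y z => (ieval im y - ieval im z)%N
  | IHalf y => (ieval im y)./2
  end.

Fixpoint isize (x : iexp) : nat :=
  match x with
  | ILit _ => 1
  | ILd y | IHalf y => (isize y).+1
  | IAdd y z | ISub y z => (isize y + isize z).+1
  end.

Fixpoint feval (F : fieldType) (s : state F) (x : fexp) : F :=
  match x with
  | FZero => 0
  | FOne => 1
  | FLd y => fmem s (ieval (imem s) y)
  | FAdd y z => feval s y + feval s z
  | FSub y z => feval s y - feval s z
  | FMul y z => feval s y * feval s z
  | FInv y => (feval s y)^-1
  end.

(* Every operation involving a field element (arithmetic, lookup, insertion,
   key) costs 1; every index operation costs [w].  With [w = 0] only the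
   operations on field elements are counted, with [w = 1] all operations are. *)
Fixpoint fcost (w : nat) (x : fexp) : nat :=
  match x with
  | FZero | FOne => 1
  | FLd y => (w * isize y).+1
  | FAdd y z | FSub y z | FMul y z => (fcost w y + fcost w z).+1
  | FInv y => (fcost w y).+1
  end.

(* All memory cells beyond the given data contain 0. *)
Definition load (F : fieldType) (ints : seq nat) (data : seq F) : state F :=
  State (nth 0%N ints) (nth 0 data).

(* [call s c t]: the multiplication procedure, started in the memory [s],
   stops in the memory [t] at cost [c].  It runs in a private memory, and the
   copying of the [2 (n + 1)] arguments and of the [2n + 1] results is charged
   to the caller.  The natural number in [exec] is the cost of the run. *)
Inductive exec (w : nat) (F : finFieldType)
    (call : state F -> nat -> state F -> Prop) :
    cmd -> state F -> nat -> state F -> Prop :=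
| ESkip s : exec w call Skip s 0 s
| EISet a x s :
    exec w call (ISet a x) s (w * (isize a + isize x).+1)
      (State [eta imem s with ieval (imem s) a |-> ieval (imem s) x] (fmem s))
| EIKey a x s :
    exec w call (IKey a x) s (w * isize a + fcost w x).+1
      (State [eta imem s with ieval (imem s) a |-> enum_rank (feval s x) : nat]
             (fmem s))
| EFSet a x s :
    exec w call (FSet a x) s (w * isize a + fcost w x).+1
      (State (imem s) [eta fmem s with ieval (imem s) a |-> feval s x])
| ESeq p1 p2 s c1 s1 c2 s2 :
    exec w call p1 s c1 s1 -> exec w call p2 s1 c2 s2 ->
    exec w call (Seq p1 p2) s (c1 + c2) s2
| EIfTrue x p1 p2 s c t :
    ieval (imem s) x <> 0%N -> exec w call p1 s c t ->
    exec w call (If x p1 p2) s (w * (isize x).+1 + c) t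
| EIfFalse x p1 p2 s c t :
    ieval (imem s) x = 0%N -> exec w call p2 s c t ->
    exec w call (If x p1 p2) s (w * (isize x).+1 + c) t
| EWhileTrue x p s c1 s1 c2 s2 :
    ieval (imem s) x <> 0%N -> exec w call p s c1 s1 ->
    exec w call (While x p) s1 c2 s2 ->
    exec w call (While x p) s (w * (isize x).+1 + c1 + c2) s2
| EWhileFalse x p s :
    ieval (imem s) x = 0%N ->
    exec w call (While x p) s (w * (isize x).+1) s
| EPMul d n a b s c t :
    let D := ieval (imem s) d in
    let N := ieval (imem s) n in
    let A := ieval (imem s) a in
    let B := ieval (imem s) b in
    call (load [:: N] (mkseq (fun i => fmem s (A + i)) N.+1 ++
                       mkseq (fun i => fmem s (B + i)) N.+1)) c t ->
    exec w call (PMul d n a b) s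
      (w * (isize d + isize n + isize a + isize b).+1 + (4 * N + 3) + c)
      (State (imem s)
         (fun x => if (D <= x < D + (2 * N + 1))%N then fmem t (x - D)
                   else fmem s x)).

Definition no_call (F : finFieldType) : state F -> nat -> state F -> Prop :=
  fun _ _ _ => False.

(* Programs without calls; the multiplication procedure is one of these. *)
Definition exec0 (w : nat) (F : finFieldType) :=
  exec w (@no_call F).

(* Programs whose calls execute [mul]. *)
Definition exec_with (w : nat) (mul : cmd) (F : finFieldType) :=
  exec w (@exec0 w F mul).

Definition outputs (F : Type) (t : state F) (out : seq F) : Prop :=
  mkseq (fmem t) (size out) = out.

Definition lg (R : realType) (x : R) : R := Num.max 1 (ln x).

(* [I] indexes all the parameters at once, so the constant is absolute. *)
Definition bigO (R : realType) (I : Type) (D : I -> Prop) (f g : I -> R) : Prop :=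
  exists C : R, forall i, D i -> f i <= C * g i.

Definition softO (R : realType) (I : Type) (D : I -> Prop) (f h : I -> R) : Prop :=
  exists k : nat, bigO D f (fun i => h i * lg (h i) ^+ k).

Definition positive_nat (n : nat) : Prop := (0 < n)%N.

(* Over every finite field, [mul] multiplies polynomials of degree at most [n]
   at cost at most [M n]. *)
Definition multiplication_cost (R : realType) (w : nat) (mul : cmd)
    (M : nat -> R) : Prop :=
  forall (F : finFieldType) (n : nat) (f g : {poly F}),
    (size f <= n.+1)%N -> (size g <= n.+1)%N ->
    exists c t,
      [/\ exec0 w mul
            (load [:: n] (mkseq (nth 0 f) n.+1 ++ mkseq (nth 0 g) n.+1)) c t,
          outputs t (mkseq (nth 0 (f * g)) (2 * n + 1))
        & c%:R <= M n].

Definition multiplication_growth (R : realType) (M : nat -> R) : Prop :=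
  [/\ bigO positive_nat M
        (fun n => n%:R * lg n%:R * lg (lg n%:R)),
      forall k n : nat, (0 < k <= n)%N -> M k / k%:R <= M n / n%:R
    & forall c : nat, bigO positive_nat (fun n => M (c * n)%N) M].

(* In {poly {poly F}} the outer variable is X and the inner variable is Y: the
   coefficient of X^i Y^j in f is f`_i`_j. *)
Definition degX (F : fieldType) (f : {poly {poly F}}) : nat := (size f).-1.
Definition degY (F : fieldType) (f : {poly {poly F}}) : nat := (sizeY f).-1.

(* The exponents (i, j) of the basis of L(m P_oo), by increasing j, then i. *)
Definition cab_basis (F : fieldType) (H : {poly {poly F}}) (m : nat) :
    seq (nat * nat) :=
  [seq ij <- [seq (i, j) | j <- iota 0 (degY H), i <- iota 0 m.+1]
     | (degY H * ij.1 + degX H * ij.2 <= m)%N].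

(* L(m P_oo) is the span of the x^i y^j with (i, j) in [cab_basis H m]; its
   elements are represented by their standard form, the only polynomial in
   their class modulo H all of whose monomials belong to that basis. *)
Definition riemann_roch (F : fieldType) (H : {poly {poly F}}) (m : nat)
    (f : {poly {poly F}}) : Prop :=
  forall i j : nat, f`_i`_j != 0 -> (i, j) \in cab_basis H m.

Definition message (F : fieldType) (H : {poly {poly F}}) (m : nat)
    (f : {poly {poly F}}) : seq F :=
  [seq f`_ij.1`_ij.2 | ij <- cab_basis H m].

Definition ev (F : fieldType) (pts : seq (F * F)) (f : {poly {poly F}}) :
    seq F :=
  [seq f.[P.1, P.2] | P <- pts].

Definition flat_points (F : Type) (pts : seq (F * F)) : seq F :=
  flatten [seq [:: P.1; P.2] | P <- pts].

Record params : Type := Params {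
  pq : nat; pr : nat; pe : nat; pm : nat; pF : finFieldType }.

Definition prime_power (q : nat) : Prop :=
  exists p k : nat, [/\ prime p, (0 < k)%N & q = (p ^ k)%N].

Definition H_Ne (i : params) : {poly {poly pF i}} :=
  (\sum_(k < pr i) 'X^(pq i ^ k)) - 'Y ^+ pe i.

Definition P_Ne (i : params) : {set pF i * pF i} :=
  [set P | ((H_Ne i).[P.1, P.2] == 0) && (P.2 != 0)].

Definition norm_exponent (i : params) : nat :=
  ((pq i ^ pr i - 1) %/ (pq i - 1))%N.

Definition setting (i : params) : Prop :=
  [/\ prime_power (pq i), (2 <= pr i)%N,
      [/\ (0 < pe i)%N, (pe i %| norm_exponent i)%N & pe i <> norm_exponent i]
    & #|pF i| = (pq i ^ pr i)%N].

Definition code_setting (i : params) : Prop :=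
  setting i /\ (pm i < #|P_Ne i|)%N.

Definition point_list (i : params) (pts : seq (pF i * pF i)) : Prop :=
  uniq pts /\ pts =i P_Ne i.

Definition parameters (i : params) : seq nat :=
  [:: pq i; pr i; pe i; pm i; #|P_Ne i|].

(* The points, in an arbitrary order, are part of the input, and this order is
   the one of the codeword. *)
Definition encodes_in (R : realType) (w : nat) (mul enc : cmd)
    (g : params -> R) : Prop :=
  exists C : R, forall i : params, code_setting i ->
  forall pts : seq (pF i * pF i), point_list pts ->
  forall f : {poly {poly pF i}}, riemann_roch (H_Ne i) (pm i) f ->
  exists c t,
    [/\ exec_with w mul enc
          (load (parameters i)
             (flat_points pts ++ message (H_Ne i) (pm i) f)) c t,
        outputs t (ev pts f)
      & c%:R <= C * g i].

Definition unencodes_in (R : realType) (w : nat) (mul unenc : cmd)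
    (g : params -> R) : Prop :=
  exists C : R, forall i : params, code_setting i ->
  forall pts : seq (pF i * pF i), point_list pts ->
  forall f : {poly {poly pF i}}, riemann_roch (H_Ne i) (pm i) f ->
  exists c t,
    [/\ exec_with w mul unenc
          (load (parameters i) (flat_points pts ++ ev pts f)) c t,
        outputs t (message (H_Ne i) (pm i) f)
      & c%:R <= C * g i].

(* Main.v *)
Require Import Defs.
From mathcomp Require Import all_boot all_order all_algebra.
From mathcomp Require Import cyclic finfield.
From mathcomp Require Import boolp reals exp.
From mathcomp Require Import zify ring lra.

(** Write [tr] for the polynomial X^(q^(r-1)) + ... + X^q + X: it is the trace of
    the field F of order q^r onto its subfield of order q, so the points are the
    pairs (a, c) with [tr a = c^e] and [c != 0].  As e divides
    (q^r - 1)/(q - 1), every nonzero value of the trace is an e-th power, and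
    above each a with [tr a != 0] lie exactly e points, whose ordinates form a
    coset of the group generated by a root of unity [zeta] of order e
    ([trace_norm], [same_norm], [card_points]).

    _Encoding._  A message is f = sum of f_j(X) Y^j over j < e.  With a primitive
    element g of F, evaluating the e rows f_j at all the nonzero elements g^u is
    a discrete Fourier transform of length N = q^r - 1; then, for each u, the
    polynomial in Y with coefficients f_j(g^u) is evaluated on a coset of
    <zeta>, which is a transform of length e after scaling.  Bluestein's
    identity jk = C(j+k,2) - C(j,2) - C(k,2) turns a transform of length L into
    one product of polynomials of degree O(L) ([chirp_sum], [chirpz_run]).
    There are e transforms of length N and N of length e, and e N <= 2n, so that
    the monotonicity of M(n)/n bounds all of them by O(M(n)) ([transforms_le]).

    _Unencoding._  The transforms of length e are inverted column by column.
    This gives the values of f_j only at the a with [tr a != 0].  But f_j * tr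
    vanishes at the other elements, and f_j * tr / X has degree less than N, so
    all the values of that polynomial at nonzero elements are known and an
    inverse transform yields its coefficients ([columns_recovered],
    [row_quotient_eval]).  The divisor tr / X = 1 + X^(q-1) + ... has r terms
    only, so the exact division costs O(r) per coefficient, and
    r <= log2(q^r) ([divide_rows_run]).

    _Primitive element._  The powers of every element that is not yet marked are
    listed and marked.  Two elements of the same order d generate the same
    subgroup, so each divisor d of N is paid for once, and the sum of the
    divisors of N is O(N log N) ([sum_divisors_le], [mark_powers_run]).  The
    abscissas a_k of the points and the differences a_0 - a_k exhaust F because
    the trace is additive ([translate_cover]).

    _Cost._  Programs are analysed with one unit per command; [steps_exec] turns
    unit counts into costs, the factor being a constant of the program.
    Multiplying X by X requires at least one write, so M(1) >= 1, hence
    M(n) >= n and all the linear terms are absorbed ([mul_bound_1],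
    [mul_bound_ge]). *)

Set Implicit Arguments.
Unset Strict Implicit.
Unset Printing Implicit Defensive.

Import Order.TTheory GRing.Theory Num.Theory.
Local Open Scope ring_scope.

(** * Step counting and program logic *)

Definition upd (T : Type) (f : nat -> T) (a : nat) (v : T) : nat -> T :=
  fun x => if x == a then v else f x.

Arguments upd T f a v x /.

Definition block (F : fieldType) (s : state F) (a n : nat) : {poly F} :=
  \poly_(i < n.+1) fmem s (a + i).

Section Steps.
Variables (F : finFieldType) (P : nat -> nat).

(** One unit per command; a call of the multiplication procedure is replaced by
    its specification, the product of the two blocks, and is charged [P]. *)
Inductive steps : cmd -> state F -> nat -> state F -> Prop :=
| SSkip s : steps Skip s 0 s
| SISet a x s :
    steps (ISet a x) s 1
      (State (upd (imem s) (ieval (imem s) a) (ieval (imem s) x)) (fmem s))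
| SIKey a x s :
    steps (IKey a x) s 1
      (State (upd (imem s) (ieval (imem s) a) (enum_rank (feval s x)))
             (fmem s))
| SFSet a x s :
    steps (FSet a x) s 1
      (State (imem s) (upd (fmem s) (ieval (imem s) a) (feval s x)))
| SSeq p1 p2 s c1 s1 c2 s2 :
    steps p1 s c1 s1 -> steps p2 s1 c2 s2 -> steps (Seq p1 p2) s (c1 + c2) s2
| SIf x p1 p2 s c t :
    steps (if ieval (imem s) x != 0%N then p1 else p2) s c t ->
    steps (If x p1 p2) s c.+1 t
| SWhileTrue x p s c1 s1 c2 s2 :
    ieval (imem s) x <> 0%N -> steps p s c1 s1 -> steps (While x p) s1 c2 s2 ->
    steps (While x p) s (c1 + c2).+1 s2
| SWhileFalse x p s : ieval (imem s) x = 0%N -> steps (While x p) s 1 s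
| SPMul d n a b s :
    let D := ieval (imem s) d in
    let N := ieval (imem s) n in
    let g := block s (ieval (imem s) a) N * block s (ieval (imem s) b) N in
    steps (PMul d n a b) s (4 * N + 4 + P N)
      (State (imem s)
         (fun x => if (D <= x < D + (2 * N + 1))%N then g`_(x - D)
                   else fmem s x)).

Definition run (p : cmd) (s : state F) (c : nat) (Q : state F -> Prop) : Prop :=
  exists k t, [/\ steps p s k t, (k <= c)%N & Q t].

Lemma run_weaken p s c c' (Q Q' : state F -> Prop) :
  run p s c Q -> (c <= c')%N -> (forall t, Q t -> Q' t) -> run p s c' Q'.
Proof.
move=> [k [t [st kc Qt]]] cc' QQ'; exists k, t; split=> //; last exact: QQ'.
exact: leq_trans cc'.
Qed.

Lemma run_seq p1 p2 s c1 c2 Q :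
  run p1 s c1 (fun t => run p2 t c2 Q) -> run (Seq p1 p2) s (c1 + c2) Q.
Proof.
move=> [k1 [t1 [st1 le1 [k2 [t2 [st2 le2 Qt]]]]]].
by exists (k1 + k2)%N, t2; split; [exact: SSeq st1 st2 | exact: leq_add |].
Qed.

Lemma run_if x p1 p2 s c Q :
  run (if ieval (imem s) x != 0%N then p1 else p2) s c Q ->
  run (If x p1 p2) s c.+1 Q.
Proof. by move=> [k [t [st le Qt]]]; exists k.+1, t; split=> //; apply: SIf. Qed.

Lemma run_pmul d n a b s N Q :
  ieval (imem s) n = N ->
  Q (State (imem s)
       (fun x => if (ieval (imem s) d <= x < ieval (imem s) d + (2 * N + 1))%N
                 then (block s (ieval (imem s) a) N *
                       block s (ieval (imem s) b) N)`_(x - ieval (imem s) d)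
                 else fmem s x)) ->
  run (PMul d n a b) s (4 * N + 4 + P N) Q.
Proof. by move=> <- Qt; do 2!eexists; split; [exact: SPMul | | exact: Qt]. Qed.

(** The credit [a] is a ghost: it collects the cost that an iteration spends
    beyond the flat rate [c], and the invariant may bound its total. *)
Lemma run_while_credit (I : nat -> nat -> state F -> Prop) x p n c :
  (forall k a s, (k < n)%N -> I k a s ->
     ieval (imem s) x <> 0%N /\
     exists d, run p s (c + d) (I k.+1 (a + d)%N)) ->
  (forall a s, I n a s -> ieval (imem s) x = 0%N) ->
  forall s, I 0 0 s ->
  exists a, run (While x p) s (n * c.+1 + 1 + a) (I n a).
Proof.
move=> step stop s I0.
suff H j : forall k a t, (k + j = n)%N -> I k a t ->
    exists b, run (While x p) t (j * c.+1 + 1 + b) (I n (a + b)%N).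
  by case: (H n 0%N 0%N s (add0n n) I0) => b Hb; exists b.
elim: j => [|j IH] k a t kj It.
  rewrite addn0 in kj; subst k; exists 0%N; exists 1%N, t; split=> //.
    by apply: SWhileFalse; exact: stop It.
  by rewrite addn0.
have [|nz [d [k1 [t1 [st1 le1 It1]]]]] := step k a t _ It; first by lia.
have [|b [k2 [t2 [st2 le2 It2]]]] := IH k.+1 (a + d)%N t1 _ It1; first by lia.
exists (d + b)%N, (k1 + k2).+1, t2; split; last by rewrite addnA.
- exact: SWhileTrue nz st1 st2.
- rewrite mulSn; lia.
Qed.

Lemma run_while (I : nat -> state F -> Prop) x p n c s :
  I 0%N s ->
  (forall k t, (k < n)%N -> I k t ->
     ieval (imem t) x <> 0%N /\ run p t c (I k.+1)) ->
  (forall t, I n t -> ieval (imem t) x = 0%N) ->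
  run (While x p) s (n * c.+1 + 1) (I n).
Proof.
move=> I0 step stop.
have [|||a H] :=
    @run_while_credit (fun k a t => a = 0%N /\ I k t) x p n c _ _ s _.
- move=> k a t kn [-> It]; have [nz r] := step _ _ kn It; split=> //.
  by exists 0%N; apply: run_weaken r _ _ => //; rewrite addn0.
- by move=> a t [_]; exact: stop.
- by [].
have [k [t [st le [a0 It]]]] := H.
by exists k, t; split=> //; rewrite a0 addn0 in le.
Qed.

End Steps.

Definition incr (v : nat) : cmd :=
  ISet (ILit v) (IAdd (ILd (ILit v)) (ILit 1)).

Definition For (v : nat) (x : iexp) (p : cmd) : cmd :=
  Seq (ISet (ILit v) (ILit 0))
      (While (ISub x (ILd (ILit v))) (Seq p (incr v))).

Definition iset (F : Type) (s : state F) (v x : nat) : state F :=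
  State (upd (imem s) v x) (fmem s).

Section Loops.
Variables (F : finFieldType) (P : nat -> nat).
Notation run := (@run F P).

(** The increment is part of the loop, so the body has to establish the next
    invariant for the state in which the counter has already moved. *)
Lemma run_for_credit (I : nat -> nat -> state F -> Prop) v x p n c s :
  I 0%N 0%N (iset s v 0) ->
  (forall k a t, I k a t -> imem t v = k /\ ieval (imem t) x = n) ->
  (forall k a t, (k < n)%N -> I k a t -> exists d,
     run p t (c + d) (fun u => I k.+1 (a + d)%N (iset u v (imem u v).+1))) ->
  exists a, run (For v x p) s (n * (c + 2) + 2 + a) (I n a).
Proof.
move=> I0 val step.
have [|||a H] := @run_while_credit F P I (ISub x (ILd (ILit v)))
   (Seq p (incr v)) n c.+1 _ _ (iset s v 0) _ => //.
- move=> k a t kn It; have [vE xn] := val _ _ _ It.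
  split; first by rewrite /= vE xn; lia.
  have [d H] := step k a t kn It; exists d; rewrite -addn1 addnAC.
  apply: run_seq; apply: run_weaken H _ _ => // u Iu.
  exists 1%N, (iset u v (imem u v).+1); split=> //.
  by rewrite -[X in iset u v X]addn1; exact: SISet.
- by move=> a t It; have [vE xn] := val _ _ _ It; rewrite /= vE xn subnn.
exists a; have -> : (n * (c + 2) + 2 + a = 1 + (n * c.+2 + 1 + a))%N by lia.
by apply: run_seq; exists 1%N, (iset s v 0); split=> //; exact: SISet.
Qed.

Lemma run_for (I : nat -> state F -> Prop) v x p n c s :
  I 0%N (iset s v 0) ->
  (forall k t, I k t -> imem t v = k /\ ieval (imem t) x = n) ->
  (forall k t, (k < n)%N -> I k t ->
     run p t c (fun u => I k.+1 (iset u v (imem u v).+1))) ->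
  run (For v x p) s (n * (c + 2) + 2) (I n).
Proof.
move=> I0 val step.
have [|||a H] :=
    @run_for_credit (fun k a t => a = 0%N /\ I k t) v x p n c s _ _ _ => //.
- by move=> k a t [_]; exact: val.
- move=> k a t kn [-> It]; exists 0%N; rewrite addn0.
  by apply: run_weaken (step _ _ kn It) _ _.
have [k [t [st le [a0 It]]]] := H.
by exists k, t; split=> //; rewrite a0 addn0 in le.
Qed.

End Loops.

(** A command without loop and without call has a computable final state
    [post]: reasoning about it is symbolic evaluation. *)
Fixpoint straight (p : cmd) : bool :=
  match p with
  | Skip | ISet _ _ | IKey _ _ | FSet _ _ => true
  | Seq p1 p2 | If _ p1 p2 => straight p1 && straight p2
  | While _ _ | PMul _ _ _ _ => false
  end.

Fixpoint straight_steps (p : cmd) : nat :=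
  match p with
  | ISet _ _ | IKey _ _ | FSet _ _ => 1
  | Seq p1 p2 => straight_steps p1 + straight_steps p2
  | If _ p1 p2 => (maxn (straight_steps p1) (straight_steps p2)).+1
  | _ => 0
  end.

Fixpoint post (F : finFieldType) (p : cmd) (s : state F) : state F :=
  match p with
  | ISet a x =>
      State (upd (imem s) (ieval (imem s) a) (ieval (imem s) x)) (fmem s)
  | IKey a x =>
      State (upd (imem s) (ieval (imem s) a) (enum_rank (feval s x))) (fmem s)
  | FSet a x =>
      State (imem s) (upd (fmem s) (ieval (imem s) a) (feval s x))
  | Seq p1 p2 => post p2 (post p1 s)
  | If x p1 p2 => if ieval (imem s) x != 0%N then post p1 s else post p2 s
  | _ => s
  end.

Lemma run_straight (F : finFieldType) P p (s : state F) (Q : state F -> Prop) :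
  straight p -> Q (post p s) -> run P p s (straight_steps p) Q.
Proof.
elim: p s Q => //=.
- by move=> s Q _ Qs; exists 0%N, s; split=> //; exact: SSkip.
- by move=> a x s Q _ Qs; do 2!eexists; split; [exact: SISet | | exact: Qs].
- by move=> a x s Q _ Qs; do 2!eexists; split; [exact: SIKey | | exact: Qs].
- by move=> a x s Q _ Qs; do 2!eexists; split; [exact: SFSet | | exact: Qs].
- move=> p1 IH1 p2 IH2 s Q /andP[s1 s2] Qs; apply: run_seq.
  by apply: IH1 => //; apply: IH2.
- move=> x p1 IH1 p2 IH2 s Q /andP[s1 s2] Qs; apply: run_if.
  case: ifP Qs => _ Qs.
    by apply: run_weaken (IH1 _ _ s1 Qs) _ _ => //; exact: leq_maxl.
  by apply: run_weaken (IH2 _ _ s2 Qs) _ _ => //; exact: leq_maxr.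
Qed.

(** The largest cost of a single step of [p]: multiplying by it turns a number
    of steps into a cost. *)
Fixpoint unit_cost (w : nat) (p : cmd) : nat :=
  match p with
  | Skip => 1
  | ISet a x => (w * (isize a + isize x).+1).+1
  | IKey a x | FSet a x => (w * isize a + fcost w x).+1
  | Seq p1 p2 => maxn (unit_cost w p1) (unit_cost w p2)
  | If x p1 p2 =>
      maxn (w * (isize x).+1) (maxn (unit_cost w p1) (unit_cost w p2))
  | While x p => maxn (w * (isize x).+1) (unit_cost w p)
  | PMul d n a b => (w * (isize d + isize n + isize a + isize b).+1).+1
  end.

(** Unit counts are costs up to the factor [unit_cost w p], which depends on the
    program only, whatever the weight [w] of the index operations. *)
Lemma steps_exec (F : finFieldType) (P : nat -> nat) w mul :
  (forall n (f g : {poly F}), (size f <= n.+1)%N -> (size g <= n.+1)%N ->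
    exists c t, [/\ exec0 w mul
      (load [:: n] (mkseq (nth 0 f) n.+1 ++ mkseq (nth 0 g) n.+1)) c t,
      outputs t (mkseq (nth 0 (f * g)) (2 * n + 1)) & (c <= P n)%N]) ->
  forall p (s t : state F) k, steps P p s k t ->
  exists2 c, exec_with w mul p s c t & (c <= unit_cost w p * k)%N.
Proof.
move=> mulP p s t k; elim=> {p s t k}.
- by move=> s; exists 0%N => //; exact: ESkip.
- by move=> a x s; eexists; [exact: EISet|rewrite /=; lia].
- by move=> a x s; eexists; [exact: EIKey|rewrite /=; lia].
- by move=> a x s; eexists; [exact: EFSet|rewrite /=; lia].
- move=> p1 p2 s c1 s1 c2 s2 _ [d1 e1 l1] _ [d2 e2 l2].
  exists (d1 + d2)%N; first exact: ESeq e1 e2.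
  by rewrite /= mulnDr leq_add // (leq_trans l1, leq_trans l2) // leq_mul2r;
     rewrite (leq_maxl, leq_maxr) orbT.
- move=> x p1 p2 s c t _ [d].
  have l0 := leq_maxl (w * (isize x).+1) (maxn (unit_cost w p1) (unit_cost w p2)).
  have l12 := leq_maxr (w * (isize x).+1) (maxn (unit_cost w p1) (unit_cost w p2)).
  rewrite mulnS; case: (eqVneq (ieval (imem s) x) 0%N) => [x0|xn0] ex le.
    exists (w * (isize x).+1 + d)%N; first exact: EIfFalse.
    rewrite leq_add // (leq_trans le) // leq_mul2r (leq_trans _ l12) ?orbT //.
    exact: leq_maxr.
  exists (w * (isize x).+1 + d)%N; first by apply: EIfTrue => //; apply/eqP.
  rewrite leq_add // (leq_trans le) // leq_mul2r (leq_trans _ l12) ?orbT //.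
  exact: leq_maxl.
- move=> x p s c1 s1 c2 s2 nz _ [d1 e1 l1] _ [d2 e2 l2].
  exists (w * (isize x).+1 + d1 + d2)%N; first exact: EWhileTrue e1 e2.
  rewrite [leqRHS]mulnS mulnDr addnA leq_add // leq_add ?leq_maxl //.
  by rewrite (leq_trans l1) // leq_mul2r leq_maxr orbT.
- move=> x p s x0; eexists; first exact: EWhileFalse.
  rewrite /=; lia.
- move=> d n a b s D N g.
  have sz A : (size (block s A N) <= N.+1)%N by exact: size_poly.
  have [c [t [ex out le]]] := mulP N _ _ (sz (ieval (imem s) a))
                                        (sz (ieval (imem s) b)).
  exists (w * (isize d + isize n + isize a + isize b).+1 +
          (4 * N + 3) + c)%N; last first.
    rewrite [leqRHS]/= mulSn.
    set X := (w * _)%N; have : (X <= X * (4 * N + 4 + P N))%N.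
      by apply: leq_pmulr; lia.
    lia.
  have -> : (fun x => if (D <= x < D + (2 * N + 1))%N then g`_(x - D)
                   else fmem s x) =
            (fun x => if (D <= x < D + (2 * N + 1))%N then fmem t (x - D)
                   else fmem s x).
    apply: funext => x; case: ifP => // /andP[Dx xD].
    move: out; rewrite /outputs size_mkseq => /(congr1 (nth 0 ^~ (x - D)%N)).
    by rewrite !nth_mkseq //; lia.
  apply: EPMul; rewrite -/N.
  have coefs A : mkseq (nth 0 (block s A N)) N.+1 =
                 mkseq (fun i => fmem s (A + i)) N.+1.
    apply/eq_in_map => i.
    by rewrite mem_iota /= add0n coef_poly => ->.
  by move: ex; rewrite !coefs.
Qed.

(** * Notations for programs and memory layout *)

Declare Scope iexp_scope.
Delimit Scope iexp_scope with ix.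
Declare Scope fexp_scope.
Delimit Scope fexp_scope with fx.
Declare Scope prog_scope.
Delimit Scope prog_scope with prog.

Definition ilit_of_num (n : Number.uint) : iexp := ILit (Nat.of_num_uint n).
Definition num_of_ilit (x : iexp) : option Number.uint :=
  if x is ILit n then Some (Nat.to_num_uint n) else None.
Number Notation iexp ilit_of_num num_of_ilit : iexp_scope.

Notation "$ v" := (ILd (ILit v%N)) (at level 1, v at level 0, format "$ v").
Notation "x + y" := (IAdd x%ix y%ix) : iexp_scope.
Notation "x - y" := (ISub x%ix y%ix) : iexp_scope.
Notation "I[ a ]" := (ILd a%ix) (at level 0, a at level 99).
Notation "F[ a ]" := (FLd a%ix) (at level 0, a at level 99).
Notation "x + y" := (FAdd x%fx y%fx) : fexp_scope.
Notation "x - y" := (FSub x%fx y%fx) : fexp_scope.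
Notation "x * y" := (FMul x%fx y%fx) : fexp_scope.
Notation "x / y" := (FMul x%fx (FInv y%fx)) : fexp_scope.
Notation "x ^-1" := (FInv x%fx) : fexp_scope.
Notation "0" := FZero : fexp_scope.
Notation "1" := FOne : fexp_scope.
Notation "v <- x" := (ISet (ILit v%N) x%ix) (at level 70) : prog_scope.
Notation "I@ a <- x" := (ISet a%ix x%ix) (at level 70, a at level 8) : prog_scope.
Notation "v <- 'key' x" := (IKey (ILit v%N) x%fx) (at level 70) : prog_scope.
Notation "F@ a <- x" := (FSet a%ix x%fx) (at level 70, a at level 8) : prog_scope.
Notation "p ;; q" := (Seq p%prog q%prog)
  (at level 75, right associativity) : prog_scope.

Arguments While x%_ix p%_prog : rename.
Arguments If x%_ix p%_prog q%_prog : rename.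
Arguments PMul d%_ix n%_ix a%_ix b%_ix : rename.
Arguments For v%_N x%_ix p%_prog.

(** Index memory.  Scalars live below 32: the five parameters, the base [vz] of
    the work area, the order [vN] of the multiplicative group, loop counters,
    and the arguments [vbase], [vstride], [vlen] of a transform.  The cells from
    32 on hold three interleaved tables (addresses 32 + 3k, 33 + 3k, 34 + 3k):
    interleaving allows tables of unknown size without multiplications. *)
Notation vq := 0%N (only parsing).
Notation vr := 1%N (only parsing).
Notation ve := 2%N (only parsing).
Notation vm := 3%N (only parsing).
Notation vn := 4%N (only parsing).
Notation vz := 5%N (only parsing).
Notation vN := 6%N (only parsing).
Notation vi := 7%N (only parsing).
Notation vkey := 8%N (only parsing).
Notation vkey1 := 9%N (only parsing).
Notation vord := 10%N (only parsing).
Notation vtmp := 11%N (only parsing).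
Notation vbase := 12%N (only parsing).
Notation vstride := 13%N (only parsing).
Notation vlen := 14%N (only parsing).
Notation vj := 15%N (only parsing).
Notation vptr := 16%N (only parsing).
Notation vpow := 17%N (only parsing).
Notation vtop := 18%N (only parsing).
Notation vrow := 19%N (only parsing).
Notation vmsg := 20%N (only parsing).
Notation vu := 21%N (only parsing).
Notation vk := 22%N (only parsing).
Notation vkey2 := 23%N (only parsing).
Notation vsum := 24%N (only parsing).

(** Data memory.  The input occupies the addresses below z, the value of [vz].
    Field scalars are at z, z + 1, ...; one ordinate for each abscissa g^u is
    stored from z + 16; the three blocks of a polynomial product start at 2z,
    3z and 4z, and the matrix with e rows of length N at 5z. *)
Notation f_run := ($vz + 0)%ix (only parsing).
Notation f_chirp := ($vz + 1)%ix (only parsing).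
Notation f_cand := ($vz + 2)%ix (only parsing).
Notation f_gen := ($vz + 3)%ix (only parsing).
Notation f_root := ($vz + 4)%ix (only parsing).
Notation f_e := ($vz + 5)%ix (only parsing).
Notation f_omega := ($vz + 6)%ix (only parsing).
Notation f_tau := ($vz + 7)%ix (only parsing).
Notation f_sigma := ($vz + 8)%ix (only parsing).
Notation f_scale := ($vz + 9)%ix (only parsing).
Notation f_abs := ($vz + 10)%ix (only parsing).
Notation a_base := ($vz + 16)%ix (only parsing).
Notation a_chirp := ($vz + $vz)%ix (only parsing).
Notation a_left := ($vz + $vz + $vz)%ix (only parsing).
Notation a_prod := ($vz + $vz + $vz + $vz)%ix (only parsing).
Notation a_mat := ($vz + $vz + $vz + $vz + $vz)%ix (only parsing).

(** [mem] decides by linear arithmetic on addresses which write a read sees. *)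
Ltac mem_if :=
  match goal with
  | |- context [if (?a == ?b :> nat) then _ else _] =>
      first [ rewrite (_ : (a == b) = false); [|apply/eqP; lia]
            | rewrite (_ : (a == b) = true); [|apply/eqP; lia] ]
  | |- context [if (?a <= ?b < ?c)%N then _ else _] =>
      first [ rewrite (_ : (a <= b < c)%N = false); [|apply/negbTE; lia]
            | rewrite (_ : (a <= b < c)%N = true); [|lia] ]
  end.
Ltac mem := rewrite /= ?addn0; repeat mem_if.

Ltac same H :=
  let x := fresh "x" in let xV := fresh "xV" in
  move=> x; rewrite !inE => xV; mem; rewrite ?H ?inE //; lia.

(** * Chirp transform *)

(** The left factor has length L but is multiplied as a polynomial of degree 2L;
   its cells are cleared because earlier transforms of other lengths have
   written there. *)
Definition chirp_tables : cmd := (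
  F@f_run <- 1 ;; F@f_chirp <- 1 ;;
  For vj ($vlen + $vlen + 1) (
    F@(a_chirp + $vj) <- F[f_chirp] ;;
    F@(a_left + $vj) <- 0 ;;
    F@f_chirp <- F[f_chirp] * F[f_run] ;;
    F@f_run <- F[f_run] * F[f_omega]))%prog.

Definition chirp_load : cmd := (
  F@f_run <- 1 ;; vptr <- $vbase ;;
  For vj $vlen (
    F@(a_left + ($vlen - ($vj + 1))) <- F[$vptr] * F[f_run] / F[a_chirp + $vj] ;;
    F@f_run <- F[f_run] * F[f_tau] ;;
    vptr <- $vptr + $vstride))%prog.

Definition chirp_store : cmd := (
  F@f_run <- F[f_scale] ;; vptr <- $vbase ;;
  For vj $vlen (
    F@$vptr <- F[f_run] * F[a_prod + ($vlen - 1 + $vj)] / F[a_chirp + $vj] ;;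
    F@f_run <- F[f_run] * F[f_sigma] ;;
    vptr <- $vptr + $vstride))%prog.

(** In place, on the L entries at distance [vstride] from [vbase], the transform
    y_k = scale * sigma^k * sum_j x_j * tau^j * omega^(jk).  The scalars tau and
    sigma are what is needed to evaluate on a coset and to undo it. *)
Definition chirpz : cmd := (
  chirp_tables ;; chirp_load ;; PMul a_prod ($vlen + $vlen) a_left a_chirp ;;
  chirp_store)%prog.

Section Chirp.
Variables (F : finFieldType) (P : nat -> nat).
Notation run := (@run F P).

Definition chirp (om : F) (t : nat) : F := om ^+ 'C(t, 2).

Lemma chirpS om t : chirp om t.+1 = chirp om t * om ^+ t.
Proof. by rewrite /chirp binS bin1 exprD. Qed.

Lemma chirp_neq0 om t : om != 0 -> chirp om t != 0.
Proof. by move=> nz; rewrite expf_neq0. Qed.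

(** Bluestein's identity. *)
Lemma chirpD om j k : chirp om (j + k) = chirp om j * chirp om k * om ^+ (j * k).
Proof.
elim: k => [|k IH]; first by rewrite addn0 muln0 /chirp bin0n !mulr1.
rewrite addnS chirpS IH chirpS mulnS !exprD; ring.
Qed.

Definition imem_eq_off (V : seq nat) (s t : state F) : Prop :=
  forall x, x \notin V -> imem t x = imem s x.

Record chirp_input (s : state F) (z L b st : nat) (om tau sig c : F) : Prop := {
  ci_z : imem s vz = z; ci_L : imem s vlen = L;
  ci_b : imem s vbase = b; ci_st : imem s vstride = st;
  ci_om : fmem s (z + 6)%N = om; ci_tau : fmem s (z + 7)%N = tau;
  ci_sig : fmem s (z + 8)%N = sig; ci_c : fmem s (z + 9)%N = c;
  ci_L0 : (0 < L)%N; ci_Lz : (4 * L + 16 < z)%N;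
  ci_bz : (5 * z <= b)%N; ci_st0 : (0 < st)%N; ci_om0 : om != 0 }.

Lemma chirp_tables_run s z L b st om tau sig c :
  chirp_input s z L b st om tau sig c ->
  run chirp_tables s (12 * L + 10)
    (fun t => [/\ imem_eq_off [:: vj] s t,
       forall i, (i <= 2 * L)%N -> fmem t (z + z + i)%N = chirp om i,
       forall i, (i <= 2 * L)%N -> fmem t (z + z + z + i)%N = 0 &
       forall y : nat, y != z -> y != (z + 1)%N -> (y < z + z \/ 5 * z <= y)%N ->
         fmem t y = fmem s y]).
Proof.
case=> Hz HL Hb Hst Hom Htau Hsig Hc L0 Lz bz st0 om0.
pose I k (t : state F) := [/\ imem t vj = k, imem_eq_off [:: vj] s t,
  fmem t z = om ^+ k, fmem t (z + 1)%N = chirp om k &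
  [/\ forall i, (i < k)%N -> fmem t (z + z + i)%N = chirp om i,
      forall i, (i < k)%N -> fmem t (z + z + z + i)%N = 0 &
       forall y : nat, y != z -> y != (z + 1)%N -> (y < z + z \/ 5 * z <= y)%N ->
         fmem t y = fmem s y]].
apply: (@run_weaken _ _ _ _ (1 + (1 + ((2 * L + 1) * (4 + 2) + 2))) _ (I (2 * L + 1)%N)).
- apply: run_seq; apply: run_straight => //.
  apply: run_seq; apply: run_straight => //.
  apply: (@run_for _ _ I).
- split=> //=.
  + by same (fun x => erefl (imem s x)).
  + by rewrite Hz; mem.
  + by rewrite Hz; mem; rewrite /chirp bin0n.
  + by split=> // y y0 y1 yz; rewrite Hz; mem.
- move=> k t [Hk Hi _ _ _]; split=> //=.
  by rewrite (Hi vlen isT) HL; lia.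
- move=> k t kL [Hk Hi Hx Hch [HC HA Hf]].
  have Hz' : imem t vz = z by rewrite Hi.
  apply: (@run_weaken _ _ _ _ 4); [|by []|move=> u; exact: id].
  apply: run_straight => //; split=> /=.
  + by rewrite Hk.
  + by same Hi.
  + by rewrite Hz' Hk; mem; rewrite Hx Hf ?Hom ?exprSr //; lia.
  + by rewrite Hz' Hk; mem; rewrite Hx Hch chirpS.
  + rewrite Hz' Hk; split.
    * move=> i; rewrite ltnS leq_eqVlt => /predU1P[->|ik]; mem => //.
      exact: HC.
    * move=> i; rewrite ltnS leq_eqVlt => /predU1P[->|ik]; mem => //.
      exact: HA.
    * by move=> y y0 y1 yz; mem; exact: Hf.
- lia.
- move=> t [_ Hi Hx Hch [HC HA Hf]]; split=> // i iL.
    by apply: HC; lia.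
  by apply: HA; lia.
Qed.

Lemma chirp_load_run s z L b st om tau sig c t :
  chirp_input s z L b st om tau sig c -> imem_eq_off [:: vj] s t ->
  (forall i, (i <= 2 * L)%N -> fmem t (z + z + i)%N = chirp om i) ->
  (forall i, (i <= 2 * L)%N -> fmem t (z + z + z + i)%N = 0) ->
  (forall y : nat, y != z -> y != (z + 1)%N -> (y < z + z \/ 5 * z <= y)%N ->
     fmem t y = fmem s y) ->
  run chirp_load t (5 * L + 10)
    (fun u => [/\ imem_eq_off [:: vj; vptr] s u,
       forall i, (i <= 2 * L)%N -> fmem u (z + z + i)%N = chirp om i,
       forall i, (i < L)%N -> fmem u (z + z + z + (L - i.+1))%N =
         fmem s (b + i * st)%N * tau ^+ i / chirp om i,
       forall i, (L <= i <= 2 * L)%N -> fmem u (z + z + z + i)%N = 0 &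
       forall y : nat, y != z -> y != (z + 1)%N -> (y < z + z \/ 5 * z <= y)%N ->
         fmem u y = fmem s y]).
Proof.
case=> Hz HL Hb Hst Hom Htau Hsig Hc L0 Lz bz st0 om0 Ti TC TA Tf.
pose I k (u : state F) := [/\ imem u vj = k, imem u vptr = (b + k * st)%N,
  imem_eq_off [:: vj; vptr] s u, fmem u z = tau ^+ k &
  [/\ forall i, (i <= 2 * L)%N -> fmem u (z + z + i)%N = chirp om i,
      forall i, (i < k)%N -> fmem u (z + z + z + (L - i.+1))%N =
         fmem s (b + i * st)%N * tau ^+ i / chirp om i,
      forall i, (L <= i <= 2 * L)%N -> fmem u (z + z + z + i)%N = 0 &
       forall y : nat, y != z -> y != (z + 1)%N -> (y < z + z \/ 5 * z <= y)%N ->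
         fmem u y = fmem s y]].
have Hz' : imem t vz = z by rewrite Ti.
apply: (@run_weaken _ _ _ _ (1 + (1 + (L * (3 + 2) + 2))) _ (I L)).
- apply: run_seq; apply: run_straight => //.
  apply: run_seq; apply: run_straight => //.
  apply: (@run_for _ _ I).
  + split=> //=.
    * by rewrite Ti // mul0n addn0.
    * by same Ti.
    * by rewrite Hz'; mem.
    * rewrite Hz'; split=> //.
      - by move=> i iL; mem; exact: TC.
      - by move=> i iL; mem; apply: TA; lia.
      - by move=> y y0 y1 yz; mem; exact: Tf.
  + by move=> k u [Hk Hp Hi _ _]; split=> //=; rewrite Hi.
  + move=> k u kL [Hk Hp Hi Hx [HC HA H0 Hf]].
    have Hz'' : imem u vz = z by rewrite Hi.
    have HL' : imem u vlen = L by rewrite Hi.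
    have Hst' : imem u vstride = st by rewrite Hi.
    apply: (@run_weaken _ _ _ _ 3); [|by []|move=> v; exact: id].
    apply: run_straight => //; split=> /=.
    * by rewrite Hk.
    * by rewrite Hp Hst'; lia.
    * by same Hi.
    * by rewrite Hz'' HL' Hk Hp; mem; rewrite Hx Hf ?Htau ?exprSr //; lia.
    * rewrite Hz'' HL' Hk Hp; split.
      - by move=> i iL; mem; exact: HC.
      - move=> i; rewrite ltnS leq_eqVlt => /predU1P[->|ik].
          by mem; rewrite Hx HC ?Hf //; lia.
        by mem; exact: HA.
      - by move=> i iL; mem; exact: H0.
      - by move=> y y0 y1 yz; mem; exact: Hf.
- lia.
- by move=> u [_ _ Hi Hx [HC HA H0 Hf]]; split.
Qed.

(** The left factor is stored in reverse order, which turns the correlation of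
    [x] with the chirp into a product: the coefficient of degree L - 1 + k pairs
    the entry j with the chirp of index j + k. *)
Lemma chirp_sum om L (x : nat -> F) (A B : {poly F}) k :
  om != 0 -> (k < L)%N ->
  (forall i, (i < L)%N -> A`_(L - i.+1) = x i / chirp om i) ->
  (forall i, (L <= i)%N -> A`_i = 0) ->
  (forall i, (i <= 2 * L)%N -> B`_i = chirp om i) ->
  (A * B)`_(L - 1 + k) / chirp om k = \sum_(j < L) x j * om ^+ (j * k).
Proof.
move=> om0 kL HA H0 HB; rewrite coefM mulr_suml.
rewrite -(big_mkord xpredT (fun i => A`_i * B`_(L - 1 + k - i) / chirp om k)).
rewrite (big_cat_nat (n := L)) //=; last by lia.
rewrite [X in _ + X]big_nat_cond [X in _ + X]big1 ?addr0; last first.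
  by move=> i /andP[/andP[Li _] _]; rewrite H0 // !mul0r.
rewrite big_mkord (reindex_inj rev_ord_inj) /=.
apply: eq_bigr => j _; rewrite HA //.
have -> : (L - 1 + k - (L - j.+1) = j + k)%N by move: (ltn_ord j); lia.
rewrite HB; last by move: (ltn_ord j); lia.
have c1 := chirp_neq0 j om0; have c2 := chirp_neq0 k om0.
by rewrite chirpD; field; rewrite c1 c2.
Qed.

Lemma chirp_store_run s z L b st om tau sig c t :
  chirp_input s z L b st om tau sig c -> imem_eq_off [:: vj; vptr] s t ->
  (forall i, (i < L)%N -> fmem t (z + z + i)%N = chirp om i) ->
  (forall y : nat, y != z -> y != (z + 1)%N -> (y < z + z \/ 5 * z <= y)%N ->
     fmem t y = fmem s y) ->
  run chirp_store t (5 * L + 10)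
    (fun u => [/\ imem_eq_off [:: vj; vptr] s u,
       forall k, (k < L)%N -> fmem u (b + k * st)%N =
         c * sig ^+ k * (fmem t (z + z + z + z + (L - 1 + k))%N / chirp om k) &
       forall y : nat, y != z -> y != (z + 1)%N -> (y < z + z \/ 5 * z <= y)%N ->
         (forall k, (k < L)%N -> y != (b + k * st)%N) ->
         fmem u y = fmem s y]).
Proof.
case=> Hz HL Hb Hst Hom Htau Hsig Hc L0 Lz bz st0 om0 Ti TC Tf.
pose I k (u : state F) := [/\ imem u vj = k, imem u vptr = (b + k * st)%N,
  imem_eq_off [:: vj; vptr] s u, fmem u z = c * sig ^+ k &
  [/\ forall i, (i < k)%N -> fmem u (b + i * st)%N =
         c * sig ^+ i * (fmem t (z + z + z + z + (L - 1 + i))%N / chirp om i),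
      forall y : nat, (2 * z <= y < 5 * z)%N -> fmem u y = fmem t y &
      forall y : nat, y != z -> y != (z + 1)%N -> (y < z + z \/ 5 * z <= y)%N ->
         (forall i, (i < k)%N -> y != (b + i * st)%N) ->
         fmem u y = fmem s y]].
have Hz' : imem t vz = z by rewrite Ti.
apply: (@run_weaken _ _ _ _ (1 + (1 + (L * (3 + 2) + 2))) _ (I L)).
- apply: run_seq; apply: run_straight => //.
  apply: run_seq; apply: run_straight => //.
  apply: (@run_for _ _ I).
  + split=> //=.
    * by rewrite Ti // mul0n addn0.
    * by same Ti.
    * by rewrite Hz'; mem; rewrite Tf ?Hc ?mulr1 //; lia.
    * rewrite Hz'; split=> //.
      - by move=> y yz; mem.
      - by move=> y y0 y1 yz _; mem; exact: Tf.
  + by move=> k u [Hk Hp Hi _ _]; split=> //=; rewrite Hi.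
  + move=> k u kL [Hk Hp Hi Hx [HO HM Hf]].
    have Hz'' : imem u vz = z by rewrite Hi.
    have HL' : imem u vlen = L by rewrite Hi.
    have Hst' : imem u vstride = st by rewrite Hi.
    apply: (@run_weaken _ _ _ _ 3); [|by []|move=> v; exact: id].
    apply: run_straight => //; split=> /=.
    * by rewrite Hk.
    * by rewrite Hp Hst'; lia.
    * by same Hi.
    * rewrite Hz'' HL' Hk Hp; mem; rewrite Hx Hf ?Hsig ?exprSr ?mulrA //; lia.
    * rewrite Hz'' HL' Hk Hp; split.
      - move=> i; rewrite ltnS leq_eqVlt => /predU1P[->|ik].
          by mem; rewrite Hx HM ?HM ?TC ?mulrA //; lia.
        have : (i * st < k * st)%N by rewrite ltn_pmul2r.
        by move=> ikst; mem; exact: HO.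
      - by move=> y yz; mem; exact: HM.
      - move=> y y0 y1 yz yb; have := yb k (ltnSn k); move/eqP=> ybk; mem.
        by apply: Hf => // i ik; apply: yb; lia.
- lia.
- by move=> u [_ _ Hi Hx [HO HM Hf]]; split.
Qed.

Lemma chirpz_run s z L b st om tau sig c :
  chirp_input s z L b st om tau sig c ->
  run chirpz s (30 * L + 34 + P (2 * L))
    (fun t => [/\ imem_eq_off [:: vj; vptr] s t,
       forall k, (k < L)%N -> fmem t (b + k * st)%N = c * sig ^+ k *
         \sum_(j < L) fmem s (b + j * st)%N * tau ^+ j * om ^+ (j * k) &
       forall y : nat, y != z -> y != (z + 1)%N -> (y < z + z \/ 5 * z <= y)%N ->
         (forall k, (k < L)%N -> y != (b + k * st)%N) ->
         fmem t y = fmem s y]).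
Proof.
move=> H; have [Hz HL Hb Hst Hom Htau Hsig Hc L0 Lz bz st0 om0] := H.
apply: (@run_weaken _ _ _ _ (12 * L + 10 + (5 * L + 10 +
  ((4 * (2 * L) + 4 + P (2 * L)) + (5 * L + 10))))); [|by lia|by move=> t; exact: id].
apply: run_seq; apply: run_weaken (chirp_tables_run H) _ _ => // t [Ti TC TA Tf].
apply: run_seq; apply: run_weaken (chirp_load_run H Ti TC TA Tf) _ _ => //.
move=> u [Ui UC UA U0 Uf].
apply: run_seq; apply: run_pmul.
  by rewrite /= Ui // HL; lia.
set u' := State _ _.
have Hz' : imem u vz = z by rewrite Ui.
have Ui' : imem_eq_off [:: vj; vptr] s u' by same Ui.
have UC' i : (i < L)%N -> fmem u' (z + z + i)%N = chirp om i.
  by move=> iL; rewrite /u' /= Hz'; mem; apply: UC; lia.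
apply: run_weaken (chirp_store_run H Ui' UC' _) _ _ => //.
  by move=> y y0 y1 yz; rewrite /u' /= Hz'; mem; exact: Uf.
move=> v [Vi VO Vf]; split=> // k kL.
rewrite VO // /u' [imem _]/= [fmem _]/= /= Hz'; mem; congr (_ * _).
rewrite (_ : _ - _ = L - 1 + k)%N; last by lia.
apply: (chirp_sum (x := fun j => fmem s (b + j * st)%N * tau ^+ j)) => // i iL.
- by rewrite coef_poly UA //; case: ifP => //; lia.
- by rewrite coef_poly; case: ifP => // iL2; apply: U0; lia.
- by rewrite coef_poly UC //; case: ifP => //; lia.
Qed.

End Chirp.

(** * Search for a primitive element *)

Notation log_cell v := (32 + (v + v + v))%ix (only parsing).

(** The key is preset to a value different from the key of 1, so that the loop
    lists at least the first power. *)
Definition mark_powers : cmd := (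
  vkey <- key F[f_cand] ;;
  If I[log_cell $vkey] Skip (
    F@f_run <- 1 ;; vord <- 0 ;; vkey <- $vkey1 + 1 ;;
    While (($vkey - $vkey1) + ($vkey1 - $vkey)) (
      F@f_run <- F[f_run] * F[f_cand] ;; vord <- $vord + 1 ;;
      vkey <- key F[f_run] ;; I@(log_cell $vkey) <- 1) ;;
    If ($vord - $vN) (vN <- $vord ;; F@f_gen <- F[f_cand]) Skip))%prog.

Definition try_candidate (x : fexp) : cmd := (F@f_cand <- x ;; mark_powers)%prog.

Arguments try_candidate x%_fx.

(** Zero is marked at the start: its powers never reach 1. *)
Definition find_primitive : cmd := (
  vkey1 <- key 1 ;; vkey <- key 0 ;; I@(log_cell $vkey) <- 1 ;;
  For vi $vn (
    try_candidate F[$vi + $vi] ;; try_candidate (F[0] - F[$vi + $vi])))%prog.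

(** Dyadic blocks: each block of indices between 2^t and 2^(t+1) contributes at
    most N. *)
Lemma sum_div_pow2 N t : (\sum_(1 <= k < 2 ^ t) N %/ k <= t * N)%N.
Proof.
elim: t => [|t IH]; first by rewrite expn0 big_geq.
have t0 : (0 < 2 ^ t)%N by rewrite expn_gt0.
rewrite (big_cat_nat (n := 2 ^ t)) //=; last by rewrite expnS; lia.
rewrite mulSn addnC leq_add //.
apply: (@leq_trans (\sum_(2 ^ t <= k < 2 ^ t.+1) N %/ 2 ^ t)).
  rewrite big_nat_cond [leqRHS]big_nat_cond; apply: leq_sum => k.
  by move=> /andP[/andP[tk _] _]; exact: leq_div2l.
rewrite sum_nat_const_nat expnS mul2n -addnn addnK mulnC.
exact: leq_trunc_div.
Qed.

(** Each divisor of [N] is a quotient [N %/ k] with [k <= N], so their sum is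
    bounded by a harmonic sum. *)
Lemma sum_divisors_le N (D : seq nat) : (0 < N)%N -> uniq D ->
  {in D, forall d, (d %| N)%N} -> (sumn D <= (trunc_log 2 N).+1 * N)%N.
Proof.
move=> N0 uD DN.
apply: leq_trans (sum_div_pow2 N (trunc_log 2 N).+1).
rewrite sumnE.
have dv d : d \in D -> (0 < d)%N by move=> /DN; exact: dvdn_gt0.
have -> : (\sum_(d <- D) d = \sum_(k <- [seq (N %/ d)%N | d <- D]) N %/ k)%N.
  rewrite big_map; apply: eq_big_seq => d dD.
  by rewrite divnA ?DN // mulnC mulnK.
set s := [seq _ | d <- D].
have us : uniq s.
  rewrite map_inj_in_uniq // => d1 d2 d1D d2D /(congr1 (divn N)).
  by rewrite !divnA ?DN // ![(N * _)%N]mulnC !mulnK.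
have sub : {subset s <= index_iota 1 (2 ^ (trunc_log 2 N).+1)}.
  move=> k /mapP[d dD ->]; rewrite mem_index_iota divn_gt0 ?dv // dvdn_leq ?DN //=.
  exact: leq_ltn_trans (leq_div N d) (trunc_log_ltn N _).
set T := index_iota 1 _ in sub *.
have pT : perm_eq s (filter (mem s) T).
  apply: uniq_perm; rewrite ?filter_uniq ?iota_uniq // => k.
  by rewrite mem_filter /=; case: (boolP (k \in s)) => //= /sub ->.
rewrite (perm_big _ pT) big_filter [leqRHS](bigID (mem s)) /=.
exact: leq_addr.
Qed.

(** Folded, it is a single atom for linear arithmetic. *)
Definition units_card (F : finFieldType) : nat := #|F|.-1.

Section Search.
Variables (F : finFieldType) (P : nat -> nat).
Notation run := (@run F P).
Notation N := (units_card F).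

Definition rank_of (x : F) : nat := enum_rank x.

Lemma rank_of_inj : injective rank_of.
Proof. by move=> x y /ord_inj /enum_rank_inj. Qed.

Lemma log_cell_eq (x y : F) :
  (32 + (rank_of x + rank_of x + rank_of x) == 32 + (rank_of y + rank_of y + rank_of y))%N = (x == y).
Proof.
rewrite -(inj_eq rank_of_inj); apply/eqP/eqP => [|->//]; lia.
Qed.

Lemma units_card_gt0 : (0 < N)%N.
Proof. by rewrite /units_card -subn1 subn_gt0; exact: finNzRing_gt1. Qed.

Lemma expf_units_card (x : F) : x != 0 -> x ^+ N = 1.
Proof.
move=> x0; apply: (mulfI x0).
by rewrite mulr1 -exprS prednK ?expf_card // (ltn_trans _ (finNzRing_gt1 F)).
Qed.

Lemma order_exists (x : F) : x != 0 ->
  exists2 d, d.-primitive_root x & (d %| N)%N.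
Proof.
by move=> x0; have [d] := prim_order_exists units_card_gt0 (expf_units_card x0); exists d.
Qed.

Lemma primitive_exists : exists g : F, N.-primitive_root g.
Proof.
pose nz := enum [pred x : F | x != 0].
have /hasP[g _ gP] : has N.-primitive_root nz.
  apply: has_prim_root units_card_gt0 _ (enum_uniq _) _.
    apply/allP => x; rewrite mem_enum inE => x0.
    by apply/unity_rootP; exact: expf_units_card.
  rewrite /units_card -cardE -(cardC1 (0 : F)); apply/eq_leq/eq_card => x.
  by rewrite !inE.
by exists g.
Qed.

(** In a cyclic group, [x] is a power of an element of order [d] if and only if
    [x ^+ d = 1]: the marks are described by the list [D] of the orders met so
    far. *)
Definition covered (D : seq nat) (x : F) : bool :=
  (x == 0) || has (fun d => x ^+ d == 1) D.

Definition scalar_eq_off (V : seq nat) (s t : state F) : Prop :=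
  forall x, (x < 32)%N -> x \notin V -> imem t x = imem s x.

Record searched (z : nat) (D : seq nat) (s : state F) : Prop := {
  se_z : imem s vz = z;
  se_k1 : imem s vkey1 = rank_of 1;
  se_uniq : uniq D;
  se_prim : forall d, d \in D -> exists a : F, d.-primitive_root a;
  se_mark : forall x, (imem s (32 + (rank_of x + rank_of x + rank_of x)) != 0)%N = covered D x;
  se_le : forall d, d \in D -> (d <= imem s vN)%N;
  se_best : imem s vN = 0%N \/
            (imem s vN).-primitive_root (fmem s (z + 3)%N) }.

Lemma covered_prim (a x : F) d : d.-primitive_root a ->
  reflect (exists2 j, (0 < j <= d)%N & x = a ^+ j) (x ^+ d == 1).
Proof.
move=> pa; apply: (iffP eqP) => [/(prim_rootP pa)[i ->]|[j _ ->]]; last first.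
  by rewrite exprAC (prim_expr_order pa) expr1n.
case: (posnP i) => [i0|ip].
  exists d; first by rewrite leqnn (prim_order_gt0 pa).
  by rewrite i0 expr0 (prim_expr_order pa).
by exists i => //; rewrite ip ltnW.
Qed.

(** If [a] is not marked, its order is new: an element of the same order would
    have marked all the solutions of [x ^+ d = 1].  The cost is the order of
    [a], and the marks of its powers are the solutions of [x ^+ d = 1]. *)
Lemma mark_powers_run z D s : searched z D s ->
  exists d, run mark_powers s (12 + 5 * d) (fun t => exists D',
    [/\ searched z D' t, covered D' (fmem s (z + 2)%N), {subset D <= D'},
        sumn D' = (sumn D + d)%N &
        scalar_eq_off [:: vN; vkey; vord] s t /\
        forall y, y != z -> y != (z + 3)%N -> fmem t y = fmem s y]).
Proof.
case=> Hz Hk1 uD pD mD leD bD; set a := fmem s (z + 2)%N.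
have key2 : post (vkey <- key F[f_cand])%prog s =
            State (upd (imem s) 8 (rank_of a)) (fmem s) by rewrite /= Hz.
case: (boolP (covered D a)) => ca.
  exists 0%N.
  apply: (@run_weaken _ _ _ _ (1 + 1) _ _ _ _ _ (fun t Q => Q)) => //.
  apply: run_seq; apply: run_straight => //; rewrite key2.
  apply: run_if; rewrite /= mD ca.
  apply: (@run_straight _ _ Skip) => //=; exists D; split=> //; rewrite ?addn0 //.
  by split=> //= x x32; rewrite !inE => xV; mem.
have a0 : a != 0 by apply: contra ca => /eqP->; rewrite /covered eqxx.
have [d pd dN] := order_exists a0.
have dD : d \notin D.
  apply: contra ca => dD; apply/orP; right; apply/hasP; exists d => //.
  by rewrite prim_expr_order.
have cD x : covered (d :: D) x = covered D x || (x ^+ d == 1).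
  by rewrite /covered /= orbCA orbC.
exists d.
pose J k (t : state F) := [/\ fmem t z = a ^+ k, imem t vord = k,
  imem t vkey = (if k is 0%N then (rank_of 1).+1 else rank_of (a ^+ k)),
  forall x, (imem t (32 + (rank_of x + rank_of x + rank_of x)) != 0)%N <->
    covered D x \/ exists2 j, (0 < j <= k)%N & x = a ^+ j &
  scalar_eq_off [:: vkey; vord] s t /\ forall y, y != z -> fmem t y = fmem s y].
apply: (@run_weaken _ _ _ _ (1 + (3 + ((d * 5 + 1) + 3)).+1) _ _ _ _ _ (fun t Q => Q)) => //; last by lia.
apply: run_seq; apply: run_straight => //; rewrite key2.
apply: run_if; rewrite /= mD (negbTE ca) /=.
rewrite (_ : 3 + _ = 1 + (1 + (1 + ((d * 5 + 1) + 3))))%N //.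
do 3 (apply: run_seq; apply: run_straight => //).
apply: run_seq.
apply: (@run_weaken _ _ _ _ (d * 5 + 1) _ (J d)) => //.
  apply: (@run_while _ _ J).
  - split=> //=.
    + by rewrite Hz; mem.
    + by rewrite Hk1 addn1.
    + by move=> x; rewrite mD; split=> [|[|[j]]]; [left | | lia].
    + split=> [|y yz]; last by rewrite Hz; mem.
      by move=> x x32; rewrite !inE => xV; mem.
  - move=> k t kd [Hx Hc Hk Hm [Hi Hf]].
    have Hz' : imem t vz = z by rewrite Hi.
    have Hk1' : imem t vkey1 = rank_of 1 by rewrite Hi.
    split.
      rewrite /= Hk Hk1'; case: k kd {Hx Hc Hk Hm} => [|k] kd; first by lia.
      have : rank_of (a ^+ k.+1) != rank_of 1.
        rewrite (inj_eq rank_of_inj) -(prim_order_dvd pd).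
        by apply/negP => /dvdn_leq; lia.
      by move/eqP; lia.
    apply: (@run_weaken _ _ _ _ 4); [|by []|move=> u; exact: id].
    have Ha : fmem t (z + 2)%N = a by rewrite Hf //; lia.
    have ak : fmem t z * fmem t (z + 2)%N = a ^+ k.+1 by rewrite Hx Ha exprSr.
    apply: run_straight => //; rewrite /= addn0 Hz' eqxx ak -/(rank_of _) Hc addn1.
    split=> //=.
    + by mem.
    + move=> x.
      case: (eqVneq x (a ^+ k.+1)) => [->|ne].
        by rewrite eqxx; split=> // _; right; exists k.+1; rewrite ?leqnn.
      have /eqP ner : rank_of x != rank_of (a ^+ k.+1) by rewrite (inj_eq rank_of_inj).
      mem_if.
      rewrite Hm; split=> [[->|[j jk xj]]|[->|[j jk xj]]]; try by left.
        by right; exists j => //; lia.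
      right; exists j => //; case/andP: jk => ->; rewrite leq_eqVlt.
      by case/predU1P=> [jk|//]; rewrite xj jk eqxx in ne.
    + split=> [x x32|y yz]; last by mem; exact: Hf.
      by rewrite !inE => xV; mem; apply: Hi; rewrite // !inE; lia.
  - move=> t [Hx Hc Hk Hm [Hi Hf]]; have d0 := prim_order_gt0 pd.
    have Hk1' : imem t vkey1 = rank_of 1 by rewrite Hi.
    rewrite /= Hk Hk1'; case: d d0 pd {Hx Hc Hm dN dD Hk cD} => // d' _ pd.
    by rewrite prim_expr_order // subnn.
move=> t [Hx Hc Hk Hm [Hi Hf]].
have Hz' : imem t vz = z by rewrite Hi.
have Hk1' : imem t vkey1 = rank_of 1 by rewrite Hi.
have HN : imem t vN = imem s vN by rewrite Hi.
have Ha : fmem t (z + 2)%N = a by rewrite Hf //; lia.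
have marks x : (imem t (32 + (rank_of x + rank_of x + rank_of x)) != 0)%N = covered (d :: D) x.
  rewrite cD; apply/idP/orP; rewrite Hm => -[H|H]; [by left|right|by left|right].
    exact/(covered_prim _ pd).
  exact/(covered_prim _ pd).
have pD' d' : d' \in d :: D -> exists a0 : F, d'.-primitive_root a0.
  by rewrite inE => /predU1P[->|/pD //]; exists a.
have ca' : covered (d :: D) a by rewrite cD prim_expr_order // eqxx orbT.
have sD : {subset D <= d :: D} by move=> x xD; rewrite inE xD orbT.
apply: (@run_straight _ _ (If _ _ _)) => //=; exists (d :: D).
rewrite Hc HN Hz'; case: ifP => [lt|ge].
  split=> //=; last 1 first.
  - split=> [x x32|y y0 y1]; last by mem; exact: Hf.
    by rewrite !inE => xV; mem; apply: Hi; rewrite // !inE; lia.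
  - split=> //=; rewrite ?uD ?dD //.
    + move=> d'; rewrite inE => /predU1P[->|/leD]; lia.
    + by right; mem; rewrite Ha.
  - by rewrite addnC.
split=> //=; last 1 first.
- split=> [x x32|y y0 y1]; last by exact: Hf.
  by rewrite !inE => xV; apply: Hi; rewrite // !inE; lia.
- split=> //=; rewrite ?uD ?dD //.
  + by move=> d'; rewrite inE HN => /predU1P[->|/leD]; lia.
  + by rewrite HN Hf //; lia.
- by rewrite addnC.
Qed.

Lemma try_candidate_run z D s x : searched z D s ->
  exists d, run (try_candidate x) s (13 + 5 * d) (fun t => exists D',
    [/\ searched z D' t, covered D' (feval s x), {subset D <= D'},
        sumn D' = (sumn D + d)%N &
        scalar_eq_off [:: vN; vkey; vord] s t /\
        forall y, y != z -> y != (z + 2)%N -> y != (z + 3)%N ->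
          fmem t y = fmem s y]).
Proof.
move=> Hs; have Hz := se_z Hs.
have Hs' : searched z D (post (F@f_cand <- x)%prog s).
  by case: Hs => *; split=> //=; rewrite Hz; mem.
have [d r] := mark_powers_run Hs'; exists d.
rewrite -[13%N]/(1 + 12)%N -addnA; apply: run_seq; apply: run_straight => //.
apply: run_weaken r _ _ => // t [D' [st cD sD sumD [Vt Ft]]]; exists D'.
split=> //; first by move: cD; rewrite /= Hz; mem.
split=> [y y32 yV|y y0 y2 y3]; first by rewrite Vt.
by rewrite Ft // /= Hz; mem.
Qed.

(** A generator of the multiplicative group is covered, so some order in [D] is
    a multiple of [N]; the largest order met is therefore [N]. *)
Lemma searched_best z D s : searched z D s -> (forall x : F, covered D x) ->
  imem s vN = N /\ N.-primitive_root (fmem s (z + 3)%N).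
Proof.
case=> _ _ _ pD _ leD bD cD; have [g pg] := primitive_exists.
have g0 : g != 0.
  apply: contraTneq pg => ->; apply/negP => /prim_expr_order/eqP.
  by rewrite expr0n; case: N units_card_gt0 => //= n _; rewrite eq_sym oner_eq0.
have := cD g; rewrite /covered (negbTE g0) /= => /hasP[d dD].
rewrite -(prim_order_dvd pg) => Nd.
have [a /prim_order_gt0 d0] := pD _ dD.
have dle := leD _ dD; have Nle := dvdn_leq d0 Nd.
case: bD => [|pb]; first by lia.
have b0 : fmem s (z + 3)%N != 0.
  apply: contraTneq pb => ->; apply/negP => /prim_expr_order/eqP.
  by rewrite expr0n; case: (imem s 6) dle => [|n] /=; [lia|rewrite eq_sym oner_eq0].
have := expf_units_card b0 => /eqP; rewrite -(prim_order_dvd pb) => /(dvdn_leq units_card_gt0) le.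
by have -> : N = imem s vN by lia.
Qed.

Lemma find_primitive_run s z n (al : nat -> F) :
  imem s vz = z -> imem s vN = 0%N -> imem s vn = n ->
  (2 * n < z)%N -> (0 < n)%N ->
  (forall x, (32 <= x)%N -> imem s x = 0%N) ->
  (forall i, (i < n)%N -> fmem s (i + i)%N = al i) ->
  (forall x : F, exists2 i, (i < n)%N & x = al i \/ x = al 0%N - al i) ->
  run find_primitive s (28 * n + 5 + 5 * ((trunc_log 2 N).+1 * N)) (fun t =>
    [/\ imem t vN = N, N.-primitive_root (fmem t (z + 3)%N),
        scalar_eq_off [:: vN; vi; vkey; vkey1; vord] s t &
        forall y, y != z -> y != (z + 2)%N -> y != (z + 3)%N ->
          fmem t y = fmem s y]).
Proof.
move=> Hz HN Hn nz n0 H0 Hal cov.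
pose I k a t := exists D, [/\ searched z D t, imem t vi = k,
  (5 * sumn D = a)%N,
  forall i, (i < k)%N -> covered D (al i) && covered D (al 0%N - al i) &
  scalar_eq_off [:: vN; vi; vkey; vkey1; vord] s t /\
  forall y, y != z -> y != (z + 2)%N -> y != (z + 3)%N -> fmem t y = fmem s y].
have I0 s1 : s1 = post (vkey1 <- key 1 ;; vkey <- key 0 ;; I@(log_cell $vkey) <- 1)%prog s ->
    I 0%N 0%N (iset s1 vi 0).
  move=> ->; exists [::]; split=> //.
    split=> //=; rewrite ?HN //; last by left.
    move=> x; rewrite /covered orbF -!/(rank_of _).
    by rewrite log_cell_eq; case: (x == 0) => //=; rewrite H0 //; lia.
  by split=> // x x32; rewrite !inE => xV; mem.
have [|k a t kn [D [Ht Hi Ha Hc [Hs Hf]]]|a H] :=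
    @run_for_credit _ P I vi ($vn)%ix
      (try_candidate F[$vi + $vi] ;; try_candidate (F[0] - F[$vi + $vi]))%prog
      n 26 _ (I0 _ (erefl _)).
- by move=> k a t [D [_ Hi _ _ [Hs _]]]; split=> //=; rewrite Hs.
- have Hz' := se_z Ht.
  have [d1 r1] := try_candidate_run (F[$vi + $vi])%fx Ht.
  have [k1 [t1 [st1 le1 [D1 [Ht1 c1 s1 sum1 [V1 F1]]]]]] := r1.
  have [d2 [k2 [t2 [st2 le2 [D2 [Ht2 c2 s2 sum2 [V2 F2]]]]]]] :=
    try_candidate_run (F[0] - F[$vi + $vi])%fx Ht1.
  exists (5 * d1 + 5 * d2)%N, (k1 + k2)%N, t2; split; first exact: SSeq st1 st2.
    by lia.
  have al1 i : (i < n)%N -> fmem t (i + i)%N = al i.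
    by move=> i_n; rewrite Hf ?Hal //; apply/eqP; lia.
  have al2 i : (i < n)%N -> fmem t1 (i + i)%N = al i.
    by move=> i_n; rewrite F1 ?al1 //; apply/eqP; lia.
  have Hi1 : imem t1 vi = k by rewrite V1.
  move: c1 c2; rewrite /= Hi Hi1 al1 // al2 // -[fmem t1 0]/(fmem t1 (0 + 0)%N).
  rewrite al2 // => c1 c2.
  have mono x E E' : {subset E <= E'} -> covered E x -> covered E' x.
    move=> EE'; rewrite /covered => /orP[->//|/hasP[d /EE' dE xd]].
    by apply/orP; right; apply/hasP; exists d.
  exists D2; split=> //=; rewrite ?V2 ?V1 ?Hi //.
  + by case: Ht2 => *; split.
  + by rewrite sum2 sum1; lia.
  + move=> i; rewrite ltnS leq_eqVlt => /predU1P[->|ik].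
      by rewrite c2 (mono _ _ _ s2 c1).
    have /andP[ca cb] := Hc i ik.
    by rewrite !(mono _ _ _ s2 (mono _ _ _ s1 _)).
  + split=> [x x32|y y0 y2 y3]; last by rewrite F2 // F1 // Hf.
    rewrite !inE => xV; mem; rewrite V2 ?V1 ?Hs // !inE; lia.
have ale t : I n a t -> (a <= 5 * ((trunc_log 2 N).+1 * N))%N.
  case=> D [Ht _ <- _ _]; rewrite leq_mul2l /=.
  apply: sum_divisors_le units_card_gt0 (se_uniq Ht) _ => d /(se_prim Ht)[x px].
  rewrite (prim_order_dvd px); apply/eqP/expf_units_card.
  apply: contraTneq px => ->; apply/negP => px.
  have := prim_expr_order px; rewrite expr0n eqn0Ngt (prim_order_gt0 px) /=.
  by move/eqP; rewrite eq_sym oner_eq0.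
have [k [t [st le It]]] := H.
pose c := (1 + (1 + (1 + (n * (26 + 2) + 2 + a))))%N.
apply: (@run_weaken _ _ _ _ c _ (I n a)); last 1 first.
- move=> {k t st le It} t [D [Ht Hi Ha Hc [Hs Hf]]].
  have [|HvN pg] := searched_best Ht; last by split.
  move=> x; have [i i_n xi] := cov x; have /andP[ca cb] := Hc i i_n.
  by case: xi => ->.
- do 3 (apply: run_seq; apply: run_straight => //).
- by have := ale t It; rewrite /c; lia.
Qed.

End Search.

(** * The points of the curve *)

Record curve_setting (F : finFieldType) (q r e : nat) : Prop := {
  cs_q : prime_power q;
  cs_r : (2 <= r)%N;
  cs_e0 : (0 < e)%N;
  cs_e : (e %| (q ^ r - 1) %/ (q - 1))%N;
  cs_ne : e <> ((q ^ r - 1) %/ (q - 1))%N;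
  cs_F : #|F| = (q ^ r)%N }.

Section Curve.
Variables (F : finFieldType) (q r e : nat).
Hypothesis CS : curve_setting F q r e.
Notation N := (units_card F).

Lemma q_gt1 : (1 < q)%N.
Proof.
case: (cs_q CS) => p [k [pp k0 ->]].
by rewrite -(exp1n k) ltn_exp2r // prime_gt1.
Qed.

Lemma r_gt0 : (0 < r)%N. Proof. by have := cs_r CS; lia. Qed.

Lemma q_pow_gt0 k : (0 < q ^ k)%N.
Proof. by rewrite expn_gt0; have := q_gt1; lia. Qed.

Lemma N_factor : N = ((q ^ r - 1) %/ (q - 1) * (q - 1))%N.
Proof.
by rewrite /units_card (cs_F CS) divnK; rewrite !subn1 // dvdn_pred_predX.
Qed.

Lemma e_dvd_N : (e %| N)%N.
Proof. by rewrite N_factor dvdn_mulr // (cs_e CS). Qed.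

Definition tr (x : F) : F := \sum_(k < r) x ^+ (q ^ k).

Lemma q_pchar k : [pchar F].-nat (q ^ k)%N.
Proof.
case: (cs_q CS) => p [n [pp n0 qE]].
have cF : p \in [pchar F].
  by apply: (card_finPcharP (n := (n * r)%N)) => //; rewrite (cs_F CS) qE expnM.
rewrite qE -expnM; apply/andP; split; first by rewrite expn_gt0 prime_gt0.
apply/allP => p'; rewrite mem_primes => /and3P[pp' _ pd].
rewrite (Euclid_dvdX p _ pp') in pd; case/andP: pd => pd _.
by rewrite dvdn_prime2 // in pd; rewrite (eqP pd).
Qed.

Lemma trB x y : tr (x - y) = tr x - tr y.
Proof.
rewrite /tr -sumrB; apply: eq_bigr => k _.
by rewrite exprDn_pchar ?q_pchar // exprNn_pchar ?q_pchar.
Qed.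

Lemma tr0 : tr 0 = 0.
Proof. by have := trB 0 0; rewrite !subrr. Qed.

Lemma exprq_sum (n : nat) (f : nat -> F) :
  (\sum_(k < n) f k) ^+ q = \sum_(k < n) f k ^+ q.
Proof.
have q1 : [pchar F].-nat q by rewrite -[q]expn1 q_pchar.
apply: (big_morph (fun x => x ^+ q)) => [x y|]; first by rewrite exprDn_pchar.
by rewrite expr0n; case: q q_gt1.
Qed.

(** The values of the trace lie in the subfield of order [q]. *)
Lemma tr_q x : tr x ^+ q = tr x.
Proof.
rewrite /tr (exprq_sum r (fun k => x ^+ (q ^ k))).
have -> : \sum_(k < r) (x ^+ (q ^ k)) ^+ q = \sum_(k < r) x ^+ (q ^ k.+1).
  by apply: eq_bigr => k _; rewrite -exprM expnSr.
case: r (cs_F CS) => [|r'] FE; first by rewrite !big_ord0.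
rewrite big_ord_recr big_ord_recl /= -FE expf_card expn0 expr1 addrC.
by congr (_ + _); apply: eq_bigr.
Qed.

Lemma card_fiber_le c : (#|[set x | tr x == c]| <= q ^ r.-1)%N.
Proof.
pose p : {poly F} := \sum_(k < r) 'X^(q ^ k) - c%:P.
have sp : (size p <= (q ^ r.-1).+1)%N.
  rewrite (leq_trans (size_polyD _ _)) // geq_max size_polyN.
  apply/andP; split; last first.
    by rewrite (leq_trans (size_polyC_leq1 _)) // ltnS ltnW // q_pow_gt0.
  apply: (leq_trans (size_sum _ _ _)); apply/bigmax_leqP => k _.
  by rewrite size_polyXn ltnS leq_exp2l ?q_gt1 //; have := ltn_ord k; lia.
have p0 : p != 0.
  apply/eqP => /(congr1 (fun u : {poly F} => u`_(q ^ r.-1))).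
  rewrite coef0 coefB coefC eqn0Ngt q_pow_gt0 /= subr0 coef_sum.
  have r1 : (r.-1 < r)%N by have := r_gt0; lia.
  rewrite (bigD1 (Ordinal r1)) //= coefXn eqxx big1 ?addr0.
    by move/eqP; rewrite oner_eq0.
  move=> k kr; rewrite coefXn eqn_exp2l ?q_gt1 //.
  by rewrite eq_sym; move: kr; rewrite -val_eqE /= => /negbTE->.
have := max_poly_roots (rs := enum [set x | tr x == c]) p0.
rewrite enum_uniq -cardE => H; rewrite -ltnS (leq_trans _ sp) // H //.
apply/allP => x; rewrite mem_enum inE => /eqP tx.
rewrite rootE !hornerE horner_sum subr_eq0 -tx; apply/eqP.
by apply: eq_bigr => k _; rewrite hornerXn.
Qed.

(** The fibres have at most q^(r-1) elements, being roots of a polynomial, and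
    there are at most q of them; together they have q^r elements, so that all
    these bounds are attained. *)
Lemma card_tr0 : #|[set x | tr x == 0]| = (q ^ r.-1)%N.
Proof.
apply/eqP; rewrite eqn_leq card_fiber_le /=.
pose K := [set c : F | c ^+ q == c].
have cK : (#|K| <= q)%N.
  have szp : size ('X^q - 'X : {poly F}) = q.+1.
    by rewrite size_polyDl size_polyXn // size_polyN size_polyX ltnS q_gt1.
  have p0 : ('X^q - 'X : {poly F}) != 0 by rewrite -size_poly_eq0 szp.
  have := max_poly_roots (rs := enum K) p0.
  rewrite enum_uniq -cardE szp ltnS => -> //.
  by apply/allP => x; rewrite mem_enum inE rootE !hornerE subr_eq0.
have K0 : 0 \in K by rewrite inE expr0n; case: q q_gt1 => //=; rewrite eqxx.
have : (#|F| = \sum_(c in K) #|[set x | tr x == c]|)%N.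
  rewrite -sum1_card (partition_big tr (mem K)) /=; last first.
    by move=> x _; rewrite inE tr_q.
  by apply: eq_bigr => c _; rewrite -sum1_card; apply: eq_bigl => x; rewrite inE.
rewrite (bigD1 0) //= (cs_F CS) => E.
have : (\sum_(c in K | c != 0%R) #|[set x | tr x == c]| <= (q - 1) * q ^ r.-1)%N.
  apply: (@leq_trans (\sum_(c in K | c != 0%R) q ^ r.-1)).
    by apply: leq_sum => c _; exact: card_fiber_le.
  rewrite sum_nat_const leq_mul2r; apply/orP; right.
  have -> : #|[pred c in K | c != 0]| = #|K :\ 0|.
    by apply: eq_card => c; rewrite !inE andbC.
  by rewrite -(leq_add2l 1) subnKC ?(ltnW q_gt1) // (leq_trans _ cK) // (cardsD1 0 K) K0.
move=> le; have -> : (q ^ r.-1 = q ^ r - (q - 1) * q ^ r.-1)%N.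
  by rewrite mulnBl mul1n -expnS prednK ?r_gt0 // subKn // leq_exp2l ?q_gt1 // leq_pred.
by rewrite leq_subLR E addnC leq_add2r.
Qed.

Section Roots.
Variables (g : F) (pg : N.-primitive_root g).

Definition zeta : F := g ^+ (N %/ e).

Lemma zeta_prim : e.-primitive_root zeta.
Proof. by rewrite /zeta; exact: (dvdn_prim_root pg e_dvd_N). Qed.

(** With [tr x = g ^+ t], raising to the power q - 1 gives that (q^r - 1)/(q - 1)
    divides t; so does e. *)
Lemma trace_norm x : tr x != 0 -> exists2 b, b != 0 & b ^+ e = tr x.
Proof.
move=> t0; have [t tE] := prim_rootP pg (expf_units_card t0).
have g0 : g != 0 by rewrite (prim_root_eq0 pg) -lt0n units_card_gt0.
have tq : tr x ^+ (q - 1) = 1.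
  apply: (mulfI t0); rewrite mulr1 -exprS -[RHS]tr_q; congr (_ ^+ _).
  by have := q_gt1; lia.
have /dvdnP[k kE] : (N %| t * (q - 1))%N.
  by rewrite (prim_order_dvd pg) exprM -tE tq.
have q0 : (0 < q - 1)%N by rewrite subn_gt0 q_gt1.
have : (e %| t)%N.
  apply: (dvdn_trans (cs_e CS)); apply/dvdnP; exists k.
  by apply/eqP; rewrite -(eqn_pmul2r q0) kE N_factor mulnA.
case/dvdnP=> u tu; exists (g ^+ u); first by rewrite expf_neq0.
by rewrite -exprM -tu tE.
Qed.

Lemma same_norm b c : b != 0 -> b ^+ e = c ^+ e ->
  exists2 k, (k < e)%N & c = b * zeta ^+ k.
Proof.
move=> b0 bc.
have /(prim_rootP zeta_prim)[k kE] : (c / b) ^+ e = 1.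
  by rewrite expr_div_n -bc divff // expf_neq0.
by exists k => //; rewrite -kE mulrC divfK.
Qed.

Lemma card_roots b : b != 0 -> #|[set c : F | c ^+ e == b ^+ e]| = e.
Proof.
move=> b0.
have -> : [set c : F | c ^+ e == b ^+ e] = [set b * zeta ^+ k | k : 'I_e].
  apply/setP => c; rewrite inE; apply/eqP/imsetP => [H|[k _ ->]].
    by have [k ke ->] := same_norm b0 (esym H); exists (Ordinal ke).
  by rewrite exprMn exprAC (prim_expr_order zeta_prim) expr1n mulr1.
rewrite card_imset ?card_ord // => i j /(mulfI b0)/eqP.
rewrite (eq_prim_root_expr zeta_prim) !modn_small // => /eqP; exact: ord_inj.
Qed.

End Roots.

Lemma card_points :
  #|[set P : F * F | (tr P.1 == P.2 ^+ e) && (P.2 != 0)]| =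
  (e * (q ^ r - q ^ r.-1))%N.
Proof.
have [g pg] := primitive_exists F.
rewrite -sum1_card.
rewrite (eq_bigl (fun P : F * F => (tr P.1 != 0) && (P.2 ^+ e == tr P.1))); last first.
  move=> [a b]; rewrite inE /= andbC [_ == tr a]eq_sym.
  by case: (tr a =P b ^+ e) => [->|]; rewrite ?andbF // !andbT expf_eq0 (cs_e0 CS).
rewrite -(pair_big_dep (fun a => tr a != 0) (fun a b => b ^+ e == tr a) (fun _ _ => 1%N)) /=.
rewrite (eq_bigr (fun _ => e)); last first.
  move=> a ta; have [b b0 <-] := trace_norm pg ta.
  rewrite sum1_card -[RHS](card_roots pg b0); apply: eq_card => c.
  by rewrite !inE.
rewrite sum_nat_const mulnC; congr (e * _)%N.
have -> : (q ^ r - q ^ r.-1)%N = #|[predC [pred x | tr x == 0]]|.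
  rewrite -(cs_F CS) -card_tr0 -[#|F|](cardC [pred x | tr x == 0]).
  rewrite (_ : #|[set x | tr x == 0]| = #|[pred x | tr x == 0]|) ?addKn //.
  by apply: eq_card => x; rewrite !inE.
by apply: eq_card => x; rewrite !inE.
Qed.

(** What makes the abscissas and their differences exhaust the field. *)
Lemma translate_cover a x : tr a != 0 -> tr x != 0 \/ tr (a - x) != 0.
Proof.
rewrite trB; case: (eqVneq (tr x) 0) => [->|] a0; last by left.
by right; rewrite subr0.
Qed.

Definition Hpoly : {poly {poly F}} := (\sum_(k < r) 'X^(q ^ k)) - 'Y ^+ e.

Lemma Hpoly_eval a b : Hpoly.[a, b] = tr a - b ^+ e.
Proof.
rewrite /Hpoly hornerD hornerN horner_exp hornerC hornerD hornerN horner_exp.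
rewrite hornerX horner_sum horner_sum; congr (_ - _).
by apply: eq_bigr => k _; rewrite hornerXn -polyC_exp hornerC.
Qed.

Lemma Hpoly_coef i : Hpoly`_i =
  \sum_(k < r) (i == q ^ k)%N%:R - (if i == 0%N then 'X^e else 0).
Proof.
rewrite coefB coef_sum -rmorphXn coefC; congr (_ - _).
by apply: eq_bigr => k _; rewrite coefXn.
Qed.

Lemma sum_indicator n i (f : nat -> nat) : injective f ->
  exists2 c, (c <= 1)%N & \sum_(k < n) (i == f k)%:R = c%:R :> {poly F}.
Proof.
move=> fi; rewrite -natr_sum; eexists; last by [].
elim: n => [|n IH]; first by rewrite big_ord0.
rewrite big_ord_recr /=; case: eqP => [->|_]; last by rewrite addn0.
by rewrite big1 // => k _; rewrite (inj_eq fi) gtn_eqF.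
Qed.

Lemma q_pow_inj : injective (expn q).
Proof. exact: expnI q_gt1. Qed.

(** The degrees determine the monomial basis of the message space. *)
Lemma degX_Hpoly : degX Hpoly = (q ^ r.-1)%N.
Proof.
rewrite /degX; suff -> : size Hpoly = (q ^ r.-1).+1 by [].
have r1 : (r.-1 < r)%N by have := r_gt0; lia.
apply/eqP; rewrite eqn_leq; apply/andP; split.
  apply/leq_sizeP => i qi; rewrite Hpoly_coef.
  rewrite (_ : i == 0%N = false) ?subr0; last by case: i qi.
  rewrite big1 // => k _; case: eqP => // ik; move: qi.
  by rewrite ik ltn_exp2l ?q_gt1 //; have := ltn_ord k; lia.
rewrite ltnNge; apply/negP => /leq_sizeP/(_ _ (leqnn _))/eqP.
rewrite Hpoly_coef eqn0Ngt q_pow_gt0 subr0 (bigD1 (Ordinal r1)) //= eqxx big1.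
  by rewrite addr0 oner_eq0.
move=> k kr; rewrite (inj_eq q_pow_inj) eq_sym.
by move: kr; rewrite -val_eqE /= => /negbTE->.
Qed.

Lemma degY_Hpoly : degY Hpoly = e.
Proof.
rewrite /degY; suff -> : sizeY Hpoly = e.+1 by [].
have H0 : size Hpoly`_0 = e.+1.
  rewrite Hpoly_coef big1 ?sub0r ?size_polyN ?size_polyXn // => k _.
  by rewrite eq_sym eqn0Ngt q_pow_gt0.
apply/eqP; rewrite eqn_leq -[X in (_ && (X <= _))%N]H0 max_size_coefXY andbT.
apply/bigmax_leqP => i _; case: (eqVneq (i : nat) 0%N) => [->|i0].
  by rewrite H0.
rewrite Hpoly_coef (negbTE i0) subr0.
have [c _ ->] := sum_indicator r i q_pow_inj.
by rewrite -polyC_natr (leq_trans (size_polyC_leq1 _)).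
Qed.

End Curve.

(** * Inverse transform and order of the messages *)

Section Inverse.
Variable F : fieldType.

Lemma dft_inv (L i : nat) (z : F) (x : nat -> F) :
  L.-primitive_root z -> (i < L)%N ->
  \sum_(k < L) (\sum_(j < L) x j * z ^+ (j * k)) * z^-1 ^+ (k * i) =
  L%:R * x i.
Proof.
move=> pz iL; have z0 : z != 0.
  by rewrite (prim_root_eq0 pz) -lt0n (prim_order_gt0 pz).
transitivity (\sum_(j < L) x j * \sum_(k < L) (z ^+ j / z ^+ i) ^+ k).
  rewrite (eq_bigr (fun k : 'I_L =>
     \sum_(j < L) x j * (z ^+ j / z ^+ i) ^+ k)); last first.
    move=> k _; rewrite mulr_suml; apply: eq_bigr => j _.
    by rewrite expr_div_n -!exprM exprVn [(k * i)%N]mulnC mulrA.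
  by rewrite exchange_big; apply: eq_bigr => j _; rewrite mulr_sumr.
rewrite (bigD1 (Ordinal iL)) //= divff ?expf_neq0 // [X in _ + X]big1 ?addr0.
  by rewrite (eq_bigr (fun _ => 1)) ?sumr_const ?card_ord 1?mulrC // => k _;
     rewrite expr1n.
move=> j ji; set y := z ^+ j / z ^+ i.
have y1 : y != 1.
  rewrite -subr_eq0 -[X in _ - X](divff (expf_neq0 i z0)) -mulrBl mulf_neq0 //.
    rewrite subr_eq0 (eq_prim_root_expr pz) !modn_small //.
  by rewrite invr_eq0 expf_neq0.
have yL : y ^+ L = 1.
  by rewrite expr_div_n exprAC [X in _ / X]exprAC (prim_expr_order pz) !expr1n divr1.
have : (y - 1) * \sum_(k < L) y ^+ k = 0 by rewrite -subrX1 yL subrr.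
by move/eqP; rewrite mulf_eq0 subr_eq0 (negbTE y1) /= => /eqP ->; rewrite mulr0.
Qed.

End Inverse.

Section Layout.

(** The quotient is the number of [i] with [e * i + c <= m], also when it is
    zero: the first subtraction is truncated. *)
Lemma ltn_count e m c i : (0 < e)%N ->
  (i < (m.+1 - c + (e - 1)) %/ e)%N = (e * i + c <= m)%N.
Proof. by move=> e0; rewrite leq_divRL // mulSn [(i * e)%N]mulnC; lia. Qed.

Variables (T : Type) (x0 : T) (g : nat -> nat -> T) (c : nat -> nat).

(** Row [j] of a message is a contiguous run of [c j] coefficients. *)
Definition rows (e : nat) : seq T :=
  flatten [seq [seq g j i | i <- iota 0 (c j)] | j <- iota 0 e].

Lemma rowsS e : rows e.+1 = rows e ++ [seq g e i | i <- iota 0 (c e)].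
Proof. by rewrite /rows -addn1 iotaD map_cat flatten_cat /= cats0. Qed.

Lemma size_rows e : size (rows e) = (\sum_(j < e) c j)%N.
Proof.
elim: e => [|e IH]; first by rewrite big_ord0.
by rewrite rowsS size_cat IH size_map size_iota big_ord_recr.
Qed.

Lemma nth_rows e j i : (j < e)%N -> (i < c j)%N ->
  nth x0 (rows e) (\sum_(j' < j) c j' + i) = g j i.
Proof.
move=> je ic; elim: e je => // e IH; rewrite ltnS leq_eqVlt rowsS nth_cat size_rows.
case/predU1P => [<-|je]; last first.
  rewrite IH // ifT //.
  apply: (@leq_trans (\sum_(j' < j.+1) c j')); first by rewrite big_ord_recr /= ltn_add2l.
  rewrite -!(big_mkord xpredT c) [leqRHS](big_cat_nat (n := j.+1)) //=.
  exact: leq_addr.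
rewrite ltnNge leq_addr /= addKn (nth_map 0%N) ?size_iota // nth_iota //.
Qed.

End Layout.

Lemma message_rows (F : fieldType) (H : {poly {poly F}}) m f e b :
  (0 < e)%N -> degY H = e -> degX H = b ->
  message H m f = rows (fun j i => f`_i`_j)
    (fun j => (m.+1 - b * j + (e - 1)) %/ e)%N e.
Proof.
move=> e0 He Hb; rewrite /message /cab_basis He Hb /rows.
rewrite filter_flatten map_flatten -!map_comp; congr flatten.
apply: eq_map => j.
rewrite -[LHS]/(map _ (filter _ (map _ (iota 0 m.+1)))) filter_map -map_comp.
congr map.
set k := (_ %/ _)%N.
have ik i : (e * i + b * j <= m)%N = (i < k)%N by rewrite /k ltn_count.
rewrite (eq_filter (a2 := fun i => (i < k)%N)) //.
have km : (k <= m.+1)%N.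
  case: k ik => // k' /(_ k'); rewrite ltnSn.
  have : (k' <= e * k')%N by rewrite leq_pmull.
  lia.
by rewrite -(filter_iota_ltn 0 km); apply: eq_filter => i.
Qed.

(** * Logarithm tables *)

Notation row_cell v := (33 + (v + v + v))%ix (only parsing).
Notation pow_cell v := (34 + (v + v + v))%ix (only parsing).

Definition log_table : cmd := (
  F@f_run <- 1 ;;
  For vi $vN (
    vkey <- key F[f_run] ;; I@(log_cell $vkey) <- $vi ;; F@f_run <- F[f_run] * F[f_gen]))%prog.

(** The exponent N / e is reached by subtracting e from N until nothing is left,
    for want of a division. *)
Definition root_of_unity : cmd := (
  F@f_root <- 1 ;; vtmp <- $vN ;;
  While $vtmp (vtmp <- $vtmp - $ve ;; F@f_root <- F[f_root] * F[f_gen]))%prog.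

(** To the power of index [k] of the root of unity the table attaches [k * N],
    the offset of row [k] of the matrix: there is no multiplication of indices
    that could compute it later.  The sum of e ones is accumulated for the
    inverse transform. *)
Definition row_table : cmd := (
  F@f_run <- 1 ;; F@f_e <- 0 ;; vtmp <- 0 ;;
  For vi $ve (
    vkey <- key F[f_run] ;; I@(row_cell $vkey) <- $vtmp ;; vtmp <- $vtmp + $vN ;;
    F@f_e <- F[f_e] + 1 ;; F@f_run <- F[f_run] * F[f_root]))%prog.

(** One ordinate above each abscissa, the last one in the list of points; the
    cell keeps its initial value 0 where there is no point, that is, where the
    trace is 0.  In both cases its e-th power is the trace. *)
Definition base_ordinates : cmd :=
  (For vi $vn (
    vkey <- key F[$vi + $vi] ;;
    F@(a_base + I[log_cell $vkey]) <- F[$vi + $vi + 1]))%prog.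

(** The exponents q^k - 1 of the divisor tr / X, and q^(r-1), by repeated
    additions. *)
Definition power_table : cmd := (
  vpow <- 1 ;;
  For vj $vr (
    vtop <- $vpow ;; I@(pow_cell $vj) <- $vpow - 1 ;; vsum <- 0 ;;
    For vi $vq (vsum <- $vsum + $vpow) ;;
    vpow <- $vsum))%prog.

Definition prepare : cmd := (
  vz <- ($vn + $vn + ($vn + $vn)) + ($vn + $vn + ($vn + $vn))
        + ($vm + $ve + 32) ;;
  find_primitive ;; log_table ;; root_of_unity ;; row_table ;;
  base_ordinates ;; power_table)%prog.

Definition table_eq (F : Type) (c : nat) (s t : state F) : Prop :=
  forall k, imem t (c + (k + k + k))%N = imem s (c + (k + k + k))%N.

Section Tables.
Variables (F : finFieldType) (P : nat -> nat).
Notation run := (@run F P).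
Notation N := (units_card F).

Lemma row_cell_eq (x y : F) :
  (33 + (rank_of x + rank_of x + rank_of x) == 33 + (rank_of y + rank_of y + rank_of y))%N = (x == y).
Proof.
rewrite -(inj_eq (@rank_of_inj F)); apply/eqP/eqP => [|->//]; lia.
Qed.

Lemma log_table_run s z g :
  imem s vz = z -> imem s vN = N -> N.-primitive_root g ->
  fmem s (z + 3)%N = g ->
  run log_table s (5 * N + 3) (fun t =>
    [/\ forall k, (k < N)%N ->
          imem t (32 + (rank_of (g ^+ k) + rank_of (g ^+ k) + rank_of (g ^+ k))) = k,
        scalar_eq_off [:: vi; vkey] s t &
        forall y, y != z -> fmem t y = fmem s y]).
Proof.
move=> Hz HN pg Hg.
pose I k t := [/\ imem t vi = k, fmem t z = g ^+ k,
  forall i, (i < k)%N ->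
    imem t (32 + (rank_of (g ^+ i) + rank_of (g ^+ i) + rank_of (g ^+ i))) = i,
  scalar_eq_off [:: vi; vkey] s t & forall y, y != z -> fmem t y = fmem s y].
apply: (@run_weaken _ _ _ _ (1 + (N * (3 + 2) + 2)) _ (I N)); last 1 first.
- by move=> t [].
- apply: run_seq; apply: run_straight => //; apply: (@run_for _ _ I).
  + split=> //=; rewrite ?Hz; first by mem.
      by move=> x x32; rewrite !inE => xV; mem.
    by move=> y y0; mem.
  + by move=> k t [Hi _ _ V _]; split=> //=; rewrite V.
  + move=> k t kN [Hi Hx Ht V Ff].
    have Hz' : imem t vz = z by rewrite V.
    have Hg' : fmem t (z + 3)%N = g by rewrite Ff //; apply/eqP; lia.
    apply: run_straight => //.
    rewrite /= addn0 Hz' Hx Hg' -exprSr -/(rank_of _) Hi.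
    split=> //=; first by mem.
    * move=> i; rewrite ltnS leq_eqVlt => /predU1P[->|ik].
        by rewrite log_cell_eq eqxx.
      rewrite log_cell_eq (eq_prim_root_expr pg) !modn_small //; last by lia.
      by rewrite ltn_eqF //; exact: Ht.
    * by move=> x x32; rewrite !inE => xV; mem; apply: V; rewrite // !inE; lia.
    * by move=> y y0; mem; exact: Ff.
- lia.
Qed.

Lemma root_of_unity_run s z g e :
  imem s vz = z -> imem s vN = N -> imem s ve = e -> (0 < e)%N -> (e %| N)%N ->
  fmem s (z + 3)%N = g ->
  run root_of_unity s (3 * N + 3) (fun t =>
    [/\ fmem t (z + 4)%N = g ^+ (N %/ e), imem_eq_off [:: vtmp] s t &
        forall y, y != (z + 4)%N -> fmem t y = fmem s y]).
Proof.
move=> Hz HN He e0 eN Hg.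
pose I k t := [/\ imem t vtmp = (N - k * e)%N, fmem t (z + 4)%N = g ^+ k,
  imem_eq_off [:: vtmp] s t & forall y, y != (z + 4)%N -> fmem t y = fmem s y].
apply: (@run_weaken _ _ _ _ (1 + (1 + (N %/ e * 3 + 1))) _ (I (N %/ e)%N)).
- do 2 (apply: run_seq; apply: run_straight => //); apply: (@run_while _ _ I).
  + split=> //=; rewrite ?Hz ?HN ?subn0 //; first by mem.
      by same (fun x => erefl (imem s x)).
    by move=> y y0; mem.
  + move=> k t kN [Ht Hx V Ff].
    have Hz' : imem t vz = z by rewrite V.
    have He' : imem t ve = e by rewrite V.
    have Hg' : fmem t (z + 3)%N = g by rewrite Ff //; apply/eqP; lia.
    have ke : (k * e + e <= N)%N by rewrite -mulSnr -leq_divRL.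
    split; first by rewrite /= Ht; lia.
    apply: (@run_weaken _ _ _ _ 2); [|by []|move=> u; exact: id].
    apply: run_straight => //; rewrite /= Hz' Hx Hg' -exprSr Ht He'.
    split=> //=; [lia|by mem|by same V|].
    by move=> y y0; mem; exact: Ff.
  + by move=> t [Ht _ _ _]; rewrite /= Ht divnK // subnn.
- by have := leq_div N e; lia.
- by move=> t [].
Qed.

Lemma row_table_run s z e zt :
  imem s vz = z -> imem s vN = N -> imem s ve = e -> e.-primitive_root zt ->
  fmem s (z + 4)%N = zt ->
  run row_table s (7 * e + 5) (fun t =>
    [/\ forall k, (k < e)%N ->
          imem t (33 + (rank_of (zt ^+ k) + rank_of (zt ^+ k) + rank_of (zt ^+ k))) = (k * N)%N,
        fmem t (z + 5)%N = e%:R, scalar_eq_off [:: vi; vkey; vtmp] s t, table_eq 32 s t &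
        forall y, y != z -> y != (z + 5)%N -> fmem t y = fmem s y]).
Proof.
move=> Hz HN He pz Hzt.
pose I k t := [/\ imem t vi = k, imem t vtmp = (k * N)%N, fmem t z = zt ^+ k,
  fmem t (z + 5)%N = k%:R &
  [/\ forall i, (i < k)%N ->
    imem t (33 + (rank_of (zt ^+ i) + rank_of (zt ^+ i) + rank_of (zt ^+ i))) = (i * N)%N,
  scalar_eq_off [:: vi; vkey; vtmp] s t, table_eq 32 s t &
  forall y, y != z -> y != (z + 5)%N -> fmem t y = fmem s y]].
apply: (@run_weaken _ _ _ _ (1 + (1 + (1 + (e * (5 + 2) + 2)))) _ (I e));
  last 1 first.
- by move=> t [_ _ _ ? []].
- do 3 (apply: run_seq; apply: run_straight => //); apply: (@run_for _ _ I).
  + split=> //=; rewrite ?Hz; [by mem|by mem|split=> //].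
      by move=> x x32; rewrite !inE => xV; mem.
    by move=> y y0 y5; mem.
  + by move=> k t [Hi _ _ _ [_ V _ _]]; split=> //=; rewrite V.
  + move=> k t ke [Hi Ht Hx Hk [Hr V T Ff]].
    have Hz' : imem t vz = z by rewrite V.
    have HN' : imem t vN = N by rewrite V.
    have Hzt' : fmem t (z + 4)%N = zt by rewrite Ff //; apply/eqP; lia.
    apply: run_straight => //.
    rewrite /= addn0 Hz'; repeat mem_if.
    rewrite Hx Hzt' Hk -exprSr -/(rank_of _) Hi Ht HN' natr1.
    split=> //=; [by rewrite mulSnr|by mem|by mem|split].
    * move=> i; rewrite ltnS leq_eqVlt => /predU1P[->|ik].
        by rewrite row_cell_eq eqxx.
      rewrite row_cell_eq (eq_prim_root_expr pz) !modn_small //; last by lia.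
      by rewrite ltn_eqF //; exact: Hr.
    * by move=> x x32; rewrite !inE => xV; mem; apply: V; rewrite // !inE; lia.
    * by move=> j; rewrite /=; mem; exact: T.
    * by move=> y y0 y5; mem; exact: Ff.
- lia.
Qed.

Lemma log_exists (g x : F) : N.-primitive_root g -> x != 0 ->
  exists2 u, (u < N)%N & x = g ^+ u.
Proof. by move=> pg x0; have [u ->] := prim_rootP pg (expf_units_card x0); exists u. Qed.

Lemma base_ordinates_run s z n e g (T : F -> F) (al be : nat -> F) :
  imem s vz = z -> imem s vn = n -> (0 < e)%N -> (2 * n < z)%N ->
  N.-primitive_root g ->
  (forall k, (k < N)%N ->
     imem s (32 + (rank_of (g ^+ k) + rank_of (g ^+ k) + rank_of (g ^+ k))) = k) ->
  (forall i, (i < n)%N -> [/\ fmem s (i + i)%N = al i,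
     fmem s (i + i + 1)%N = be i, al i != 0 & be i ^+ e = T (al i)]) ->
  (forall x, T x != 0 -> exists2 i, (i < n)%N & al i = x) ->
  (forall u, (u < N)%N -> fmem s (z + 16 + u)%N = 0) ->
  run base_ordinates s (4 * n + 2) (fun t =>
    [/\ forall u, (u < N)%N -> fmem t (z + 16 + u)%N ^+ e = T (g ^+ u),
        imem_eq_off [:: vi; vkey] s t &
        forall y, (y < z + 16)%N || (z + 16 + N <= y)%N ->
          fmem t y = fmem s y]).
Proof.
move=> Hz Hn e0 nz pg Hl Hp Hc H0.
pose I k t := [/\ imem t vi = k,
  forall u, (u < N)%N -> fmem t (z + 16 + u)%N = 0 \/
     fmem t (z + 16 + u)%N ^+ e = T (g ^+ u),
  forall u i, (i < k)%N -> (u < N)%N -> al i = g ^+ u ->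
     fmem t (z + 16 + u)%N ^+ e = T (g ^+ u),
  imem_eq_off [:: vi; vkey] s t &
  forall y, (y < z + 16)%N || (z + 16 + N <= y)%N -> fmem t y = fmem s y].
apply: (@run_weaken _ _ _ _ (n * (2 + 2) + 2) _ (I n)).
- apply: (@run_for _ _ I).
  + split=> //=; first by move=> u uN; left; exact: H0.
    by same (fun x => erefl (imem s x)).
  + by move=> k t [Hi _ _ V _]; split=> //=; rewrite V.
  + move=> k t kn [Hi Hu Hk V Ff].
    have Hz' : imem t vz = z by rewrite V.
    have [al1 be1 al0 alT] := Hp k kn.
    have al2 : fmem t (k + k)%N = al k by rewrite Ff // (leq_trans _ (leq_addr _ _)) //; lia.
    have be2 : fmem t (k + k + 1)%N = be k by rewrite Ff //; apply/orP; left; lia.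
    have [v vN alv] := log_exists pg al0.
    have Hv : imem t (32 + (rank_of (al k) + rank_of (al k) + rank_of (al k))) = v.
      by rewrite V ?alv ?Hl // !inE; lia.
    apply: (@run_weaken _ _ _ _ 2); [|by []|move=> u; exact: id].
    apply: run_straight => //; rewrite /= Hi al2 be2 -/(rank_of _) Hz' Hv.
    split=> //=.
    * move=> u uN; case: (eqVneq u v) => [->|uv]; first by rewrite eqxx alT alv; right.
      by rewrite eqn_add2l (negbTE uv); exact: Hu.
    * move=> u i ik uN aliu; case: (eqVneq u v) => [->|uv].
        by rewrite eqxx alT alv.
      rewrite eqn_add2l (negbTE uv); apply: (Hk u i) => //.
      move: ik; rewrite ltnS leq_eqVlt => /predU1P[ik|//].
      move: aliu; rewrite ik alv => /eqP.
      by rewrite (eq_prim_root_expr pg) !modn_small // eq_sym (negbTE uv).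
    * by same V.
    * by move=> y yz; mem; exact: Ff.
- lia.
- move=> t [_ Hu Hk V Ff]; split=> // u uN.
  case: (eqVneq (T (g ^+ u)) 0) => [T0|/Hc[i i_n ali]].
    case: (Hu u uN) => [->|->//].
    by rewrite T0 expr0n; case: e e0 {Hp Hk Hu I}.
  exact: Hk u i i_n uN ali.
Qed.

Lemma power_table_run s q r :
  imem s vq = q -> imem s vr = r -> (0 < r)%N ->
  run power_table s (r * (3 * q + 8) + 3) (fun t =>
    [/\ imem t vtop = (q ^ r.-1)%N,
        forall k, (k < r)%N -> imem t (34 + (k + k + k)) = (q ^ k - 1)%N,
        scalar_eq_off [:: vi; vj; vpow; vtop; vsum] s t, table_eq 32 s t &
        table_eq 33 s t /\ fmem t = fmem s]).
Proof.
move=> Hq Hr r0.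
pose I k t := [/\ imem t vj = k, imem t vpow = (q ^ k)%N,
   (0 < k)%N -> imem t vtop = (q ^ k.-1)%N,
   forall i, (i < k)%N -> imem t (34 + (i + i + i)) = (q ^ i - 1)%N &
   [/\ scalar_eq_off [:: vi; vj; vpow; vtop; vsum] s t, table_eq 32 s t,
       table_eq 33 s t & fmem t = fmem s]].
apply: (@run_weaken _ _ _ _ (1 + (r * (3 * q + 6 + 2) + 2)) _ (I r)); last 1 first.
- by move=> t [_ _ Hb Ht [V T T' Ff]]; split=> //; exact: Hb.
- apply: run_seq; apply: run_straight => //; apply: (@run_for _ _ I).
  + split=> //=; split=> //.
    by move=> x x32; rewrite !inE => xV; mem.
  + by move=> k t [Hi _ _ _ [V _ _ _]]; split=> //=; rewrite V.
  + move=> k t kr [Hj Hb _ Ht [V T T' Ff]].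
    rewrite (_ : 3 * q + 6 = 1 + (1 + (1 + (q * (1 + 2) + 2 + 1))))%N; last by lia.
    do 3 (apply: run_seq; apply: run_straight => //).
    move E1: (post _ _) => t1.
    have Hq1 : imem t1 vq = q by rewrite -E1 /= ?Hj; mem; rewrite V.
    have Hb1 : imem t1 vpow = (q ^ k)%N by rewrite -E1 /= ?Hj; mem.
    pose J i (u : state F) := [/\ imem u vi = i, imem u vsum = (i * q ^ k)%N,
      imem_eq_off [:: vi; vsum] t1 u & fmem u = fmem t1].
    apply: run_seq; apply: (@run_weaken _ _ _ _ _ _ (J q)).
    * apply: (@run_for _ _ J).
      - split=> //=; first by rewrite -E1.
        by same (fun x => erefl (imem t1 x)).
      - by move=> i u [Hi _ W _]; split=> //=; rewrite W.
      - move=> i u iq [Hi Hs W Fu]; apply: run_straight => //.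
        split=> //=; first by rewrite Hi.
          by rewrite Hs W // Hb1 mulSnr.
        by same W.
    * by [].
    * move=> u [_ Hs W Fu].
      have Hj' : imem u vj = k by rewrite W // -E1 /= ?Hj; mem.
      have W32 x : (32 <= x)%N -> imem u x = imem t1 x.
        by move=> x32; rewrite W // !inE; lia.
      apply: run_straight => //; split=> //=.
      - by rewrite Hj'.
      - by rewrite Hs expnS.
      - by move=> _; rewrite W // -E1 /= ?Hj; mem.
      - move=> i; rewrite ltnS leq_eqVlt => ik; rewrite W32 ?leq_addr //.
        rewrite -E1 /= ?Hj; mem; case/predU1P: ik => [->|ik]; mem; first by rewrite Hb.
        exact: Ht.
      - split=> [x x32|i|i|].
        + rewrite !inE => xV; mem; rewrite W ?inE; last by lia.
          by rewrite -E1 /= ?Hj; mem; apply: V; rewrite // !inE; lia.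
        + by rewrite /=; mem; rewrite W32 ?leq_addr // -E1 /= ?Hj; mem; exact: T.
        + by rewrite /=; mem; rewrite W32 ?leq_addr // -E1 /= ?Hj; mem; exact: T'.
        + by rewrite Fu -E1 /= Ff.
- lia.
Qed.

End Tables.

(** * Transforming all rows or all columns of a matrix *)

(** [pre] prepares the scalars of the next transform.  Rows have stride 1 and
    increment N, columns stride N and increment 1. *)
Definition sweep (x inc : iexp) (pre : cmd) : cmd :=
  For vu x (pre ;; chirpz ;; vbase <- $vbase + inc)%prog.

Arguments sweep x%_ix inc%_ix pre%_prog.

Section Sweep.
Variables (F : finFieldType) (P : nat -> nat).
Notation run := (@run F P).

Definition sweep_vars : seq nat := [:: vu; vbase; vj; vptr; vi].

(** Below the product blocks, only the scalars that change from one transform to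
    the next are free. *)
Definition low_eq_off_slots (z : nat) (s t : state F) : Prop :=
  forall y, (y < z + z)%N ->
    y \notin [:: z; (z + 1)%N; (z + 7)%N; (z + 8)%N; (z + 9)%N; (z + 10)%N] ->
    fmem t y = fmem s y.

(** The sequence [w] is the value of a scalar that [pre] may carry from one
    transform to the next.  Injectivity of the addressing keeps the vectors
    disjoint, so each transform reads untouched entries. *)
Lemma sweep_run s z C L ib st cp om (tau sig c w : nat -> F) x inc pre
    (X : nat -> nat -> F) :
  imem s vz = z -> imem s vlen = L -> imem s vstride = st -> imem s vbase = (5 * z)%N ->
  (forall t, imem_eq_off sweep_vars s t ->
     ieval (imem t) x = C /\ ieval (imem t) inc = ib) ->
  (0 < L)%N -> (4 * L + 16 < z)%N -> (0 < st)%N -> om != 0 ->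
  (forall i k i' k', (i < C)%N -> (k < L)%N -> (i' < C)%N -> (k' < L)%N ->
     (i * ib + k * st = i' * ib + k' * st)%N -> i = i' /\ k = k') ->
  fmem s (z + 6)%N = om -> fmem s (z + 10)%N = w 0%N ->
  (forall i t, (i < C)%N -> imem t vu = i -> imem_eq_off sweep_vars s t ->
     low_eq_off_slots z s t -> fmem t (z + 10)%N = w i ->
     run pre t cp (fun u => [/\ imem_eq_off [:: vi] t u, low_eq_off_slots z s u,
       [/\ fmem u (z + 7)%N = tau i, fmem u (z + 8)%N = sig i,
           fmem u (z + 9)%N = c i & fmem u (z + 10)%N = w i.+1] &
       forall y, (5 * z <= y)%N -> fmem u y = fmem t y])) ->
  (forall i k, (i < C)%N -> (k < L)%N ->
     fmem s (5 * z + (i * ib + k * st))%N = X i k) ->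
  run (sweep x inc pre) s (C * (cp + 30 * L + 37 + P (2 * L)) + 2)
    (fun t => [/\ imem_eq_off sweep_vars s t, low_eq_off_slots z s t &
       forall i k, (i < C)%N -> (k < L)%N ->
         fmem t (5 * z + (i * ib + k * st))%N =
         c i * sig i ^+ k *
           \sum_(j < L) X i j * tau i ^+ j * om ^+ (j * k)]).
Proof.
move=> Hz HL Hst HB Hx L0 Lz st0 om0 inj Hom Hw Hpre HX.
pose Y i k := c i * sig i ^+ k *
           \sum_(j < L) X i j * tau i ^+ j * om ^+ (j * k).
pose I n t := [/\ imem t vu = n, imem t vbase = (5 * z + n * ib)%N,
  imem_eq_off sweep_vars s t, low_eq_off_slots z s t & fmem t (z + 10)%N = w n /\
  forall i k, (i < C)%N -> (k < L)%N ->
    fmem t (5 * z + (i * ib + k * st))%N = if (i < n)%N then Y i k else X i k].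
apply: (@run_weaken _ _ _ _
          (C * ((cp + (30 * L + 34 + P (2 * L) + 1)) + 2) + 2) _ (I C)).
- apply: (@run_for _ _ I).
  + split=> //=; first by rewrite HB mul0n addn0.
    by same (fun x => erefl (imem s x)).
  + by move=> n t [Hn _ V _ _]; split=> //; have [] := Hx t V.
  + move=> n t nC [Hn Hb V Lo [Hwn HXn]].
    apply: run_seq; apply: run_weaken (Hpre n t nC Hn V Lo Hwn) _ _ => // u.
    move=> [Vu Lu [H7 H8 H9 H10] Fu].
    have Vsu : imem_eq_off sweep_vars s u.
      move=> y yV; rewrite Vu ?V // !inE.
      by move: yV; rewrite !inE; lia.
    have ci : chirp_input u z L (5 * z + n * ib) st om (tau n) (sig n) (c n).
      split=> //; [by rewrite Vsu|by rewrite Vsu|by rewrite Vu|by rewrite Vsu| |].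
        by rewrite Lu ?Hom // ?inE; lia.
      exact: leq_addr.
    apply: run_seq; apply: run_weaken (chirpz_run P ci) _ _ => // v.
    move=> [Vv HO Fv]; have Vsv : imem_eq_off sweep_vars s v.
      move=> y yV; rewrite Vv ?Vsu // !inE.
      by move: yV; rewrite !inE; lia.
    have Hinc := (Hx v Vsv).2.
    have Hvu : imem v vu = n by rewrite Vv // Vu.
    have HvB : imem v vbase = (5 * z + n * ib)%N by rewrite Vv // Vu.
    apply: run_straight => //; split=> /=; rewrite ?Hinc ?Hvu //.
    * by rewrite HvB mulSnr; lia.
    * by move=> y yV; have := yV; rewrite !inE => yV'; mem; rewrite Vsv.
    * move=> y yz yV; rewrite Fv ?Lu //.
      - by move: yV; rewrite !inE; lia.
      - by move: yV; rewrite !inE; lia.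
      - by left.
      - by move=> k _; apply/eqP; lia.
    * split=> [|i k iC kL].
        rewrite Fv ?H10 //; [by apply/eqP; lia|by apply/eqP; lia|by left; lia|].
        by move=> k _; apply/eqP; lia.
      have XE j : (j < L)%N -> fmem u (5 * z + n * ib + j * st)%N = X n j.
        move=> jL; rewrite Fu; last by rewrite -addnA leq_addr.
        by rewrite -addnA HXn // ltnn.
      rewrite ltnS leq_eqVlt; case: (eqVneq i n) => [->|ni] /=.
        rewrite addnA HO //; congr (_ * _); apply: eq_bigr => j _.
        by rewrite XE.
      have le5 : (5 * z <= 5 * z + (i * ib + k * st))%N by exact: leq_addr.
      rewrite Fv ?Fu ?HXn //; [by apply/eqP; lia|by apply/eqP; lia|by right|].
      move=> k' k'L; rewrite -addnA eqn_add2l; apply/eqP => /inj[] // /eqP.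
      by rewrite (negbTE ni).
- by rewrite leq_add2r leq_mul2l; apply/orP; right; lia.
- move=> t [_ _ V Lo [_ H]]; split=> // i k iC kL; by rewrite H // iC.
Qed.

End Sweep.

(** * Preparation *)

(** [al] and [be] list the abscissas and the ordinates of all the points. *)
Record point_data (F : finFieldType) (q r e m n : nat) (al be : nat -> F) :
    Prop := {
  pd_curve : curve_setting F q r e;
  pd_n : n = (e * (q ^ r - q ^ r.-1))%N;
  pd_m : (m < n)%N;
  pd_point : forall i, (i < n)%N -> tr q r (al i) = be i ^+ e /\ be i != 0;
  pd_all : forall a b, tr q r a = b ^+ e -> b != 0 ->
    exists i, [/\ (i < n)%N, al i = a & be i = b] }.

(** As q^r <= 2n and a message has at most m + e coefficients, this bounds both
    the length of the input and that of each block of a polynomial product. *)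
Definition work_base (e m n : nat) : nat := (8 * n + m + e + 32)%N.

Record started (F : finFieldType) (q r e m n : nat) (al be : nat -> F)
    (s : state F) : Prop := {
  st_q : imem s vq = q; st_r : imem s vr = r; st_e : imem s ve = e;
  st_m : imem s vm = m; st_n : imem s vn = n;
  st_0 : forall x, (5 <= x)%N -> imem s x = 0%N;
  st_al : forall i, (i < n)%N -> fmem s (i + i)%N = al i;
  st_be : forall i, (i < n)%N -> fmem s (i + i + 1)%N = be i;
  st_f0 : forall y, (work_base e m n <= y)%N -> fmem s y = 0 }.

Record prepared (F : finFieldType) (q r e m n : nat) (g : F)
    (s t : state F) : Prop := {
  pr_z : imem t vz = work_base e m n;
  pr_N : imem t vN = units_card F;
  pr_bl : imem t vtop = (q ^ r.-1)%N;
  pr_in : forall v, (v < 5)%N -> imem t v = imem s v;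
  pr_g : fmem t (work_base e m n + 3)%N = g;
  pr_zeta : fmem t (work_base e m n + 4)%N = zeta e g;
  pr_e : fmem t (work_base e m n + 5)%N = e%:R;
  pr_log : forall k, (k < units_card F)%N ->
    imem t (32 + (rank_of (g ^+ k) + rank_of (g ^+ k) + rank_of (g ^+ k))) = k;
  pr_row : forall k, (k < e)%N ->
    imem t (33 + (rank_of (zeta e g ^+ k) + rank_of (zeta e g ^+ k) +
                  rank_of (zeta e g ^+ k))) = (k * units_card F)%N;
  pr_pow : forall k, (k < r)%N -> imem t (34 + (k + k + k)) = (q ^ k - 1)%N;
  pr_tw : forall u, (u < units_card F)%N ->
    fmem t (work_base e m n + 16 + u)%N ^+ e = tr q r (g ^+ u);
  pr_data : forall y, (y < work_base e m n)%N -> fmem t y = fmem s y;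
  pr_high : forall y, (work_base e m n + work_base e m n <= y)%N ->
    fmem t y = fmem s y }.

Section Prepare.
Variables (F : finFieldType) (P : nat -> nat).
Notation run := (@run F P).
Notation N := (units_card F).
Variables (q r e m n : nat) (al be : nat -> F).
Hypothesis PD : point_data q r e m n al be.
Notation z := (work_base e m n).
Let CS : curve_setting F q r e := pd_curve PD.

Lemma pd_cover x : tr q r x != 0 -> exists2 i, (i < n)%N & al i = x.
Proof.
have [g pg] := primitive_exists F => /(trace_norm CS pg)[b b0 /esym bx].
by have [i [i_n ai _]] := pd_all PD bx b0; exists i.
Qed.

Lemma card_N : (N.+1 = q ^ r)%N.
Proof.
by rewrite /units_card prednK ?(cs_F CS) // expn_gt0; have := q_gt1 CS; lia.
Qed.

(** Half of the elements of [F], at least, are abscissas of points. *)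
Lemma q_pow_half : (2 * q ^ r.-1 <= q ^ r)%N.
Proof.
have r0 := r_gt0 CS; rewrite -[X in (_ <= _ ^ X)%N](prednK r0) expnS leq_mul2r.
by rewrite (q_gt1 CS) orbT.
Qed.

Lemma e_N_le : (e * N.+1 <= 2 * n)%N.
Proof.
rewrite card_N (pd_n PD) mulnCA leq_mul2l; apply/orP; right.
by have := q_pow_half; lia.
Qed.

Lemma e_le_N : (e <= N)%N.
Proof. by rewrite dvdn_leq ?(e_dvd_N CS) // units_card_gt0. Qed.

Lemma N_lt_n : (N < 2 * n)%N.
Proof. by have := e_N_le; have := cs_e0 CS; nia. Qed.

Lemma al_neq0 i : (i < n)%N -> al i != 0.
Proof.
move=> /(pd_point PD)[tri bi]; apply: contraNneq bi => ai.
have : be i ^+ e == 0 by rewrite -tri ai (tr0 CS).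
by rewrite expf_eq0 => /andP[].
Qed.

Definition prepare_cost : nat :=
  (1 + ((28 * n + 5 + 5 * ((trunc_log 2 N).+1 * N)) + ((5 * N + 3) +
   ((3 * N + 3) + ((7 * e + 5) + ((4 * n + 2) + (r * (3 * q + 8) + 3)))))))%N.

Lemma prepare_run s : started q r e m n al be s ->
  run prepare s prepare_cost (fun t => exists2 g, N.-primitive_root g &
    prepared q r e m n g s t).
Proof.
case=> Hq Hr He Hm Hn H0 Hal Hbe Hf0.
have Nn := N_lt_n; have n0 : (0 < n)%N by lia.
have eN := e_le_N; have e0 := cs_e0 CS; have r0 := r_gt0 CS.
have wz : z = (8 * n + m + e + 32)%N by [].
apply: run_seq; apply: run_straight => //; move E1: (post _ _) => s1.
have z1 : imem s1 vz = z by rewrite -E1 /= He Hm Hn wz; lia.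
have V1 x : x != 5%N -> imem s1 x = imem s x by move=> x5; rewrite -E1; mem.
have F1 : fmem s1 = fmem s by rewrite -E1.
apply: run_seq; apply: (run_weaken (@find_primitive_run _ P s1 z n al _ _ _ _ _ _ _ _)) => //.
- by rewrite V1 ?H0.
- by rewrite V1 ?Hn.
- by lia.
- by move=> x x32; rewrite V1 ?H0 //; [lia|apply/eqP; lia].
- by move=> i i_n; rewrite F1 Hal.
- move=> x; have [_ b0] := pd_point PD n0; have [t0 _] := pd_point PD n0.
  have [|/pd_cover[i i_n <-]|/pd_cover[i i_n ai]] :=
    @translate_cover _ _ _ _ CS (al 0%N) x.
  + by rewrite t0 expf_neq0.
  + by exists i => //; left.
  + by exists i => //; right; rewrite ai opprB addrC subrK.
move=> s2 [N2 pg V2 F2]; set g := fmem s2 _ in pg.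
have z2 : imem s2 vz = z by rewrite V2.
apply: run_seq; apply: run_weaken (log_table_run P z2 N2 pg (erefl _)) _ _ => //.
move=> s3 [L3 V3 F3].
have z3 : imem s3 vz = z by rewrite V3.
have N3 : imem s3 vN = N by rewrite V3.
have e3 : imem s3 ve = e by rewrite V3 // V2 // V1.
have g3 : fmem s3 (z + 3)%N = g by rewrite F3 //; apply/eqP; lia.
apply: run_seq.
apply: run_weaken (root_of_unity_run P z3 N3 e3 e0 (e_dvd_N CS) g3) _ _ => //.
move=> s4 [zt4 V4 F4].
have z4 : imem s4 vz = z by rewrite V4.
have N4 : imem s4 vN = N by rewrite V4.
have e4 : imem s4 ve = e by rewrite V4.
apply: run_seq.
apply: run_weaken (row_table_run P z4 N4 e4 (zeta_prim CS pg) zt4) _ _ => //.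
move=> s5 [R5 E5 V5 T5 F5].
have z5 : imem s5 vz = z by rewrite V5.
have n5 : imem s5 vn = n by rewrite V5 // V4 // V3 // V2 // V1.
have F15 y : (y < z)%N || (z + 16 <= y)%N -> fmem s5 y = fmem s y.
  by move=> yz; rewrite F5 ?F4 ?F3 ?F2 ?F1 //; apply/eqP; lia.
have L5 k : (k < N)%N ->
    imem s5 (32 + (rank_of (g ^+ k) + rank_of (g ^+ k) + rank_of (g ^+ k))) = k.
  by move=> kN; rewrite T5 V4 ?L3 // !inE.
apply: run_seq.
apply: run_weaken (@base_ordinates_run _ P s5 z n e g (tr q r) al be
   z5 n5 e0 _ pg L5 _ _ _) _ _ => //.
- by lia.
- move=> i i_n; split; [by rewrite F15 ?Hal //; lia|by rewrite F15 ?Hbe //; lia| |].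
    exact: al_neq0.
  by have [-> _] := pd_point PD i_n.
- exact: pd_cover.
- by move=> u uN; rewrite F15 ?Hf0 //; lia.
move=> s6 [W6 V6 F6].
have q6 : imem s6 vq = q by rewrite V6 // V5 // V4 // V3 // V2 // V1.
have r6 : imem s6 vr = r by rewrite V6 // V5 // V4 // V3 // V2 // V1.
apply: run_weaken (power_table_run P q6 r6 r0) _ _ => //.
move=> t [B7 P7 V7 T7 [T7' F7]]; exists g => //; split=> //.
- by rewrite V7 // V6.
- by rewrite V7 // V6 // V5.
- by move=> [|[|[|[|[|v]]]]] // _; rewrite V7 // V6 // V5 // V4 // V3 // V2 // V1.
- by rewrite F7 F6 ?F5 ?F4 //; lia.
- by rewrite F7 F6 ?F5 //; lia.
- by rewrite F7 F6 //; lia.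
- by move=> k kN; rewrite T7 V6 ?L5 // !inE.
- by move=> k ke; rewrite T7' V6 ?R5 // !inE.
- by move=> u uN; rewrite F7 W6.
- by move=> y yz; rewrite F7 F6 ?F15 //; lia.
- by move=> y yz; rewrite F7 F6 ?F15 //; lia.
Qed.

End Prepare.

(** * Encoding *)

(** Visits the cells of the matrix that correspond to the monomials of the
    message space, in the order of the message: [vstride] runs through the pole
    orders e * i + q^(r-1) * j of row [j] as long as they are at most m. *)
Definition scan_rows (start : iexp) (body : cmd) : cmd := (
  vrow <- a_mat ;; vmsg <- start ;; vtmp <- 0 ;;
  For vj $ve (
    vstride <- $vtmp ;; vptr <- $vrow ;;
    While ($vm + 1 - $vstride) (
      body ;; vmsg <- $vmsg + 1 ;; vptr <- $vptr + 1 ;; vstride <- $vstride + $ve) ;;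
    vtmp <- $vtmp + $vtop ;; vrow <- $vrow + $vN))%prog.

Arguments scan_rows start%_ix body%_prog.

Definition row_count (e b m j : nat) : nat :=
  ((m.+1 - b * j + (e - 1)) %/ e)%N.

Definition scan_vars : seq nat := [:: vrow; vmsg; vtmp; vj; vstride; vptr].

Section Scan.
Variables (F : finFieldType) (P : nat -> nat).
Notation run := (@run F P).

(** [J j i] describes the data memory when the next monomial is X^i Y^j. *)
Lemma scan_run s z e m b N st start body (J : nat -> nat -> (nat -> F) -> Prop) :
  imem s vz = z -> imem s ve = e -> imem s vm = m -> imem s vtop = b ->
  imem s vN = N -> (0 < e)%N ->
  (forall t, imem_eq_off scan_vars s t -> ieval (imem t) start = st) ->
  straight body -> straight_steps body = 1%N ->
  (forall t : state F, imem (post body t) = imem t) ->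
  (forall j i (t : state F), (j < e)%N -> (i < row_count e b m j)%N ->
     imem t vmsg = (st + (\sum_(j' < j) row_count e b m j' + i))%N ->
     imem t vptr = (5 * z + (j * N + i))%N ->
     J j i (fmem t) -> J j i.+1 (fmem (post body t))) ->
  (forall j f, (j < e)%N -> J j (row_count e b m j) f -> J j.+1 0%N f) ->
  J 0%N 0%N (fmem s) ->
  run (scan_rows start body) s (e * (5 * (m %/ e) + 13) + 5)
    (fun t => imem_eq_off scan_vars s t /\ J e 0%N (fmem t)).
Proof.
move=> Hz He Hm Hb HN e0 Hst sb lb ib Jb Jr J0.
pose off j := (\sum_(j' < j) row_count e b m j')%N.
pose I j t := [/\ imem t vj = j, imem t vrow = (5 * z + j * N)%N,
  imem t vmsg = (st + off j)%N, imem t vtmp = (b * j)%N &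
  imem_eq_off scan_vars s t /\ J j 0%N (fmem t)].
apply: (@run_weaken _ _ _ _ (1 + (1 + (1 +
  (e * (1 + (1 + (((m %/ e).+1 * 5 + 1) + (1 + 1))) + 2) + 2)))) _ (I e)); last 1 first.
- by move=> t [_ _ _ _ H].
- do 3 (apply: run_seq; apply: run_straight => //); apply: (@run_for _ _ I).
  + split=> //=.
    * by rewrite Hz; lia.
    * rewrite /off big_ord0 addn0; apply: (Hst (State _ (fmem s))).
      by same (fun x => erefl (imem s x)).
    * by rewrite muln0.
    * by split=> //; same (fun x => erefl (imem s x)).
  + by move=> j t [Hj _ _ _ [V _]]; split=> //=; rewrite V.
  + move=> j t je [Hj Hrow Hmsg Ht [V Jt]].
    do 2 (apply: run_seq; apply: run_straight => //).
    move E1: (post _ _) => t1.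
    have V1 : imem_eq_off scan_vars s t1 by rewrite -E1; same V.
    have T1 : imem t1 vtmp = (b * j)%N by rewrite -E1.
    have R1 : imem t1 vrow = (5 * z + j * N)%N by rewrite -E1.
    have Y1 : imem t1 vj = j by rewrite -E1.
    pose K i (u : state F) := [/\ imem u vstride = (e * i + b * j)%N,
      imem u vptr = (5 * z + (j * N + i))%N, imem u vmsg = (st + (off j + i))%N,
      imem_eq_off [:: vstride; vptr; vmsg] t1 u & J j i (fmem u)].
    have rc : (row_count e b m j <= (m %/ e).+1)%N.
      rewrite leqNgt; apply/negP; rewrite ltn_count // => le.
      by have := ltn_ceil m e0; rewrite mulnC; lia.
    apply: run_seq; apply: (@run_weaken _ _ _ _ (row_count e b m j * 5 + 1) _
                              (K (row_count e b m j))).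
    * apply: (@run_while _ _ K).
      - split; rewrite -?E1 /= ?Ht ?Hrow ?Hmsg ?muln0 ?addn0 //.
      - move=> i u iC [HS Hp Hmg W Ju].
        have Hm' : imem u vm = m by rewrite W // V1.
        have He' : imem u ve = e by rewrite W // V1.
        split.
          by move: iC; rewrite ltn_count // /= Hm' HS; lia.
        rewrite -[4%N]/(1 + 3)%N; apply: run_seq.
        rewrite -[X in run _ _ X]lb; apply: run_straight => //.
        apply: (@run_weaken _ _ _ _ 3); [|by []|move=> v; exact: id].
        apply: run_straight => //; split=> //=; rewrite ?ib.
        + by rewrite HS He' mulnS; lia.
        + by rewrite Hp; lia.
        + by rewrite Hmg; lia.
        + by move=> x; rewrite !inE => xV; mem; rewrite ?ib W // !inE; lia.
        + exact: Jb.
      - move=> u [HS _ _ W _]; rewrite /= W // V1 // Hm HS.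
        have := ltn_count m (b * j) (row_count e b m j) e0.
        by rewrite /row_count ltnn => /esym; lia.
    * by rewrite leq_add2r leq_mul2r rc orbT.
    * move=> u [HS Hp Hmg W Ju].
      have N1 : imem u vN = N by rewrite W // V1.
      have B1 : imem u vtop = b by rewrite W // V1.
      apply: run_seq; apply: run_straight => //; apply: run_straight => //.
      split=> //=.
      - by rewrite W // Y1.
      - by rewrite W // R1 N1 mulSn; lia.
      - by rewrite Hmg /off big_ord_recr.
      - by rewrite W // T1 B1 mulnS; lia.
      - split; last exact: Jr.
        move=> x xV; have := xV; rewrite !inE => xV'; mem.
        by rewrite W ?V1 // !inE; lia.
- rewrite -[5%N]/(3 + 2)%N !addnA leq_add2r -!addnA [leqRHS]addnC !leq_add2l.
  by rewrite leq_mul2l; apply/orP; right; lia.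
Qed.

End Scan.

Definition load_rows : cmd := scan_rows ($vn + $vn) (F@$vptr <- F[$vmsg]).

(** [x] is the root of unity and [y] the scale of the transform. *)
Definition transform_rows (x y : fexp) : cmd := (
  F@f_omega <- x ;; vstride <- 1 ;; vlen <- $vN ;; vbase <- a_mat ;;
  sweep $ve $vN (F@f_tau <- 1 ;; F@f_sigma <- 1 ;; F@f_scale <- y))%prog.

Arguments transform_rows x%_fx y%_fx.

Definition transform_columns : cmd := (
  F@f_omega <- F[f_root] ;; vstride <- $vN ;; vlen <- $ve ;; vbase <- a_mat ;;
  sweep $vN 1 (F@f_tau <- F[a_base + $vu] ;; F@f_sigma <- 1 ;; F@f_scale <- 1))%prog.

(** The value at point [i] may overwrite the list of points: it goes to the
    address [i], and only the addresses from 2i on remain to be read. *)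
Definition output_values : cmd :=
  (For vi $vn (
    vkey <- key F[$vi + $vi] ;;
    vkey2 <- key (F[$vi + $vi + 1] / F[a_base + I[log_cell $vkey]]) ;;
    F@$vi <- F[a_mat + (I[log_cell $vkey] + I[row_cell $vkey2])]))%prog.

Definition encoder : cmd := (
  prepare ;; load_rows ;; transform_rows F[f_gen] 1 ;; transform_columns ;;
  output_values)%prog.

Definition cab_support (F : fieldType) (e b m : nat) (f : {poly {poly F}}) :
    Prop :=
  forall i j, f`_i`_j != 0 -> (j < e)%N /\ (e * i + b * j <= m)%N.

(** Horner evaluation row by row, the order followed by the transforms. *)
Lemma eval_support (F : fieldType) (f : {poly {poly F}}) n e (a b : F) :
  (forall i j, f`_i`_j != 0 -> (i < n)%N /\ (j < e)%N) ->
  f.[a, b] = \sum_(j < e) (\sum_(i < n) f`_i`_j * a ^+ i) * b ^+ j.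
Proof.
move=> supp.
have sf : (size f <= n)%N.
  apply/leq_sizeP => i ni; apply/polyP => j; rewrite coef0; apply/eqP.
  by apply: contraTT ni => /supp[]; rewrite -ltnNge.
have si i : (size (f`_i)%R <= e)%N.
  apply/leq_sizeP => j ej; apply/eqP.
  by apply: contraTT ej => /supp[_]; rewrite -ltnNge.
rewrite (horner_coef_wide _ sf) horner_sum.
under eq_bigr => i _ do
  rewrite hornerM -polyC_exp hornerC (horner_coef_wide _ (si i)) mulr_suml.
rewrite exchange_big; apply: eq_bigr => j _; rewrite mulr_suml.
by apply: eq_bigr => i _; rewrite mulrAC.
Qed.

Lemma idx_inj N j u j' u' : (u < N)%N -> (u' < N)%N ->
  (j * N + u = j' * N + u')%N -> j = j' /\ u = u'.
Proof.
move=> uN u'N E; have N0 : (0 < N)%N by lia.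
have := congr1 (modn^~ N) E; rewrite !modnMDl !modn_small // => uu.
split=> //; move: E; rewrite uu => /addIn/eqP.
by rewrite eqn_pmul2r // => /eqP.
Qed.

Section Encode.
Variables (F : finFieldType) (P : nat -> nat).
Notation run := (@run F P).
Notation N := (units_card F).
Variables (q r e m n : nat) (al be : nat -> F).
Hypothesis PD : point_data q r e m n al be.
Notation z := (work_base e m n).
Notation b := (q ^ r.-1)%N.
Notation W j u := (5 * z + (j * N + u))%N.
Let CS : curve_setting F q r e := pd_curve PD.

Definition msg_pos (j i : nat) : nat :=
  (\sum_(j' < j) row_count e b m j' + i)%N.

Lemma row_bound i j : (e * i + b * j <= m)%N -> (i < q ^ r - q ^ r.-1)%N.
Proof.
have := pd_m PD; rewrite (pd_n PD) => mn le.
rewrite -(ltn_pmul2l (cs_e0 CS)); lia.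
Qed.

Lemma row_bound_N i j : (e * i + b * j <= m)%N -> (i < N)%N.
Proof. by move/row_bound; have := card_N PD; have := q_pow_gt0 CS r.-1; lia. Qed.

Lemma W_inj j u j' u' : (u < N)%N -> (u' < N)%N ->
  W j u = W j' u' -> j = j' /\ u = u'.
Proof. by move=> uN u'N /addnI; exact: idx_inj. Qed.

Definition load_cost : nat := (e * (5 * (m %/ e) + 13) + 5)%N.

Lemma load_rows_run g s t (f : {poly {poly F}}) :
  started q r e m n al be s -> prepared q r e m n g s t ->
  cab_support e b m f ->
  (forall j i, (j < e)%N -> (e * i + b * j <= m)%N ->
     fmem s (n + n + msg_pos j i)%N = f`_i`_j) ->
  (forall j i, (j < e)%N -> (e * i + b * j <= m)%N -> (n + n + msg_pos j i < z)%N) ->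
  run load_rows t load_cost (fun t' =>
    [/\ imem_eq_off scan_vars t t',
        forall y, (y < 5 * z)%N -> fmem t' y = fmem t y &
        forall j u, (j < e)%N -> (u < N)%N -> fmem t' (W j u) = f`_u`_j]).
Proof.
move=> St Pr supp Hmsg Hpos; have e0 := cs_e0 CS.
pose J j i (h : nat -> F) :=
  (forall y, (y < 5 * z)%N -> h y = fmem t y) /\
  forall j' u, (j' < e)%N -> (u < N)%N ->
    h (W j' u) = if (j' < j)%N || ((j' == j) && (u < i)%N) then f`_u`_j' else 0.
apply: (@run_weaken _ _ _ _ load_cost _
  (fun u => imem_eq_off scan_vars t u /\ J e 0%N (fmem u))) => //; last first.
- move=> u [V [lo H]]; split=> // j v je vN; by rewrite H // je.
- apply: (@scan_run _ P t z e m b N (n + n)%N ($vn + $vn)%ix _ J) => //.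
  + by case: Pr.
  + by rewrite (pr_in Pr) // (st_e St).
  + by rewrite (pr_in Pr) // (st_m St).
  + by case: Pr.
  + by case: Pr.
  + by move=> u V; rewrite /= V // (pr_in Pr) // (st_n St).
  + move=> j i u je iC Hmg Hp [lo H].
    rewrite ltn_count // in iC; have iN := row_bound_N iC.
    rewrite /= Hmg Hp lo; last by have := Hpos j i je iC; rewrite /msg_pos; lia.
    rewrite (pr_data Pr); last exact: Hpos.
    rewrite Hmsg //; split=> [y yz|j' v je' vN] /=; first by mem; exact: lo.
    case: eqP => [/(W_inj vN iN)[-> ->]|ne]; first by rewrite eqxx ltnS leqnn orbT.
    rewrite H //; case: ltngtP => //= jj; rewrite (ltnS v i) (leq_eqVlt v i).
    by case: eqP => // vE; case: ne; rewrite jj vE.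
  + move=> j h je [lo H]; split=> // j' v je' vN; rewrite H // ltnS andbF orbF.
    case: ltngtP => //= ->; case: ifP => // /negbT; rewrite ltn_count // => nle.
    by apply/esym/eqP; apply: contraR nle => /supp[].
  + split=> // j' v je' vN; rewrite ltn0 andbF (pr_high Pr) ?(st_f0 St) //; lia.
Qed.

Definition transform_cost (C L : nat) : nat :=
  (C * (30 * L + 40 + P (2 * L)) + 6)%N.

(** The tables, the points and the constants prepared beforehand survive the
    later phases, which use the free scalars, the product blocks and the
    matrix. *)
Definition preserved (t t' : state F) : Prop :=
  (forall x, x \notin scan_vars ++ sweep_vars ++ [:: vstride; vlen; vkey; vkey2; vi] ->
     imem t' x = imem t x) /\
  forall y, (y < z + 6)%N || (z + 16 <= y < z + z)%N ->
     y \notin [:: z; (z + 1)%N] -> fmem t' y = fmem t y.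

Lemma transform_rows_run g s t x y (om c : F) (X : nat -> nat -> F) :
  prepared q r e m n g s t -> started q r e m n al be s -> om != 0 ->
  (forall t1, preserved t t1 -> feval t1 x = om) ->
  (forall t1 : state F, feval t1 y = c) ->
  forall t1, preserved t t1 ->
  (forall j u, (j < e)%N -> (u < N)%N -> fmem t1 (W j u) = X j u) ->
  run (transform_rows x y) t1 (transform_cost e N) (fun t2 => preserved t t2 /\
    forall j k, (j < e)%N -> (k < N)%N ->
      fmem t2 (W j k) = c * \sum_(u < N) X j u * om ^+ (u * k)).
Proof.
move=> Pr St om0 Hx Hy t1 S1 HX; have [V1 F1] := S1.
have Nn := N_lt_n PD; have eN := e_le_N PD; have e0 := cs_e0 CS.
have wz : z = (8 * n + m + e + 32)%N by [].
have z1 : imem t1 vz = z by rewrite V1 //; case: Pr.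
apply: (@run_weaken _ _ _ _ (1 + (1 + (1 + (1 +
  (e * (3 + 30 * N + 37 + P (2 * N)) + 2))))) _
  (fun t2 => preserved t t2 /\
    forall j k, (j < e)%N -> (k < N)%N -> fmem t2 (W j k) =
     c * 1 ^+ k * \sum_(u < N) X j u * 1 ^+ u * om ^+ (u * k))).
- do 4 (apply: run_seq; apply: run_straight => //).
  move E2: (post _ _) => t2.
  have V2 a : a \notin [:: vstride; vlen; vbase] -> imem t2 a = imem t1 a.
    by rewrite !inE => aV; rewrite -E2; mem.
  have F2 a : a != (z + 6)%N -> fmem t2 a = fmem t1 a.
    by move=> a6; rewrite -E2 /= !z1; mem.
  have N1 : imem t1 vN = N by rewrite V1 //; case: Pr.
  have e1 : imem t1 ve = e by rewrite V1 // (pr_in Pr) // (st_e St).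
  have H6 : fmem t2 (z + 6)%N = om by rewrite -E2 /= !z1 Hx //; mem.
  apply: run_weaken (@sweep_run _ P t2 z e N N 1 3 om (fun _ => 1) (fun _ => 1)
    (fun _ => c) (fun _ => fmem t2 (z + 10)%N) ($ve)%ix ($vN)%ix
    (F@f_tau <- 1 ;; F@f_sigma <- 1 ;; F@f_scale <- y)%prog X
    _ _ _ _ _ _ _ _ om0 _ H6 _ _ _) _ _ => //.
  + by rewrite V2.
  + by rewrite -E2.
  + by rewrite -E2.
  + by rewrite -E2 /= !z1; lia.
  + by move=> u V; rewrite /= !V // !V2.
  + exact: units_card_gt0.
  + by lia.
  + move=> i k i' k' _ kN _ k'N; rewrite !muln1; exact: idx_inj.
  + move=> i u iC _ V L Hw.
    have zu : imem u vz = z by rewrite V // V2.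
    apply: run_straight => //; rewrite /= !Hy zu; split=> //.
    * by move=> a az; rewrite !inE => aV; mem; rewrite L // !inE; lia.
    * by split; mem.
    * by move=> a az; mem.
  + by move=> i k iC kN; rewrite muln1 F2 ?HX //; apply/eqP; lia.
  move=> t3 [V3 L3 H3]; split; last first.
    by move=> j k je kN; rewrite -(H3 j k) // muln1.
  split=> [a aV|a az aV].
    by rewrite V3 ?V2 ?V1 //; move: aV; rewrite !inE; lia.
  by rewrite L3 ?F2 ?F1 //; move: aV; rewrite ?inE; lia.
- rewrite /transform_cost.
  by rewrite (_ : 3 + 30 * N + 37 = 30 * N + 40)%N; lia.
- move=> t3 [S3 H3]; split=> // j k je kN; rewrite H3 // expr1n mulr1; congr (_ * _).
  by apply: eq_bigr => u _; rewrite expr1n mulr1.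
Qed.

Lemma transform_columns_run g s t (X : nat -> nat -> F) (tw : nat -> F) :
  prepared q r e m n g s t -> started q r e m n al be s -> g != 0 ->
  (forall u, (u < N)%N -> fmem t (z + 16 + u)%N = tw u) ->
  forall t1, preserved t t1 ->
  (forall j u, (j < e)%N -> (u < N)%N -> fmem t1 (W j u) = X j u) ->
  run transform_columns t1 (transform_cost N e) (fun t2 => preserved t t2 /\
    forall k u, (k < e)%N -> (u < N)%N ->
      fmem t2 (W k u) =
      \sum_(j < e) X j u * tw u ^+ j * zeta e g ^+ (j * k)).
Proof.
move=> Pr St g0 Htw t1 [V1 F1] HX.
have Nn := N_lt_n PD; have eN := e_le_N PD; have e0 := cs_e0 CS.
have wz : z = (8 * n + m + e + 32)%N by [].
have z1 : imem t1 vz = z by rewrite V1 //; case: Pr.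
have zt0 : zeta e g != 0 by rewrite expf_neq0.
apply: (@run_weaken _ _ _ _ (1 + (1 + (1 + (1 +
  (N * (3 + 30 * e + 37 + P (2 * e)) + 2))))) _
  (fun t2 => preserved t t2 /\
    forall k u, (k < e)%N -> (u < N)%N -> fmem t2 (W k u) =
     1 * 1 ^+ k * \sum_(j < e) X j u * tw u ^+ j * zeta e g ^+ (j * k))).
- do 4 (apply: run_seq; apply: run_straight => //).
  move E2: (post _ _) => t2.
  have V2 x : x \notin [:: vstride; vlen; vbase] -> imem t2 x = imem t1 x.
    by rewrite !inE => xV; rewrite -E2; mem.
  have F2 y : y != (z + 6)%N -> fmem t2 y = fmem t1 y.
    by move=> y6; rewrite -E2 /= !z1; mem.
  have N1 : imem t1 vN = N by rewrite V1 //; case: Pr.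
  have e1 : imem t1 ve = e by rewrite V1 // (pr_in Pr) // (st_e St).
  have g1 : fmem t1 (z + 4)%N = zeta e g.
    by rewrite F1 ?(pr_zeta Pr) //; [lia|rewrite !inE; lia].
  have H6 : fmem t2 (z + 6)%N = zeta e g by rewrite -E2 /= !z1; mem.
  have tw2 u : (u < N)%N -> fmem t2 (z + 16 + u)%N = tw u.
    move=> uN; rewrite F2 ?F1 ?Htw //; last by apply/eqP; lia.
      by lia.
    by rewrite !inE; lia.
  apply: run_weaken (@sweep_run _ P t2 z N e 1 N 3 (zeta e g) tw (fun _ => 1)
    (fun _ => 1) (fun _ => fmem t2 (z + 10)%N) ($vN)%ix 1%ix
    (F@f_tau <- F[a_base + $vu] ;; F@f_sigma <- 1 ;; F@f_scale <- 1)%prog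
    (fun u j => X j u)
    _ _ _ _ _ e0 _ _ zt0 _ H6 _ _ _) _ _ => //.
  + by rewrite V2.
  + by rewrite -E2.
  + by rewrite -E2.
  + by rewrite -E2 /= !z1; lia.
  + by move=> u V; rewrite /= !V // !V2.
  + by lia.
  + exact: units_card_gt0.
  + move=> i k i' k' iN _ i'N _; rewrite !muln1 addnC [RHS]addnC.
    by move=> /(idx_inj iN i'N)[-> ->].
  + move=> i u iC Hi V L Hw.
    have zu : imem u vz = z by rewrite V // V2.
    have tu : fmem u (z + 16 + i)%N = tw i.
      by rewrite L ?tw2 //; [lia|rewrite !inE; lia].
    apply: run_straight => //; rewrite /= zu Hi tu; split=> //.
    * by move=> y yz; rewrite !inE => yV; mem; rewrite L // !inE; lia.
    * by split; mem.
    * by move=> y yz; mem.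
  + by move=> i k iC kN; rewrite muln1 [(i + _)%N]addnC F2 ?HX //; apply/eqP; lia.
  move=> t3 [V3 L3 H3]; split; last first.
    by move=> k u ke uN; rewrite -(H3 u k) // muln1 [(u + _)%N]addnC.
  split=> [x xV|y yz yV].
    by rewrite V3 ?V2 ?V1 //; move: xV; rewrite !inE; lia.
  by rewrite L3 ?F2 ?F1 //; move: yV; rewrite ?inE; lia.
- rewrite /transform_cost.
  by rewrite (_ : 3 + 30 * e + 37 = 30 * e + 40)%N; lia.
- move=> t3 [S3 H3]; split=> // j k je kN; rewrite H3 // expr1n !mul1r //.
Qed.

Lemma point_log g (tw : nat -> F) i : N.-primitive_root g ->
  (forall u, (u < N)%N -> tw u ^+ e = tr q r (g ^+ u)) -> (i < n)%N ->
  exists u k, [/\ (u < N)%N, (k < e)%N, al i = g ^+ u, tw u != 0 &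
                 be i = tw u * zeta e g ^+ k].
Proof.
move=> pg Htw i_n; have [tri bi] := pd_point PD i_n.
have [u uN alu] := log_exists pg (al_neq0 PD i_n).
have tu : tw u ^+ e = be i ^+ e by rewrite Htw // -alu.
have tu0 : tw u != 0.
  apply: contraNneq bi => t0; move: tu; rewrite t0 expr0n.
  by rewrite eqn0Ngt (cs_e0 CS) /= => /esym/eqP; rewrite expf_eq0 => /andP[].
by have [k ke bk] := same_norm CS pg tu0 tu; exists u, k.
Qed.

Lemma output_values_run g s t (tw : nat -> F) (f : F -> F -> F) :
  prepared q r e m n g s t -> started q r e m n al be s -> N.-primitive_root g ->
  (forall u, (u < N)%N -> fmem t (z + 16 + u)%N = tw u) ->
  (forall u, (u < N)%N -> tw u ^+ e = tr q r (g ^+ u)) ->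
  forall t1, preserved t t1 ->
  (forall k u, (k < e)%N -> (u < N)%N ->
     fmem t1 (W k u) = f (g ^+ u) (tw u * zeta e g ^+ k)) ->
  run output_values t1 (5 * n + 2) (fun t2 =>
    forall i, (i < n)%N -> fmem t2 i = f (al i) (be i)).
Proof.
move=> Pr St pg Htw twE t1 [V1 F1] HW.
have Nn := N_lt_n PD; have eN := e_le_N PD; have e0 := cs_e0 CS.
have wz : z = (8 * n + m + e + 32)%N by [].
have z1 : imem t1 vz = z by rewrite V1 //; case: Pr.
have n1 : imem t1 vn = n by rewrite V1 // (pr_in Pr) // (st_n St).
pose I k t2 := [/\ imem t2 vi = k, imem_eq_off [:: vi; vkey; vkey2] t1 t2,
  forall i, (i < k)%N -> fmem t2 i = f (al i) (be i) &
  forall y, (k <= y)%N -> fmem t2 y = fmem t1 y].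
apply: (@run_weaken _ _ _ _ (n * (3 + 2) + 2) _ (I n)); last 1 first.
- by move=> t2 [].
- apply: (@run_for _ _ I).
  + by split=> //; same (fun x => erefl (imem t1 x)).
  + by move=> k t2 [Hi V _ _]; split=> //=; rewrite V.
  + move=> k t2 kn [Hi V Ho Hf].
    have z2 : imem t2 vz = z by rewrite V.
    have al2 : fmem t2 (k + k)%N = al k.
      rewrite Hf ?F1 ?(pr_data Pr) ?(st_al St) //; try (rewrite ?inE; lia).
    have be2 : fmem t2 (k + k + 1)%N = be k.
      rewrite Hf ?F1 ?(pr_data Pr) ?(st_be St) //; try (rewrite ?inE; lia).
    have [u [v [uN ve' alu tu0 bev]]] := point_log pg twE kn.
    have V2 x : (32 <= x)%N -> imem t2 x = imem t x.
      by move=> x32; rewrite V ?V1 // !inE; lia.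
    have tw2 : fmem t2 (z + 16 + u)%N = tw u.
      by rewrite Hf ?F1 ?Htw //; try (rewrite ?inE; lia).
    have W2 : fmem t2 (W v u) = f (al k) (be k).
      by rewrite Hf ?HW // -?alu -?bev //; lia.
    have log2 : imem t2 (32 + (rank_of (al k) + rank_of (al k) + rank_of (al k))) = u.
      by rewrite V2 ?alu ?(pr_log Pr) ?leq_addr.
    have quo : be k / tw u = zeta e g ^+ v by rewrite bev mulrC mulKf.
    have row2 : imem t2 (33 + (rank_of (be k / tw u) + rank_of (be k / tw u) + rank_of (be k / tw u)))
              = (v * N)%N.
      by rewrite V2 ?quo ?(pr_row Pr) //; lia.
    apply: run_straight => //.
    rewrite /= Hi al2 be2 -!/(rank_of _) z2 log2 tw2 -!/(rank_of _).
    rewrite row2 (_ : _ + (u + _) = W v u)%N; last by lia.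
    rewrite W2; split=> //=.
    * by same V.
    * move=> i; rewrite ltnS leq_eqVlt => /predU1P[->|ik]; first by rewrite eqxx.
      by mem; exact: Ho.
    * by move=> y ky; mem; apply: Hf; lia.
- by lia.
Qed.

Definition encoder_cost : nat :=
  (prepare_cost F q r e n + (load_cost + (transform_cost e N +
   (transform_cost N e + (5 * n + 2)))))%N.

Lemma preserved_scan t t' : imem_eq_off scan_vars t t' ->
  (forall y, (y < 5 * z)%N -> fmem t' y = fmem t y) -> preserved t t'.
Proof.
have wz : z = (8 * n + m + e + 32)%N by [].
move=> V Fl; split=> [x xV|y yz _]; last by apply: Fl; lia.
by rewrite V //; apply: contra xV; rewrite mem_cat => ->.
Qed.

Lemma encoder_run s (f : {poly {poly F}}) :
  started q r e m n al be s -> cab_support e b m f ->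
  (forall j i, (j < e)%N -> (e * i + b * j <= m)%N ->
     fmem s (n + n + msg_pos j i)%N = f`_i`_j) ->
  (forall j i, (j < e)%N -> (e * i + b * j <= m)%N -> (n + n + msg_pos j i < z)%N) ->
  run encoder s encoder_cost (fun t =>
    forall i, (i < n)%N -> fmem t i = f.[al i, be i]).
Proof.
move=> St supp Hmsg Hpos.
apply: run_seq; apply: run_weaken (prepare_run P PD St) _ _ => // t [g pg Pr].
have g0 : g != 0 by rewrite (prim_root_eq0 pg) -lt0n units_card_gt0.
apply: run_seq; apply: run_weaken (load_rows_run St Pr supp Hmsg Hpos) _ _ => //.
move=> t1 [V1 F1 W1]; have S1 := preserved_scan V1 F1.
apply: run_seq; apply: run_weaken
  (@transform_rows_run g s t F[f_gen] 1%fx g 1 _ Pr St g0 _ _ t1 S1 W1) _ _ => //.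
  move=> t2 [V2 F2]; have wz : z = (8 * n + m + e + 32)%N by [].
  rewrite /= V2 // (pr_z Pr) F2 ?(pr_g Pr) //; [lia|rewrite !inE; lia].
move=> t2 [S2 W2].
pose tw u := fmem t (z + 16 + u)%N.
pose Y j u := 1 * \sum_(i < N) f`_i`_j * g ^+ (i * u).
apply: run_seq.
apply: run_weaken (@transform_columns_run g s t Y tw Pr St g0 _ t2 S2 W2) _ _ => //.
move=> t3 [S3 W3].
apply: run_weaken (@output_values_run g s t tw (fun a c => f.[a, c]) Pr St pg _
  (pr_tw Pr) t3 S3 _) _ _ => // k u ke uN.
rewrite W3 // (@eval_support _ f N e); last first.
  by move=> i j /supp[je le]; split=> //; exact: row_bound_N le.
apply: eq_bigr => j _; rewrite exprMn -[(zeta e g ^+ k) ^+ j]exprM [(k * j)%N]mulnC.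
rewrite mulrA /Y mul1r; congr (_ * _ * _).
by apply: eq_bigr => i _; rewrite -exprM mulnC.
Qed.

End Encode.

(** * Unencoding *)

Definition scatter : cmd :=
  (For vi $vn (
    vkey <- key F[$vi + $vi] ;;
    vkey2 <- key (F[$vi + $vi + 1] / F[a_base + I[log_cell $vkey]]) ;;
    F@(a_mat + (I[log_cell $vkey] + I[row_cell $vkey2])) <- F[$vn + $vn + $vi]))%prog.

(** For the abscissa a and the ordinate c above it, scale = c^e / (e a) and
    sigma = 1/c.  The factor 1/e and sigma invert the transform on the coset of
    c, and c^e / a = tr a / a prepares the inversion of the rows.  Where the
    trace is 0, c is 0 and the whole column becomes 0, the value of
    f_j * tr / X there. *)
Definition column_scalars : cmd := (
  F@f_scale <- (F[f_abs] * F[f_e])^-1 ;;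
  For vi $ve (F@f_scale <- F[f_scale] * F[a_base + $vu]) ;;
  F@f_sigma <- F[a_base + $vu]^-1 ;; F@f_tau <- 1 ;; F@f_abs <- F[f_abs] * F[f_gen])%prog.

Definition inverse_columns : cmd := (
  F@f_omega <- F[f_root]^-1 ;; F@f_abs <- 1 ;; vstride <- $vN ;; vlen <- $ve ;; vbase <- a_mat ;;
  sweep $vN 1 column_scalars)%prog.

(** Division by tr / X = 1 + X^(q-1) + X^(q^2-1) + ..., in place from the lowest
    coefficient on: the subtracted entries are already final. *)
Definition divide_rows : cmd := (
  vrow <- a_mat ;;
  For vj $ve (
    For vi $vN (
      For vk ($vr - 1) (
        If ($vi + 1 - I[pow_cell ($vk + 1)])
          (F@($vrow + $vi) <-
             F[$vrow + $vi] - F[$vrow + ($vi - I[pow_cell ($vk + 1)])])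
          Skip)) ;;
    vrow <- $vrow + $vN))%prog.

Definition store_rows : cmd := scan_rows 0 (F@$vmsg <- F[$vptr]).

Definition unencoder : cmd := (
  prepare ;; scatter ;; inverse_columns ;;
  transform_rows (F[f_gen]^-1) (0 - 1) ;; divide_rows ;; store_rows)%prog.

Section Unencode.
Variables (F : finFieldType) (P : nat -> nat).
Notation run := (@run F P).
Notation N := (units_card F).
Variables (q r e m n : nat) (al be : nat -> F).
Hypothesis PD : point_data q r e m n al be.
Notation z := (work_base e m n).
Notation b := (q ^ r.-1)%N.
Notation W j u := (5 * z + (j * N + u))%N.
Let CS : curve_setting F q r e := pd_curve PD.
Notation preserved := (@preserved F e m n).

(** Each entry of a column over an abscissa of a point is written, since all the
    points are in the list; the other columns keep the initial 0. *)
Lemma scatter_run g s t (tw : nat -> F) (f : F -> F -> F) :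
  prepared q r e m n g s t -> started q r e m n al be s -> N.-primitive_root g ->
  (forall u, (u < N)%N -> fmem t (z + 16 + u)%N = tw u) ->
  (forall u, (u < N)%N -> tw u ^+ e = tr q r (g ^+ u)) ->
  (forall i, (i < n)%N -> fmem s (n + n + i)%N = f (al i) (be i)) ->
  run scatter t (5 * n + 2) (fun t1 => preserved t t1 /\
    forall k u, (k < e)%N -> (u < N)%N -> fmem t1 (W k u) =
      if tw u == 0 then 0 else f (g ^+ u) (tw u * zeta e g ^+ k)).
Proof.
move=> Pr St pg Htw twE Hcw.
have Nn := N_lt_n PD; have eN := e_le_N PD; have e0 := cs_e0 CS.
have wz : z = (8 * n + m + e + 32)%N by [].
have z1 : imem t vz = z by case: Pr.
have n1 : imem t vn = n by rewrite (pr_in Pr) // (st_n St).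
have g0 : g != 0 by rewrite (prim_root_eq0 pg) -lt0n units_card_gt0.
pose val k u : F :=
  if tw u == 0 then 0 else f (g ^+ u) (tw u * zeta e g ^+ k).
pose I i t1 := [/\ imem t1 vi = i, imem_eq_off [:: vi; vkey; vkey2] t t1,
  forall y, (y < 5 * z)%N -> fmem t1 y = fmem t y,
  forall k u, (k < e)%N -> (u < N)%N ->
    fmem t1 (W k u) = 0 \/ fmem t1 (W k u) = val k u &
  forall i' k u, (i' < i)%N -> (k < e)%N -> (u < N)%N ->
    al i' = g ^+ u -> be i' = tw u * zeta e g ^+ k ->
    fmem t1 (W k u) = val k u].
apply: (@run_weaken _ _ _ _ (n * (3 + 2) + 2) _ (I n)); last 1 first.
- move=> t1 [_ V Fl H0 Hv]; split.
    split=> [x xV|y yz _]; last by apply: Fl; lia.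
    by rewrite V //; move: xV; rewrite !inE; lia.
  move=> k u ke uN; rewrite -/(val k u); case: (eqVneq (tw u) 0) => t0.
    by have [->|->//] := H0 k u ke uN; rewrite /val t0 eqxx.
  have tn : tr q r (g ^+ u) = (tw u * zeta e g ^+ k) ^+ e.
    by rewrite exprMn twE // exprAC (prim_expr_order (zeta_prim CS pg)) expr1n mulr1.
  have [|i [i_n ai bi]] := pd_all PD tn.
    by rewrite mulf_neq0 // !expf_neq0.
  exact: Hv i_n ke uN ai bi.
- apply: (@run_for _ _ I).
  + split=> //=; first by same (fun x => erefl (imem t x)).
    by move=> k u ke uN; left; rewrite (pr_high Pr) ?(st_f0 St) //; lia.
  + by move=> k t1 [Hi V _ _ _]; split=> //=; rewrite V.
  + move=> k t1 kn [Hi V Fl H0 Hv].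
    have z2 : imem t1 vz = z by rewrite V.
    have n2 : imem t1 vn = n by rewrite V.
    have al2 : fmem t1 (k + k)%N = al k.
      by rewrite Fl ?(pr_data Pr) ?(st_al St) //; lia.
    have be2 : fmem t1 (k + k + 1)%N = be k.
      by rewrite Fl ?(pr_data Pr) ?(st_be St) //; lia.
    have cw2 : fmem t1 (n + n + k)%N = f (al k) (be k).
      by rewrite Fl ?(pr_data Pr) ?Hcw //; lia.
    have [u [v [uN ve' alu tu0 bev]]] := point_log PD pg twE kn.
    have V2 x : (32 <= x)%N -> imem t1 x = imem t x.
      by move=> x32; rewrite V // !inE; lia.
    have tw2 : fmem t1 (z + 16 + u)%N = tw u by rewrite Fl ?Htw //; lia.
    have log2 : imem t1 (32 + (rank_of (al k) + rank_of (al k) + rank_of (al k))) = u.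
      by rewrite V2 ?alu ?(pr_log Pr) ?leq_addr.
    have quo : be k / tw u = zeta e g ^+ v by rewrite bev mulrC mulKf.
    have row2 : imem t1 (33 + (rank_of (be k / tw u) + rank_of (be k / tw u) + rank_of (be k / tw u)))
              = (v * N)%N.
      by rewrite V2 ?quo ?(pr_row Pr) //; lia.
    have valk : f (al k) (be k) = val v u by rewrite /val (negbTE tu0) -alu -bev.
    apply: run_straight => //.
    rewrite /= Hi al2 be2 -!/(rank_of _) z2 n2 log2 tw2 -!/(rank_of _) row2 cw2.
    rewrite (_ : _ + (u + _) = W v u)%N; last by lia.
    split=> //=.
    * by same V.
    * by move=> y yz; mem; exact: Fl.
    * move=> k' u' ke' uN'; case: eqP => [/(W_inj uN' uN)[-> ->]|_].
        by right.
      exact: H0.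
    * move=> i k' u' ik ke' uN' aliu beik.
      case: eqP => [/(W_inj uN' uN)[-> ->]//|ne].
      apply: (Hv i) => //; move: ik; rewrite ltnS leq_eqVlt => /predU1P[ik|//].
      case: ne; move: aliu beik; rewrite ik alu bev => /eqP.
      rewrite (eq_prim_root_expr pg) !modn_small // => /eqP <- /(mulfI tu0)/eqP.
      by rewrite (eq_prim_root_expr (zeta_prim CS pg)) !modn_small // => /eqP <-.
- by lia.
Qed.

Lemma tr_neq0 g u (tw : nat -> F) :
  (forall u, (u < N)%N -> tw u ^+ e = tr q r (g ^+ u)) -> (u < N)%N ->
  tw u = 0 -> tr q r (g ^+ u) = 0.
Proof.
by move=> twE uN t0; rewrite -twE // t0 expr0n eqn0Ngt (cs_e0 CS).
Qed.

Lemma column_scalars_run u y i (tu h c x : F) :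
  imem u vz = y -> imem u ve = e -> imem u vu = i ->
  fmem u (y + 16 + i)%N = tu -> fmem u (y + 3)%N = h -> fmem u (y + 5)%N = c ->
  fmem u (y + 10)%N = x ->
  run column_scalars u (3 * e + 6) (fun v => [/\ imem_eq_off [:: vi] u v,
    [/\ fmem v (y + 7)%N = 1, fmem v (y + 8)%N = tu^-1,
        fmem v (y + 9)%N = (x * c)^-1 * tu ^+ e & fmem v (y + 10)%N = x * h] &
    forall a, a \notin [:: (y + 7)%N; (y + 8)%N; (y + 9)%N; (y + 10)%N] ->
      fmem v a = fmem u a]).
Proof.
move=> Hy He Hi Ht Hh Hc Hx.
pose I k v := [/\ imem v vi = k, imem_eq_off [:: vi] u v,
  fmem v (y + 9)%N = (x * c)^-1 * tu ^+ k &
  forall a, a != (y + 9)%N -> fmem v a = fmem u a].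
apply: (@run_weaken _ _ _ _ (1 + (e * (1 + 2) + 2 + (1 + (1 + 1)))) _
  (fun v => [/\ imem_eq_off [:: vi] u v,
    [/\ fmem v (y + 7)%N = 1, fmem v (y + 8)%N = tu^-1,
        fmem v (y + 9)%N = (x * c)^-1 * tu ^+ e & fmem v (y + 10)%N = x * h] &
    forall a, a \notin [:: (y + 7)%N; (y + 8)%N; (y + 9)%N; (y + 10)%N] ->
      fmem v a = fmem u a])) => //; last by lia.
apply: run_seq; apply: run_straight => //.
apply: run_seq; apply: (@run_weaken _ _ _ _ (e * (1 + 2) + 2) _ (I e)) => //.
  apply: (@run_for _ _ I).
  - split=> //=; first by same (fun a => erefl (imem u a)).
      by rewrite Hy; mem; rewrite Hx Hc mulr1.
    by move=> a a9; rewrite Hy; mem.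
  - by move=> k v [Hk V _ _]; split=> //=; rewrite V.
  - move=> k v ke [Hk V H9 Hf]; apply: run_straight => //.
    have y' : imem v vz = y by rewrite V.
    have i' : imem v vu = i by rewrite V.
    have t' : fmem v (y + 16 + i)%N = tu by rewrite Hf //; apply/eqP; lia.
    rewrite /= y' i' H9 t' -mulrA -exprSr Hk; split=> //=; first by same V.
      by mem.
    by move=> a a9; mem; exact: Hf.
move=> v [_ V H9 Hf].
have y' : imem v vz = y by rewrite V.
have i' : imem v vu = i by rewrite V.
have t' : fmem v (y + 16 + i)%N = tu by rewrite Hf //; apply/eqP; lia.
have x' : fmem v (y + 10)%N = x by rewrite Hf //; apply/eqP; lia.
have h' : fmem v (y + 3)%N = h by rewrite Hf //; apply/eqP; lia.
do 2 (apply: run_seq; apply: run_straight => //); apply: run_straight => //.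
rewrite /= !y' !i' t'; split=> //=.
  by split; mem; rewrite // x' h'.
by move=> a; rewrite !inE => aV; mem; apply: Hf; lia.
Qed.

Lemma inverse_columns_run g s t (X : nat -> nat -> F) (tw : nat -> F) :
  prepared q r e m n g s t -> started q r e m n al be s -> N.-primitive_root g ->
  (forall u, (u < N)%N -> fmem t (z + 16 + u)%N = tw u) ->
  forall t1, preserved t t1 ->
  (forall j u, (j < e)%N -> (u < N)%N -> fmem t1 (W j u) = X j u) ->
  run inverse_columns t1 (N * (33 * e + 43 + P (2 * e)) + 7) (fun t2 =>
    preserved t t2 /\
    forall j u, (j < e)%N -> (u < N)%N ->
      fmem t2 (W j u) = (g ^+ u * e%:R)^-1 * tw u ^+ e * (tw u)^-1 ^+ j *
      \sum_(k < e) X k u * (zeta e g)^-1 ^+ (k * j)).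
Proof.
move=> Pr St pg Htw t1 [V1 F1] HX.
have Nn := N_lt_n PD; have eN := e_le_N PD; have e0 := cs_e0 CS.
have wz : z = (8 * n + m + e + 32)%N by [].
have z1 : imem t1 vz = z by rewrite V1 //; case: Pr.
have g0 : g != 0 by rewrite (prim_root_eq0 pg) -lt0n units_card_gt0.
have zt0 : (zeta e g)^-1 != 0 by rewrite invr_eq0 expf_neq0.
pose c u := (g ^+ u * e%:R)^-1 * tw u ^+ e.
apply: (@run_weaken _ _ _ _ (1 + (1 + (1 + (1 + (1 +
  (N * ((3 * e + 6) + 30 * e + 37 + P (2 * e)) + 2)))))) _
  (fun t2 => preserved t t2 /\
    forall k u, (k < e)%N -> (u < N)%N -> fmem t2 (W k u) =
     c u * (tw u)^-1 ^+ k *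
     \sum_(j < e) X j u * 1 ^+ j * (zeta e g)^-1 ^+ (j * k))).
- do 5 (apply: run_seq; apply: run_straight => //).
  move E2: (post _ _) => t2.
  have V2 x : x \notin [:: vstride; vlen; vbase] -> imem t2 x = imem t1 x.
    by rewrite !inE => xV; rewrite -E2; mem.
  have F2 y : y != (z + 6)%N -> y != (z + 10)%N -> fmem t2 y = fmem t1 y.
    by move=> y6 y10; rewrite -E2 /= !z1; mem.
  have N1 : imem t1 vN = N by rewrite V1 //; case: Pr.
  have e1 : imem t1 ve = e by rewrite V1 // (pr_in Pr) // (st_e St).
  have g1 : fmem t1 (z + 4)%N = zeta e g.
    by rewrite F1 ?(pr_zeta Pr) //; [lia|rewrite !inE; lia].
  have H6 : fmem t2 (z + 6)%N = (zeta e g)^-1 by rewrite -E2 /= !z1; mem; rewrite g1.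
  have H10 : fmem t2 (z + 10)%N = g ^+ 0 by rewrite -E2 /= !z1; mem.
  have tw2 u : (u < N)%N -> fmem t2 (z + 16 + u)%N = tw u.
    move=> uN; rewrite F2 ?F1 ?Htw //; try (apply/eqP; lia); try lia.
    by rewrite !inE; lia.
  have low_slot u k : low_eq_off_slots z t2 u -> (k == 3%N) || (k == 5%N) ->
      fmem u (z + k)%N = fmem t (z + k)%N.
    move=> L k35; rewrite L ?F2 ?F1 ?inE //; try (apply/eqP; lia); lia.
  apply: run_weaken (@sweep_run _ P t2 z N e 1 N (3 * e + 6) (zeta e g)^-1
    (fun _ => 1) (fun u => (tw u)^-1) c (fun u => g ^+ u) ($vN)%ix 1%ix
    column_scalars (fun u j => X j u)
    _ _ _ _ _ e0 _ _ zt0 _ H6 H10 _ _) _ _ => //.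
  + by rewrite V2.
  + by rewrite -E2.
  + by rewrite -E2.
  + by rewrite -E2 /= !z1; lia.
  + by move=> u V; rewrite /= !V // !V2.
  + by lia.
  + exact: units_card_gt0.
  + move=> i k i' k' iN _ i'N _; rewrite !muln1 addnC [RHS]addnC.
    by move=> /(idx_inj iN i'N)[-> ->].
  + move=> i u iC Hi V L Hw.
    have zu : imem u vz = z by rewrite V // V2.
    have eu : imem u ve = e by rewrite V // V2.
    have tu : fmem u (z + 16 + i)%N = tw i.
      by rewrite L ?tw2 //; [lia|rewrite !inE; lia].
    have u3 : fmem u (z + 3)%N = g by rewrite (low_slot _ _ L) // (pr_g Pr).
    have u5 : fmem u (z + 5)%N = e%:R by rewrite (low_slot _ _ L) // (pr_e Pr).
    apply: run_weaken (column_scalars_run zu eu Hi tu u3 u5 Hw) _ _ => //.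
    move=> v [Vv [H7 H8 H9 Hv10] Fv]; split=> //.
    * move=> y yz yV; rewrite Fv ?L //.
      by move: yV; rewrite !inE; lia.
    * by split=> //; rewrite exprSr.
    * by move=> y yz; rewrite Fv // !inE; lia.
  + move=> i k iC kN; rewrite muln1 [(i + _)%N]addnC F2 ?HX //; apply/eqP; lia.
  move=> t3 [V3 L3 H3]; split; last first.
    by move=> k u ke uN; rewrite -(H3 u k) // muln1 [(u + _)%N]addnC.
  split=> [x xV|y yz yV].
    by rewrite V3 ?V2 ?V1 //; move: xV; rewrite !inE; lia.
  by rewrite L3 ?F2 ?F1 //; move: yV; rewrite ?inE; lia.
- by rewrite (_ : 3 * e + 6 + 30 * e + 37 = 33 * e + 43)%N; lia.
- move=> t3 [S3 H3]; split=> // j k je kN; rewrite H3 //; congr (_ * _).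
  by apply: eq_bigr => u _; rewrite expr1n mulr1.
Qed.

Lemma order_natr : N%:R = -1 :> F.
Proof.
apply/eqP; rewrite -addr_eq0 natr1 (card_N PD).
case: (cs_q CS) => p [k [pp k0 qE]].
have cF : p \in [pchar F].
  by apply: (card_finPcharP (n := (k * r)%N)) => //; rewrite (cs_F CS) qE expnM.
by rewrite qE -expnM natrX (pcharf0 cF) expr0n eqn0Ngt muln_gt0 k0 (r_gt0 CS).
Qed.

(** Where the trace vanishes both sides are zero.  Elsewhere this is the inverse
    transform of length e, the factor [tw u ^+ i] of the coset being cancelled
    by [(tw u)^-1 ^+ j]. *)
Lemma columns_recovered g (tw : nat -> F) (Y : nat -> nat -> F) j u :
  N.-primitive_root g -> (u < N)%N -> (j < e)%N ->
  (forall u, (u < N)%N -> tw u ^+ e = tr q r (g ^+ u)) ->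
  (g ^+ u * e%:R)^-1 * tw u ^+ e * (tw u)^-1 ^+ j *
  \sum_(k < e) (if tw u == 0 then 0 else
     \sum_(i < e) Y i u * (tw u * zeta e g ^+ k) ^+ i) *
     (zeta e g)^-1 ^+ (k * j) =
  tr q r (g ^+ u) / g ^+ u * Y j u.
Proof.
move=> pg uN je twE; have pz := zeta_prim CS pg.
have e1 : e%:R != 0 :> F by exact: prim_root_natf_neq0 pz.
have g0 : g ^+ u != 0 by rewrite expf_neq0 // (prim_root_eq0 pg) -lt0n units_card_gt0.
case: (eqVneq (tw u) 0) => [t0|t0].
  by rewrite (tr_neq0 twE uN t0) t0 expr0n eqn0Ngt (cs_e0 CS) /= mulr0 !mul0r.
rewrite (eq_bigr (fun k : 'I_e => (\sum_(i < e) (Y i u * tw u ^+ i) *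
    zeta e g ^+ (i * k)) * (zeta e g)^-1 ^+ (k * j))); last first.
  move=> k _; congr (_ * _); apply: eq_bigr => i _.
  by rewrite exprMn mulrA -exprM [(k * i)%N]mulnC.
rewrite (dft_inv (fun i => Y i u * tw u ^+ i) pz je) -twE // exprVn.
field; rewrite e1 g0 expf_neq0 //.
Qed.

(** Multiplication by x^d, with room for the shifted coefficients. *)
Lemma shift_sum (a : nat -> F) L d x : (d <= L)%N ->
  (forall i, (L - d <= i)%N -> a i = 0) ->
  \sum_(i < L) a i * x ^+ (i + d) =
  \sum_(i < L) (if (d <= i)%N then a (i - d)%N else 0) * x ^+ i.
Proof.
move=> dL a0.
rewrite -(big_mkord xpredT (fun i => a i * x ^+ (i + d))).
rewrite -(big_mkord xpredT (fun i => (if (d <= i)%N then a (i - d)%N else 0) * x ^+ i)).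
rewrite (big_cat_nat (n := (L - d)%N)) ?leq_subr //= [X in _ + X]big_nat_cond.
rewrite [X in _ + X]big1 ?addr0; last first.
  by move=> i /andP[/andP[Li _] _]; rewrite a0 // mul0r.
rewrite [RHS](big_cat_nat (n := d)) //= [X in _ = X + _]big_nat_cond.
rewrite [X in _ = X + _]big1 ?add0r; last first.
  by move=> i /andP[/andP[_ id] _]; rewrite leqNgt id mul0r.
rewrite -[X in \sum_(X <= _ < L) _]add0n big_addn.
by apply: eq_bigr => i _; rewrite leq_addl addnK.
Qed.

(** The coefficients of the product of a row with tr / X. *)
Definition row_quotient (a : nat -> F) (i : nat) : F :=
  \sum_(k < r) if (q ^ k - 1 <= i)%N then a (i - (q ^ k - 1))%N else 0.

(** The degree bound on the row keeps the degree of its product with tr / X below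
    N, so that no coefficient is wrapped around by the transform. *)
Lemma row_quotient_eval (a : nat -> F) x : x != 0 ->
  (forall i, (q ^ r - q ^ r.-1 <= i)%N -> a i = 0) ->
  tr q r x / x * \sum_(i < N) a i * x ^+ i =
  \sum_(i < N) row_quotient a i * x ^+ i.
Proof.
move=> x0 a0; rewrite /tr !mulr_suml.
under [RHS]eq_bigr => i _ do rewrite /row_quotient mulr_suml.
rewrite exchange_big /=; apply: eq_bigr => k _.
have qk : (q ^ k <= q ^ r.-1)%N.
  by rewrite leq_exp2l ?(q_gt1 CS) //; have := ltn_ord k; lia.
have qk0 := q_pow_gt0 CS k; have half := q_pow_half PD; have cN := card_N PD.
rewrite -shift_sum; [|lia|by move=> i iN; apply: a0; lia].
rewrite mulr_sumr; apply: eq_bigr => i _.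
have -> : x ^+ (q ^ k) = x ^+ (q ^ k - 1) * x by rewrite -exprSr -subSn // subn1.
by rewrite mulfK // exprD [RHS]mulrA mulrC.
Qed.

Lemma row_quotient_first a i : row_quotient a i = a i +
  \sum_(k < r - 1) if (q ^ k.+1 - 1 <= i)%N then a (i - (q ^ k.+1 - 1))%N else 0.
Proof.
rewrite /row_quotient; have [r' rE] : exists r', r = r'.+1.
  by exists r.-1; rewrite prednK // (r_gt0 CS).
rewrite rE subn1 big_ord_recl /= expn0 subnn subn0; congr (_ + _).
Qed.

Lemma divide_rows_run g s t (a : nat -> nat -> F) :
  prepared q r e m n g s t -> started q r e m n al be s ->
  forall t1, preserved t t1 ->
  (forall j i, (j < e)%N -> (i < N)%N ->
     fmem t1 (W j i) = row_quotient (a j) i) ->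
  run divide_rows t1 (e * (N * (4 * r + 4) + 7) + 3) (fun t2 =>
    imem_eq_off [:: vrow; vj; vi; vk] t1 t2 /\
    forall j i, (j < e)%N -> (i < N)%N -> fmem t2 (W j i) = a j i).
Proof.
move=> Pr St t1 [V1 F1] HX.
have e0 := cs_e0 CS; have r0 := r_gt0 CS.
have z1 : imem t1 vz = z by rewrite V1 //; case: Pr.
have N1 : imem t1 vN = N by rewrite V1 //; case: Pr.
have e1 : imem t1 ve = e by rewrite V1 // (pr_in Pr) // (st_e St).
have r1 : imem t1 vr = r by rewrite V1 // (pr_in Pr) // (st_r St).
have pow1 k : (k < r - 1)%N ->
    imem t1 (34 + (k.+1 + k.+1 + k.+1)) = (q ^ k.+1 - 1)%N.
  by move=> kr; rewrite V1 ?(pr_pow Pr) //; lia.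
pose part k j i := a j i + \sum_(k' < r - 1 - k)
  if (q ^ (k + k').+1 - 1 <= i)%N then a j (i - (q ^ (k + k').+1 - 1))%N else 0.
pose content k j i t2 := forall j' i', (j' < e)%N -> (i' < N)%N ->
  fmem t2 (W j' i') =
    if (j' < j)%N || ((j' == j) && (i' < i)%N) then a j' i'
    else if (j' == j) && (i' == i) then part k j i else row_quotient (a j') i'.
have part0 j i : part 0%N j i = row_quotient (a j) i.
  by rewrite row_quotient_first /part subn0.
have part_last j i : part (r - 1)%N j i = a j i.
  by rewrite /part subnn big_ord0 addr0.
pose I j t2 := [/\ imem t2 vj = j, imem t2 vrow = (5 * z + j * N)%N,
  imem_eq_off [:: vrow; vj; vi; vk] t1 t2 & content 0%N j 0%N t2].
pose J j i t2 := [/\ imem t2 vi = i, imem t2 vj = j,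
  imem t2 vrow = (5 * z + j * N)%N, imem_eq_off [:: vrow; vj; vi; vk] t1 t2 &
  content 0%N j i t2].
pose K j i k t2 := [/\ imem t2 vk = k, imem t2 vi = i, imem t2 vj = j,
  imem t2 vrow = (5 * z + j * N)%N & imem_eq_off [:: vrow; vj; vi; vk] t1 t2 /\
  content k j i t2].
apply: (@run_weaken _ _ _ _
  (1 + (e * ((N * ((r - 1) * (2 + 2) + 2 + 2) + 2) + 1 + 2) + 2)) _ (I e)); last 1 first.
- move=> t2 [_ _ V H]; split=> // j i je iN; by rewrite H // je.
- apply: run_seq; apply: run_straight => //; apply: (@run_for _ _ I).
  + split=> //=; first by rewrite z1; lia.
      by same (fun x => erefl (imem t1 x)).
    move=> j i je iN; rewrite ltn0 andbF /=.
    rewrite HX //; case: andP => // -[/eqP-> /eqP->].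
    by rewrite part0.
  + by move=> j t2 [Hj _ V _]; split=> //=; rewrite V.
  + move=> j t2 je [Hj Hrow V H].
    apply: run_seq; apply: (@run_weaken _ _ _ _ _ _ (J j N)); first last.
    * move=> t3 [_ Hj3 Hrow3 V3 H3]; apply: run_straight => //; split=> //=.
      - by rewrite Hj3.
      - by rewrite Hrow3 V3 // N1 mulSn; lia.
      - by same V3.
      - move=> j' i' je' iN'; rewrite /= H3 // iN' andbT andbF orbF (ltnS j' j).
        rewrite (leq_eqVlt j' j) orbC; case: ifP => // _.
        rewrite (ltn_eqF iN') andbF; case: andP => // [[/eqP -> /eqP ->]].
        by rewrite part0.
    * exact: leqnn.
    * apply: (@run_for _ _ (J j)).
      - by split=> //=; same V.
      - by move=> i t3 [Hi _ _ V3 _]; split=> //=; rewrite V3.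
      - move=> i t3 iN [Hi Hj3 Hrow3 V3 H3].
        apply: (@run_weaken _ _ _ _ _ _ (K j i (r - 1)%N)); first last.
        + move=> t4 [_ Hi4 Hj4 Hrow4 [V4 H4]]; split=> //=.
          * by rewrite Hi4.
          * by same V4.
          * move=> j' i' je' iN'; rewrite /= H4 // part_last.
            rewrite (ltnS i' i) (leq_eqVlt i' i).
            case: (ltngtP j' j) => //= jj; case: (ltngtP i' i) => //= ii.
              by case: eqP => // ->; rewrite jj part0.
            by rewrite jj ii.
        + exact: leqnn.
        + apply: (@run_for _ _ (K j i)).
          * by split=> //=; split=> //; same V3.
          * by move=> k t4 [Hk _ _ _ [V4 _]]; split=> //=; rewrite V4 // r1.
          * move=> k t4 kr [Hk Hi4 Hj4 Hrow4 [V4 H4]].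
            have p4 : imem t4 (34 + (k.+1 + k.+1 + k.+1)) = (q ^ k.+1 - 1)%N.
              by rewrite V4 ?pow1 // !inE; lia.
            have partS : part k.+1 j i = part k j i -
                (if (q ^ k.+1 - 1 <= i)%N then a j (i - (q ^ k.+1 - 1))%N else 0).
              rewrite /part (_ : r - 1 - k = (r - 1 - k.+1).+1)%N; last by lia.
              rewrite big_ord_recl addn0 [a j i + (_ + _)]addrA [RHS]addrAC addrK.
              congr (_ + _); apply: eq_bigr => k' _.
              by rewrite /= /bump /= add1n addnS.
            apply: (@run_weaken _ _ _ _ 2); [|by []|move=> v; exact: id].
            apply: run_straight => //.
            rewrite /= Hk Hi4 Hrow4 !addn1 p4.
            have d0 : (0 < q ^ k.+1 - 1)%N.
              by rewrite subn_gt0 -[X in (X < _)%N](expn0 q) ltn_exp2l // (q_gt1 CS).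
            move: partS d0; set d := (q ^ k.+1 - 1)%N => partS d0.
            rewrite subn_eq0 ltnNge negbK; case: (leqP d i) partS => di partS; last first.
              split=> //=; first by rewrite Hk.
              by split; [same V4|move=> j' i' je' iN'; rewrite /= H4 // partS subr0].
            have Hi1 : fmem t4 (5 * z + j * N + i)%N = part k j i.
              by rewrite -addnA H4 // !eqxx !ltnn.
            have Hi2 : fmem t4 (5 * z + j * N + (i - d))%N = a j (i - d)%N.
              by rewrite -addnA H4 //; [rewrite eqxx ifT //; lia|lia].
            rewrite Hi1 Hi2 -partS -addnA /=.
            split=> //=; first by rewrite Hk.
            split; first by same V4.
            move=> j' i' je' iN' /=.
            case: eqP => [/(W_inj iN' iN)[-> ->]|ne]; first by rewrite !eqxx !ltnn.
            rewrite H4 //; case: ifP => // _; case: andP => // -[/eqP jj /eqP ii].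
            by case: ne; rewrite jj ii.
- rewrite (_ : (r - 1) * (2 + 2) + 2 + 2 = 4 * r)%N; last by lia.
  have : (N * (4 * r) <= N * (4 * r + 4))%N by rewrite leq_mul2l leq_addr orbT.
  move=> le; have : (e * (N * (4 * r) + 2 + 1 + 2 + 2) <= e * (N * (4 * r + 4) + 7))%N.
    by rewrite leq_mul2l; apply/orP; right; lia.
  lia.
Qed.

Lemma msg_pos_next j :
  msg_pos q r e m j (row_count e b m j) = msg_pos q r e m j.+1 0.
Proof. by rewrite /msg_pos big_ord_recr /= addn0. Qed.

Lemma msg_pos_le j : (msg_pos q r e m j 0 <= j * (m %/ e).+1)%N.
Proof.
rewrite /msg_pos addn0 -[X in (_ <= X * _)%N](card_ord j) -sum_nat_const.
apply: leq_sum => i _; rewrite leqNgt; apply/negP.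
rewrite ltn_count ?(cs_e0 CS) // => le.
by have := ltn_ceil m (cs_e0 CS); rewrite mulnC; lia.
Qed.

Lemma msg_pos_mono j k : (j <= k)%N ->
  (msg_pos q r e m j 0 <= msg_pos q r e m k 0)%N.
Proof.
move/subnK <-; elim: (k - j)%N => // d IH; apply: (leq_trans IH).
by rewrite addSn -msg_pos_next leq_add2l.
Qed.

Lemma msg_pos_lt j i : (j < e)%N -> (e * i + b * j <= m)%N ->
  (msg_pos q r e m j i < msg_pos q r e m e 0)%N.
Proof.
move=> je le; apply: (@leq_trans (msg_pos q r e m j.+1 0)); last exact: msg_pos_mono.
rewrite -msg_pos_next; have : (i < row_count e b m j)%N by rewrite ltn_count ?(cs_e0 CS).
by rewrite /msg_pos ltn_add2l.
Qed.

Lemma msg_size_le : (msg_pos q r e m e 0 <= m + e)%N.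
Proof.
apply: leq_trans (msg_pos_le e) _.
by rewrite mulnS addnC leq_add2r mulnC leq_trunc_div.
Qed.

Lemma store_rows_run g s t (a : nat -> nat -> F) (msg : nat -> F) :
  prepared q r e m n g s t -> started q r e m n al be s ->
  forall t1, imem_eq_off (scan_vars ++ sweep_vars ++ [:: vstride; vlen; vkey; vkey2; vi; vk]) t t1 ->
  (forall j i, (j < e)%N -> (i < N)%N -> fmem t1 (W j i) = a j i) ->
  (forall j i, (j < e)%N -> (e * i + b * j <= m)%N ->
     msg (msg_pos q r e m j i) = a j i) ->
  run store_rows t1 (load_cost e m) (fun t2 =>
    forall p, (p < msg_pos q r e m e 0)%N -> fmem t2 p = msg p).
Proof.
move=> Pr St t1 V1 HW Hmsg; have e0 := cs_e0 CS.
have wz : z = (8 * n + m + e + 32)%N by [].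
pose J j i (h : nat -> F) :=
  (forall y, (5 * z <= y)%N -> h y = fmem t1 y) /\
  forall p, (p < msg_pos q r e m j i)%N -> h p = msg p.
apply: (@run_weaken _ _ _ _ (load_cost e m) _
  (fun u => imem_eq_off scan_vars t1 u /\ J e 0%N (fmem u))) => //; last first.
- by move=> u [_ []].
- apply: (@scan_run _ P t1 z e m b N 0 0%ix _ J) => //.
  + by rewrite V1 //; case: Pr.
  + by rewrite V1 // (pr_in Pr) // (st_e St).
  + by rewrite V1 // (pr_in Pr) // (st_m St).
  + by rewrite V1 //; case: Pr.
  + by rewrite V1 //; case: Pr.
  + move=> j i u je iC Hmg Hp [lo H].
    rewrite ltn_count // in iC.
    have lt : (msg_pos q r e m j i < 5 * z)%N.
      by have := msg_pos_lt je iC; have := msg_size_le; lia.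
    have Hmg' : imem u vmsg = msg_pos q r e m j i by rewrite Hmg.
    rewrite /= Hmg' Hp lo ?leq_addr // HW ?(row_bound_N PD iC) // -Hmsg //.
    split=> [y yz|p]; first by rewrite /=; mem; exact: lo.
    rewrite /msg_pos addnS ltnS leq_eqVlt => /predU1P[->|lt']; first by rewrite /= eqxx.
    by rewrite /= ltn_eqF //; apply: H.
  + by move=> j h je [lo H]; split=> // p; rewrite -msg_pos_next; exact: H.
  + by split=> // p; rewrite /msg_pos big_ord0.
Qed.

Definition unencoder_cost : nat :=
  (prepare_cost F q r e n + ((5 * n + 2) + ((N * (33 * e + 43 + P (2 * e)) + 7) +
   (transform_cost P e N + ((e * (N * (4 * r + 4) + 7) + 3) + load_cost e m)))))%N.

Lemma unencoder_run s (f : {poly {poly F}}) (msg : nat -> F) :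
  started q r e m n al be s -> cab_support e b m f ->
  (forall i, (i < n)%N -> fmem s (n + n + i)%N = f.[al i, be i]) ->
  (forall j i, (j < e)%N -> (e * i + b * j <= m)%N ->
     msg (msg_pos q r e m j i) = f`_i`_j) ->
  run unencoder s unencoder_cost (fun t =>
    forall p, (p < msg_pos q r e m e 0)%N -> fmem t p = msg p).
Proof.
move=> St supp Hcw Hmsg.
apply: run_seq; apply: run_weaken (prepare_run P PD St) _ _ => // t [g pg Pr].
have g0 : g != 0 by rewrite (prim_root_eq0 pg) -lt0n units_card_gt0.
pose tw u := fmem t (z + 16 + u)%N.
have twE : forall u, (u < N)%N -> tw u ^+ e = tr q r (g ^+ u) := pr_tw Pr.
apply: run_seq.
apply: run_weaken (@scatter_run g s t tw (fun a c => f.[a, c]) Pr St pg _ twE Hcw)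
  _ _ => // t1 [S1 W1].
apply: run_seq.
apply: run_weaken (@inverse_columns_run g s t _ tw Pr St pg _ t1 S1 W1)
  _ _ => // t2 [S2 W2].
pose a j i := f`_i`_j.
pose G j := row_quotient (a j).
have fz j i : (q ^ r - q ^ r.-1 <= i)%N -> a j i = 0.
  move=> ri; apply/eqP; apply: contraTT ri => /supp[_ /(row_bound PD)].
  by rewrite -ltnNge.
have {}W2 j u : (j < e)%N -> (u < N)%N ->
    fmem t2 (W j u) = \sum_(i < N) G j i * g ^+ (i * u).
  move=> je uN; rewrite W2 //.
  pose Y i u := \sum_(l < N) f`_l`_i * (g ^+ u) ^+ l.
  rewrite (eq_bigr (fun k : 'I_e => (if tw u == 0 then 0 else
     \sum_(i < e) Y i u * (tw u * zeta e g ^+ k) ^+ i) *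
     (zeta e g)^-1 ^+ (k * j))); last first.
    move=> k _; congr (_ * _); case: ifP => // _.
    apply: (@eval_support _ f N e) => i i' /supp[ie le]; split=> //.
    exact: (row_bound_N PD le).
  rewrite (columns_recovered Y pg uN je twE).
  rewrite (row_quotient_eval _ (fz j)) ?expf_neq0 //.
  by apply: eq_bigr => i _; rewrite -exprM mulnC.
apply: run_seq; apply: run_weaken
  (@transform_rows_run _ P _ _ _ _ _ _ _ PD g s t (F[f_gen]^-1)%fx (0 - 1)%fx g^-1
     (0 - 1) _ Pr St _ _ _ t2 S2 W2) _ _ => //.
- by rewrite invr_eq0.
- move=> t' [V' F']; have wz : z = (8 * n + m + e + 32)%N by [].
  rewrite /= V' // (pr_z Pr) F' ?(pr_g Pr) //; [lia|rewrite !inE; lia].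
move=> t3 [S3 W3].
have {}W3 j i : (j < e)%N -> (i < N)%N -> fmem t3 (W j i) = row_quotient (a j) i.
  move=> je iN; rewrite W3 // (dft_inv (G j) pg iN) order_natr.
  by rewrite sub0r mulrA mulrNN mul1r mul1r.
apply: run_seq; apply: run_weaken (divide_rows_run Pr St S3 W3) _ _ => //.
move=> t4 [V4 W4].
apply: run_weaken (store_rows_run Pr St _ W4 Hmsg) _ _ => //.
move=> x xV; rewrite V4 ?(S3.1) //; move: xV; rewrite !inE; lia.
Qed.

End Unencode.

(** * Step counts *)

Section Counts.
Variables (F : finFieldType) (P : nat -> nat).
Notation N := (units_card F).
Variables (q r e m n : nat) (al be : nat -> F).
Hypothesis PD : point_data q r e m n al be.
Notation b := (q ^ r.-1)%N.
Let CS : curve_setting F q r e := pd_curve PD.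
Notation T := (trunc_log 2 N).+1.

(** The table of powers of q is built with r * q additions. *)
Lemma r_q_le : (r * q <= q ^ r)%N.
Proof.
have r0 := r_gt0 CS; rewrite -[X in (_ <= _ ^ X)%N](prednK r0) expnSr leq_mul2r.
apply/orP; right; rewrite -[X in (X <= _)%N](prednK r0).
apply: leq_trans (ltn_expl r.-1 (isT : (1 < 2)%N)) _.
have r1 : (0 < r.-1)%N by have := cs_r CS; lia.
by rewrite leq_exp2r // (q_gt1 CS).
Qed.

Lemma prepare_cost_le : (prepare_cost F q r e n <= 130 * (n * T))%N.
Proof.
have Nn := N_lt_n PD; have eN := e_le_N PD; have rq := r_q_le.
have cN := card_N PD; have q1 := q_gt1 CS; have r0 := r_gt0 CS.
have rr : (r <= r * q)%N by rewrite leq_pmulr //; lia.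
have TN : (T * N <= 2 * (n * T))%N.
  by rewrite mulnC mulnA leq_mul2r ltnW // orbT.
have nT : (n <= n * T)%N by rewrite leq_pmulr.
rewrite /prepare_cost mulnDr [(r * (3 * q))%N]mulnCA; lia.
Qed.

Lemma load_cost_le : (load_cost e m <= 5 * m + 13 * e + 5)%N.
Proof.
rewrite /load_cost mulnDr mulnCA; have := leq_trunc_div m e; rewrite mulnC.
lia.
Qed.

Lemma transform_cost_le C L : (C <= 2 * n)%N -> (C * L <= 2 * n)%N -> (0 < n)%N ->
  (transform_cost P C L <= C * P (2 * L) + 146 * n)%N.
Proof.
move=> Cn CL n0; rewrite /transform_cost.
lia.
Qed.

(** The factor T comes from the search for a primitive element. *)
Lemma encoder_cost_le :
  (encoder_cost F P q r e m n <=
   500 * (n * T) + (e * P (2 * N) + N * P (2 * e)))%N.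
Proof.
have Nn := N_lt_n PD; have eN := e_le_N PD; have eNn := e_N_le PD.
have mn := pd_m PD; have n0 : (0 < n)%N by lia.
have eN2 : (e * N <= 2 * n)%N by apply: leq_trans eNn; rewrite leq_mul2l leqnSn orbT.
have Ne2 : (N * e <= 2 * n)%N by rewrite mulnC.
have e2n : (e <= 2 * n)%N by lia.
have N2n : (N <= 2 * n)%N by lia.
have nT : (n <= n * T)%N by rewrite leq_pmulr.
have := prepare_cost_le; have := load_cost_le.
have := transform_cost_le e2n eN2 n0; have := transform_cost_le N2n Ne2 n0.
rewrite /encoder_cost; lia.
Qed.

Lemma n_le_eQ : (n <= e * q ^ r)%N.
Proof. by rewrite (pd_n PD) leq_mul2l leq_subr orbT. Qed.

(** The summand r of the last factor comes from the division by the r terms of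
    tr / X. *)
Lemma unencoder_cost_le :
  (unencoder_cost F P q r e m n <=
   500 * (e * q ^ r * (T + r)) + (e * P (2 * N) + N * P (2 * e)))%N.
Proof.
have e0 := cs_e0 CS; have cN := card_N PD; have mn := pd_m PD.
have r0 := r_gt0 CS; have nQ := n_le_eQ.
set Q := (q ^ r)%N in cN nQ *; set S := (T + r)%N; set E := (e * Q)%N in nQ *.
have NQ : (N < Q)%N by rewrite cN.
have QE : (Q <= E)%N by rewrite leq_pmull.
have eE : (e <= E)%N by rewrite leq_pmulr //; lia.
have NeE : (N * e <= E)%N by rewrite mulnC leq_mul2l ltnW ?orbT.
have ES : (E <= E * S)%N by rewrite leq_pmulr // /S; lia.
have nTS : (n * T <= E * S)%N by rewrite leq_mul // leq_addr.
have eNr : (e * (N * r) <= E * S)%N.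
  by rewrite mulnA [(e * N)%N]mulnC leq_mul // leq_addl.
have := prepare_cost_le; have := load_cost_le.
rewrite /unencoder_cost /transform_cost.
set X := P (2 * e); set Y := P (2 * N).
lia.
Qed.
End Counts.

(** * Input and output conventions *)

Definition point_count (i : params) : nat := #|P_Ne i|.

Section Interface.
Variable i : params.
Notation F := (pF i).
Notation q := (pq i).
Notation r := (pr i).
Notation e := (pe i).
Notation m := (pm i).
Notation n := (point_count i).

Lemma setting_curve : setting i -> curve_setting F q r e.
Proof. by case=> hq hr [e0 de ne] hF; split. Qed.

Lemma P_Ne_trace : P_Ne i =
  [set A : F * F | (tr q r A.1 == A.2 ^+ e) && (A.2 != 0)].
Proof.
apply/setP => A; rewrite !inE; congr (_ && _).
by rewrite -[H_Ne i]/(Hpoly F q r e) Hpoly_eval subr_eq0.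
Qed.

Lemma card_P_Ne : setting i -> n = (e * (q ^ r - q ^ r.-1))%N.
Proof.
by move=> /setting_curve CS; rewrite /point_count P_Ne_trace (card_points CS).
Qed.

Variable pts : seq (F * F).
Definition abscissa (k : nat) : F := (nth (0, 0) pts k).1.
Definition ordinate (k : nat) : F := (nth (0, 0) pts k).2.

Hypothesis Hi : code_setting i.
Hypothesis Hpts : point_list pts.

Lemma size_pts : size pts = n.
Proof.
by case: Hpts => u E; rewrite /point_count -(card_uniqP u); apply: eq_card.
Qed.

Lemma params_data : point_data q r e m n abscissa ordinate.
Proof.
case: Hi Hpts => Si mn [u E]; have inP k : (k < n)%N -> nth (0, 0) pts k \in P_Ne i.
  by move=> kn; rewrite -E mem_nth // size_pts.
split=> //; first exact: setting_curve.
- exact: card_P_Ne.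
- by move=> k /inP; rewrite P_Ne_trace inE => /andP[/eqP].
- move=> a c ac c0; have acP : (a, c) \in pts.
    by rewrite E P_Ne_trace inE /= ac eqxx.
  exists (index (a, c) pts); rewrite /abscissa /ordinate nth_index //.
  by rewrite -size_pts index_mem.
Qed.

Lemma size_flat_points : size (flat_points pts) = (n + n)%N.
Proof. by rewrite -size_pts /flat_points; elim: pts => //= A s IH; rewrite IH; lia. Qed.

Lemma nth_flat_points k : (k < n)%N ->
  nth 0 (flat_points pts) (k + k) = abscissa k /\
  nth 0 (flat_points pts) (k + k + 1) = ordinate k.
Proof.
rewrite -size_pts /flat_points /abscissa /ordinate.
elim: pts k => //= A s IH [|k] //= /IH[<- <-]; by rewrite addnS.
Qed.

Lemma load_started (data : seq F) :
  (n + n + size data <= work_base e m n)%N ->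
  started q r e m n abscissa ordinate
    (load (parameters i) (flat_points pts ++ data)).
Proof.
move=> sz; split=> //=.
- by move=> x x5; rewrite nth_default.
- move=> k kn; rewrite nth_cat size_flat_points ifT; last by lia.
  by have [] := nth_flat_points kn.
- move=> k kn; rewrite nth_cat size_flat_points ifT; last by lia.
  by have [] := nth_flat_points kn.
- by move=> y yz; rewrite nth_default // size_cat size_flat_points; lia.
Qed.

Lemma load_data (data : seq F) k :
  fmem (load (parameters i) (flat_points pts ++ data)) (n + n + k)%N = nth 0 data k.
Proof. by rewrite /= nth_cat size_flat_points ltnNge leq_addr /= addKn. Qed.

Let CS := setting_curve Hi.1.

Variable f : {poly {poly F}}.
Hypothesis Hf : riemann_roch (H_Ne i) m f.

Lemma degY_H : degY (H_Ne i) = e.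
Proof. exact: (degY_Hpoly CS). Qed.

Lemma degX_H : degX (H_Ne i) = (q ^ r.-1)%N.
Proof. exact: (degX_Hpoly CS). Qed.

Lemma riemann_roch_support : cab_support e (q ^ r.-1) m f.
Proof.
move=> k j /Hf; rewrite mem_filter degY_H degX_H.
case/andP => le /allpairsPdep[j' [k' [jn _ [_ jE]]]].
by move: le jn; rewrite /= -jE mem_iota => -> /= ->.
Qed.

Lemma message_nth j k : (j < e)%N -> (e * k + q ^ r.-1 * j <= m)%N ->
  nth 0 (message (H_Ne i) m f) (msg_pos q r e m j k) = f`_k`_j.
Proof.
move=> je le; rewrite (message_rows _ _ (cs_e0 CS) degY_H degX_H).
rewrite (nth_rows 0 (fun j i => f`_i`_j) (c := row_count e (q ^ r.-1) m)) //.
by rewrite ltn_count ?(cs_e0 CS).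
Qed.

Lemma size_message : size (message (H_Ne i) m f) = msg_pos q r e m e 0.
Proof.
by rewrite (message_rows _ _ (cs_e0 CS) degY_H degX_H) size_rows /msg_pos addn0.
Qed.

Lemma encoder_correct P : exists c t,
  [/\ steps P encoder
        (load (parameters i) (flat_points pts ++ message (H_Ne i) m f)) c t,
      outputs t (ev pts f) & (c <= encoder_cost F P q r e m n)%N].
Proof.
have PD := params_data; have wz : work_base e m n = (8 * n + m + e + 32)%N by [].
have sm := msg_size_le PD; have ez := e_le_N PD; have Nn := N_lt_n PD.
have [|||c [t [st le out]]] :=
  @encoder_run F P q r e m n abscissa ordinate PD
    (load (parameters i) (flat_points pts ++ message (H_Ne i) m f)) f
    _ riemann_roch_support.
- by apply: load_started; rewrite size_message; lia.
- by move=> j k je le; rewrite load_data message_nth.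
- by move=> j k je le; have := msg_pos_lt PD je le; lia.
exists c, t; split=> //; rewrite /outputs.
apply: (@eq_from_nth _ 0); first by rewrite size_mkseq.
move=> k; rewrite size_mkseq size_map => kn.
rewrite nth_mkseq ?size_map // out -?size_pts //.
by rewrite (nth_map (0, 0)).
Qed.

Lemma unencoder_correct P : exists c t,
  [/\ steps P unencoder (load (parameters i) (flat_points pts ++ ev pts f)) c t,
      outputs t (message (H_Ne i) m f) &
      (c <= unencoder_cost F P q r e m n)%N].
Proof.
have PD := params_data; have wz : work_base e m n = (8 * n + m + e + 32)%N by [].
have [|||c [t [st le out]]] :=
  @unencoder_run F P q r e m n abscissa ordinate PD
    (load (parameters i) (flat_points pts ++ ev pts f)) f
    (nth 0 (message (H_Ne i) m f)) _ riemann_roch_support.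
- by apply: load_started; rewrite size_map size_pts; lia.
- move=> k kn; rewrite load_data (nth_map (0, 0)) ?size_pts //.
- by move=> j k je lt; rewrite message_nth.
exists c, t; split=> //; rewrite /outputs.
apply: (@eq_from_nth _ 0); first by rewrite size_mkseq.
move=> k; rewrite size_mkseq => kn; rewrite nth_mkseq // out //.
by rewrite -size_message.
Qed.

End Interface.

(** * The cost of multiplication *)

(** Every write to the data memory costs at least 1, even for [w = 0]. *)
Lemma exec0_free w (F : finFieldType) p (s t : state F) c :
  exec0 w p s c t -> c = 0%N -> fmem t = fmem s.
Proof.
elim=> //=; try by move=> *; lia.
- move=> p1 p2 s0 c1 s1 c2 s2 _ IH1 _ IH2 c0; rewrite IH2 ?IH1 //; lia.
- move=> x p1 p2 s0 c0 t0 _ _ IH c1; apply: IH; lia.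
- move=> x p1 p2 s0 c0 t0 _ _ IH c1; apply: IH; lia.
- move=> x p0 s0 c1 s1 c2 s2 _ _ IH1 _ IH2 c0; rewrite IH2 ?IH1 //; lia.
Qed.

Section Multiplication.
Variables (R : realType) (w : nat) (mul : cmd) (M : nat -> R).
Hypothesis mulM : multiplication_cost w mul M.

Lemma mul_bound_ge0 n : 0 <= M n.
Proof.
have [||c [t [_ _ le]]] := mulM (n := n) (f := (0 : {poly 'F_2})) (g := 0).
- by rewrite size_poly0.
- by rewrite size_poly0.
exact: le_trans (ler0n _ _) le.
Qed.

(** The product of X by X over the field of order 2 has a coefficient 1 at an
    address where the input holds 0. *)
Lemma mul_bound_1 : 1 <= M 1.
Proof.
have sX : (size ('X : {poly 'F_2}) <= 2)%N by rewrite size_polyX.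
have [c [t [ex out le]]] := mulM sX sX.
apply: le_trans le; rewrite (ler_nat _ 1) lt0n; apply/eqP => c0.
have := congr1 (nth 0 ^~ 2%N) out; rewrite size_mkseq !nth_mkseq //.
rewrite (exec0_free ex c0) /= -expr2 coefXn eqxx !polyseqX /=.
by move/eqP; rewrite eq_sym oner_eq0.
Qed.

Definition mul_steps (n : nat) : nat := Num.truncn (M n).

Lemma mul_steps_le n : (mul_steps n)%:R <= M n.
Proof. by rewrite truncn_le mul_bound_ge0. Qed.

(** Costs are natural numbers, so the integer part of [M] bounds them as well. *)
Lemma exec_of_steps (F : finFieldType) p (s t : state F) k :
  steps mul_steps p s k t ->
  exists2 c, exec_with w mul p s c t & (c <= unit_cost w p * k)%N.
Proof.
apply: steps_exec => n f g sf sg; have [c [t' [ex out le]]] := mulM sf sg.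
by exists c, t'; split=> //; rewrite truncn_ge_nat ?mul_bound_ge0.
Qed.

Hypothesis growM : multiplication_growth M.

Lemma mul_bound_linear k n : (0 < k <= n)%N -> n%:R * M k <= k%:R * M n.
Proof.
case: growM => _ mono _ kn; have := mono _ _ kn; case/andP: kn => k0 kn.
have n0 : (0 < n)%N by lia.
by rewrite ler_pdivrMr ?ltr0n // mulrAC ler_pdivlMr ?ltr0n // mulrC [M n * _]mulrC.
Qed.

Lemma mul_bound_mono k n : (0 < k <= n)%N -> M k <= M n.
Proof.
move=> kn; have := mul_bound_linear kn; case/andP: kn => k0 kn le.
rewrite -(ler_pM2l (_ : 0 < n%:R)) ?ltr0n ?(leq_trans k0) //.
by apply: le_trans le _; rewrite ler_wpM2r ?mul_bound_ge0 // ler_nat.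
Qed.

Lemma mul_bound_ge n : (0 < n)%N -> n%:R <= M n.
Proof.
move=> n0; have := @mul_bound_linear 1 n; rewrite n0 mul1r => /(_ isT).
by apply: le_trans; rewrite ler_peMr ?mul_bound_1.
Qed.

Lemma mul_bound_scale (a : nat) : exists2 C : R, 0 <= C &
  forall n, (0 < n)%N -> M (a * n)%N <= C * M n.
Proof.
case: growM => _ _ /(_ a)[C HC]; exists `|C| => // n n0.
by apply: le_trans (HC n n0) _; rewrite ler_wpM2r ?mul_bound_ge0 // ler_norm.
Qed.

End Multiplication.

(** * Logarithms *)

Section Logarithm.
Variable R : realType.

Lemma lg_ge1 (x : R) : 1 <= lg x.
Proof. by rewrite /lg le_max lexx. Qed.

Lemma lg_ge0 (x : R) : 0 <= lg x.
Proof. exact: le_trans ler01 (lg_ge1 x). Qed.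

Lemma lg_ln (x : R) : ln x <= lg x.
Proof. by rewrite /lg le_max lexx orbT. Qed.

Lemma lg_mono (x y : R) : 0 < x -> x <= y -> lg x <= lg y.
Proof.
move=> x0 xy; rewrite /lg ge_max !le_max lexx /= ler_ln ?xy ?orbT //.
  by rewrite posrE (lt_le_trans x0).
Qed.

Lemma lg_lg_le (x : R) : lg (lg x) <= lg x.
Proof.
rewrite {1}/lg ge_max lg_ge1 /=; have := @le_ln1Dx R (lg x - 1).
rewrite (addrC 1) subrK => le; apply: (le_trans (le _)).
  by have := lg_ge1 x; lra.
by rewrite gerBl.
Qed.

Lemma ln_2_le1 : ln (2 : R) <= 1.
Proof. by have := @le_ln1Dx R 1; rewrite -natr1 addrC => -> //; lra. Qed.

Lemma lg_double (n : nat) : (0 < n)%N -> lg (2 * n)%:R <= 2 * lg n%:R :> R.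
Proof.
move=> n0; rewrite {1}/lg ge_max; have l1 := lg_ge1 (n%:R : R).
apply/andP; split; first by lra.
rewrite natrM lnM ?posrE ?ltr0n //; have := ln_2_le1; have := lg_ln (n%:R : R).
lra.
Qed.

(** Converts binary logarithms to [lg]; both T and r are below this multiple. *)
Definition log_const : R := 3 + 3 * (ln 2)^-1.

Lemma ln2_gt0 : 0 < ln (2 : R).
Proof. by apply: ln_gt0; rewrite ltr1n. Qed.

Lemma log_const_gt0 : 0 < log_const.
Proof. by have := ln2_gt0; rewrite -invr_gt0 /log_const => ?; lra. Qed.

Lemma pow2_le_lg (k n : nat) : (2 ^ k <= n)%N ->
  k%:R <= (ln 2)^-1 * lg n%:R :> R.
Proof.
move=> kn; have n0 : (0 < n)%N by rewrite (leq_trans _ kn) // expn_gt0.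
rewrite mulrC ler_pdivlMr ?ln2_gt0 // mulr_natl -lnXn ?ltr0n // -natrX.
apply: le_trans (lg_ln _); rewrite ler_ln ?posrE ?ltr0n ?expn_gt0 //.
by rewrite ler_nat.
Qed.

End Logarithm.

(** * Asymptotic bounds *)

Section Bounds.
Variables (R : realType) (w : nat) (mul : cmd) (M : nat -> R).
Hypotheses (mulM : multiplication_cost w mul M) (growM : multiplication_growth M).
Variables (i : params) (pts : seq (pF i * pF i)).
Hypotheses (Hi : code_setting i) (Hpts : point_list pts).
Notation F := (pF i).
Notation N := (units_card F).
Notation q := (pq i).
Notation r := (pr i).
Notation e := (pe i).
Notation m := (pm i).
Notation n := (point_count i).
Notation P := (mul_steps M).
Notation T := (trunc_log 2 N).+1.
Let PD := params_data Hi Hpts.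
Let CS := pd_curve PD.

Lemma point_count_gt0 : (0 < n)%N.
Proof. by have := pd_m PD; lia. Qed.

(** As M(n)/n is nondecreasing, a call of size 2a costs at most the fraction
    2a/k of a call of size k; the number of calls makes up for the fraction. *)
Lemma transforms_le (d k : nat) :
  (0 < k)%N -> (2 * N <= k)%N -> (2 * (e * N) <= d * k)%N ->
  (e * P (2 * N) + N * P (2 * e))%:R <= 2 * (d%:R * M k).
Proof.
move=> k0 Nk eNk; have e0 := cs_e0 CS; have N0 := units_card_gt0 F.
have eN := e_le_N PD.
have part a c : (0 < a)%N -> (2 * a <= k)%N -> (2 * (c * a) <= d * k)%N ->
    (c * P (2 * a))%:R <= d%:R * M k.
  move=> a0 ak cak.
  have := @mul_bound_linear _ _ growM (2 * a) k.
  rewrite ak muln_gt0 a0 => /(_ isT) lin.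
  rewrite -(ler_pM2l (_ : 0 < (k%:R : R))) ?ltr0n //.
  rewrite natrM mulrCA; apply: (@le_trans _ _ (c%:R * (k%:R * M (2 * a)))).
    by rewrite ler_wpM2l // ler_wpM2l // (mul_steps_le mulM).
  apply: (@le_trans _ _ (c%:R * ((2 * a)%:R * M k))); first by rewrite ler_wpM2l.
  rewrite !mulrA -!natrM ler_wpM2r ?(mul_bound_ge0 mulM) // ler_nat mulnCA.
  by rewrite [(k * d)%N]mulnC.
rewrite natrD [leRHS]mulrDl !mul1r lerD //; first exact: part.
by apply: part => //; [lia|rewrite [(N * e)%N]mulnC].
Qed.

Lemma T_le_lg (k : nat) : (N <= 2 * k)%N -> (0 < k)%N ->
  T%:R <= log_const R * lg k%:R.
Proof.
move=> Nk k0; have := @pow2_le_lg R (trunc_log 2 N) (2 * k).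
rewrite (leq_trans (trunc_logP _ (units_card_gt0 F))) // => /(_ isT).
have := lg_double R k0; have := lg_ge1 (k%:R : R); rewrite -natr1 /log_const.
have : 0 < (ln 2)^-1 :> R by rewrite invr_gt0 ln2_gt0.
move: (ln 2)^-1 (lg k%:R) (lg (2 * k)%:R) => l x y l0 x1 y2 le.
have : l * y <= l * (2 * x) by rewrite ler_wpM2l // ltW.
nra.
Qed.

Lemma encoder_bound C4 :
  (forall n, (0 < n)%N -> M (4 * n)%N <= C4 * M n) -> 0 <= C4 ->
  (encoder_cost F P q r e m n)%:R <=
  (500 * log_const R + 2 * C4) * (M (m + n)%N * lg (m + n)%:R).
Proof.
move=> HC C0; have n0 := point_count_gt0; have Nn := N_lt_n PD.
have eNn := e_N_le PD.
have Mmn : M n <= M (m + n)%N by apply: (mul_bound_mono mulM growM); rewrite n0 leq_addl.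
have M0 := mul_bound_ge0 mulM (m + n)%N; have nM := mul_bound_ge mulM growM n0.
have l1 := lg_ge1 ((m + n)%:R : R).
have lmono : lg n%:R <= lg (m + n)%:R :> R.
  by apply: lg_mono; rewrite ?ltr0n // ler_nat leq_addl.
have K0 := log_const_gt0 R.
have TK : T%:R <= log_const R * lg (m + n)%:R.
  by apply: le_trans (T_le_lg (ltnW Nn) n0) _; rewrite ler_wpM2l // ltW.
have nTK : (n * T)%:R <= log_const R * (M (m + n)%N * lg (m + n)%:R).
  rewrite natrM mulrCA; apply: ler_pM => //; exact: le_trans nM Mmn.
have X : (e * P (2 * N) + N * P (2 * e))%:R <=
    2 * C4 * (M (m + n)%N * lg (m + n)%:R).
  apply: le_trans (@transforms_le 1 (4 * n) _ _ _) _; [lia|lia|lia|].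
  rewrite mul1r -mulrA ler_wpM2l //; apply: le_trans (HC n n0) _.
  rewrite ler_wpM2l // (le_trans Mmn) // ler_peMr //.
apply: (@le_trans _ _ (500 * (n * T) + (e * P (2 * N) + N * P (2 * e)))%:R).
  by rewrite ler_nat; exact: encoder_cost_le PD.
by rewrite natrD [leRHS]mulrDl lerD // natrM -mulrA ler_wpM2l.
Qed.

Lemma unencoder_bound C2 :
  (forall n, (0 < n)%N -> M (2 * n)%N <= C2 * M n) -> 0 <= C2 ->
  (unencoder_cost F P q r e m n)%:R <=
  (1000 * log_const R + 2 * C2) *
  (e%:R * M (q ^ r)%N * lg (q ^ r)%:R).
Proof.
move=> HC C0; have cN := card_N PD; have e0 := cs_e0 CS.
have Q0 : (0 < q ^ r)%N by rewrite -cN.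
have M0 := mul_bound_ge0 mulM (q ^ r)%N; have QM := mul_bound_ge mulM growM Q0.
have l1 := lg_ge1 ((q ^ r)%:R : R); have K0 := log_const_gt0 R.
have TK : T%:R <= log_const R * lg (q ^ r)%:R by apply: T_le_lg => //; lia.
have rK : r%:R <= log_const R * lg (q ^ r)%:R.
  have : (2 ^ r <= q ^ r)%N by rewrite leq_exp2r ?(q_gt1 CS) // (r_gt0 CS).
  move/(@pow2_le_lg R)/le_trans; apply; rewrite ler_wpM2r ?lg_ge0 //.
  by have := ln2_gt0 R; rewrite -invr_gt0 /log_const => ?; lra.
have eM : (e * q ^ r)%:R <= e%:R * M (q ^ r)%N by rewrite natrM ler_wpM2l.
have eM0 : 0 <= e%:R * M (q ^ r)%N by rewrite mulr_ge0.
have S : (e * q ^ r * (T + r))%:R <=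
    2 * log_const R * (e%:R * M (q ^ r)%N * lg (q ^ r)%:R).
  rewrite natrM natrD mulrCA; apply: ler_pM => //; first by rewrite addr_ge0.
  by rewrite -mulrA [leRHS]mulrDl !mul1r lerD.
have X : (e * P (2 * N) + N * P (2 * e))%:R <=
    2 * C2 * (e%:R * M (q ^ r)%N * lg (q ^ r)%:R).
  apply: le_trans (@transforms_le e (2 * q ^ r) _ _ _) _; [lia|lia| |].
    by rewrite mulnCA leq_mul2l leq_mul2l -cN leqnSn !orbT.
  rewrite -[leRHS]mulrA ler_wpM2l //.
  apply: (@le_trans _ _ (e%:R * (C2 * M (q ^ r)%N))).
    by rewrite ler_wpM2l // HC.
  by rewrite mulrCA ler_wpM2l // ler_peMr.
apply: (@le_trans _ _ (500 * (e * q ^ r * (T + r)) +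
                       (e * P (2 * N) + N * P (2 * e)))%:R).
  by rewrite ler_nat; exact: unencoder_cost_le PD.
rewrite natrD [leRHS]mulrDl lerD // natrM.
apply: (@le_trans _ _ (500 * (2 * log_const R * (e%:R * M (q ^ r)%N * lg (q ^ r)%:R)))).
  by rewrite ler_wpM2l.
by rewrite !mulrA -natrM.
Qed.

End Bounds.

(** The three logarithms of k, among them a double one, are at most twice the
    logarithm of l. *)
Lemma quasilinear (R : realType) (C y : R) (k l : nat) :
  0 <= C -> (0 < k <= 2 * l)%N ->
  y <= C * (k%:R * lg k%:R * lg (lg k%:R)) ->
  y * lg k%:R <= 16 * C * (l%:R * lg l%:R ^+ 3).
Proof.
move=> C0 /andP[k0 kl] yk; have l0 : (0 < l)%N by lia.
have lk : lg k%:R <= 2 * lg l%:R :> R.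
  apply: le_trans (lg_double R l0); apply: lg_mono; rewrite ?ltr0n //.
  by rewrite ler_nat.
have llk := le_trans (lg_lg_le (k%:R : R)) lk.
have k1 := lg_ge0 (k%:R : R); have ll1 := lg_ge0 (lg k%:R : R).
apply: (@le_trans _ _ (C * (k%:R * lg k%:R * lg (lg k%:R)) * lg k%:R)).
  by rewrite ler_wpM2r.
apply: (@le_trans _ _ (C * ((2 * l)%:R * (2 * lg l%:R) * (2 * lg l%:R)) *
                       (2 * lg l%:R))); last first.
  by rewrite natrM le_eqVlt; apply/orP; left; apply/eqP; ring.
apply: ler_pM => //; first by rewrite !mulr_ge0.
rewrite ler_wpM2l //; apply: ler_pM => //; first by rewrite mulr_ge0.
by apply: ler_pM => //; rewrite ler_nat.
Qed.

Lemma point_list_enum i : point_list (i := i) (enum (P_Ne i)).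
Proof. by split; [exact: enum_uniq|move=> x; rewrite mem_enum]. Qed.

Theorem corollaryV8 (R : realType) (w : nat) (mul : cmd) (M : nat -> R) :
  multiplication_cost w mul M ->
  multiplication_growth M ->
  let n (i : params) : nat := #|P_Ne i| in
  let enc_bound (i : params) : R :=
    M (pm i + n i)%N * lg (pm i + n i)%:R in
  let unenc_bound (i : params) : R :=
    (pe i)%:R * M (pq i ^ pr i)%N * lg (pq i ^ pr i)%:R in
  (forall i : params, setting i ->
     n i = (pe i * (pq i ^ pr i - pq i ^ (pr i).-1))%N) /\
  exists enc unenc : cmd,
    [/\ encodes_in w mul enc enc_bound,
        softO code_setting enc_bound (fun i => (n i)%:R),
        unencodes_in w mul unenc unenc_bound
      & softO code_setting unenc_bound (fun i => (n i)%:R)].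
Proof.
move=> mulM growM n enc_bound unenc_bound.
split; first by move=> i Si; exact: card_P_Ne.
have [C4 C40 HC4] := mul_bound_scale mulM growM 4.
have [C2 C20 HC2] := mul_bound_scale mulM growM 2.
have [[C0 HC0] _ _] := growM.
have M_up k : (0 < k)%N -> M k <= `|C0| * (k%:R * lg k%:R * lg (lg k%:R)).
  move=> k0; apply: le_trans (HC0 k k0) _; rewrite ler_wpM2r ?ler_norm //.
  by rewrite !mulr_ge0 // lg_ge0.
have pos i : code_setting i -> (0 < n i)%N.
  by move=> Hi; exact: (point_count_gt0 Hi (point_list_enum i)).
exists encoder, unencoder; split.
- exists ((unit_cost w encoder)%:R * (500 * log_const R + 2 * C4)).
  move=> i Hi pts Hpts f Hf.
  have [k [t [st out le]]] := encoder_correct Hi Hpts Hf (mul_steps M).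
  have [c ex cle] := exec_of_steps mulM st; exists c, t; split=> //.
  apply: (@le_trans _ _ (unit_cost w encoder * k)%:R); first by rewrite ler_nat.
  rewrite natrM -mulrA ler_wpM2l //.
  apply: le_trans (encoder_bound mulM growM Hi Hpts HC4 C40).
  by rewrite ler_nat.
- exists 3%N, (16 * `|C0|) => i Hi.
  apply: quasilinear => //; last by apply: M_up; rewrite addn_gt0 pos ?orbT.
  by rewrite addn_gt0 pos // orbT mul2n -addnn leq_add2r ltnW // Hi.2.
- exists ((unit_cost w unencoder)%:R * (1000 * log_const R + 2 * C2)).
  move=> i Hi pts Hpts f Hf.
  have [k [t [st out le]]] := unencoder_correct Hi Hpts Hf (mul_steps M).
  have [c ex cle] := exec_of_steps mulM st; exists c, t; split=> //.
  apply: (@le_trans _ _ (unit_cost w unencoder * k)%:R); first by rewrite ler_nat.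
  rewrite natrM -mulrA ler_wpM2l //.
  apply: le_trans (unencoder_bound mulM growM Hi Hpts HC2 C20).
  by rewrite ler_nat.
- exists 3%N, (16 * `|C0|) => i Hi.
  have PD := params_data Hi (point_list_enum i).
  have eQ := e_N_le PD; have cN := card_N PD; rewrite cN in eQ.
  have e0 := cs_e0 (pd_curve PD).
  have Q0 : (0 < pq i ^ pr i)%N by rewrite -cN.
  have QeQ : (pq i ^ pr i <= pe i * pq i ^ pr i)%N by rewrite leq_pmull.
  have lQ : lg (pq i ^ pr i)%:R <= lg (pe i * pq i ^ pr i)%:R :> R.
    by apply: lg_mono; rewrite ?ltr0n // ler_nat.
  apply: (@le_trans _ _ ((pe i)%:R * M (pq i ^ pr i)%N *
                         lg (pe i * pq i ^ pr i)%:R)).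
    by rewrite ler_wpM2l // mulr_ge0 // (mul_bound_ge0 mulM).
  apply: quasilinear => //; first by rewrite (leq_trans Q0 QeQ).
  apply: (@le_trans _ _ ((pe i)%:R * (`|C0| * ((pq i ^ pr i)%:R *
            lg (pq i ^ pr i)%:R * lg (lg (pq i ^ pr i)%:R))))).
    by rewrite ler_wpM2l // M_up.
  rewrite mulrCA ler_wpM2l // natrM !mulrA -!mulrA ler_wpM2l // ler_wpM2l //.
  by apply: ler_pM => //; rewrite ?lg_ge0 // -?natrM // lg_mono // (lt_le_trans ltr01 (lg_ge1 _)).
Qed.
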